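(* Let $p>3$ be a prime. If $p\equiv1\pmod3$, write $p=x^2+3y^2$ with integers $x,y$, $x\equiv1\pmod3$ and $y\equiv0$ or $1\pmod3$, and set $u=-2x$ if $3\mid y$ and $u=x-3y$ if $3\mid y-1$; then $$\sum_{k=0}^{p-1}(12k+1)\binom{-1/6}k^4\equiv-pu+\frac{p^2}u+\frac{p^3}{u^3}\pmod{p^4}.$$ If $p\equiv2\pmod3$, then $$\sum_{k=0}^{p-1}(12k+1)\binom{-1/6}k^4\equiv\frac{20\cdot2^{\frac{p+1}3}(2^{p-1}+3p-4)p^2}{3\binom{2(p+1)/3}{(p+1)/3}}\pmod{p^4}.$$
   Context: The general binomial coefficient is $\binom a0=1$, $\binom ak=a(a-1)\cdots(a-k+1)/k!$ for $k\ge1$. Congruences are in the ring of rationals with denominators prime to $p$. *)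

(* Defs.v *)
From mathcomp Require Import all_boot all_order all_algebra.

Set Implicit Arguments.
Unset Strict Implicit.
Unset Printing Implicit Defensive.

Import Order.TTheory GRing.Theory Num.Theory.
Local Open Scope ring_scope.

Definition gbinom (a : rat) (k : nat) : rat :=
  (\prod_(i < k) (a - i%:R)) / (k`!)%:R.

(* The ring of rationals with denominator prime to p; denq r is the
   denominator of r in lowest terms. *)
Definition pintegral (p : nat) : pred rat :=
  [pred r : rat | coprime p `|denq r|].

(* a = b (mod m) as a congruence in that ring: both sides belong to the ring
   and their difference is a multiple of m in the ring. *)
Definition pcongr (p m : nat) (a b : rat) : Prop :=
  [/\ a \in pintegral p, b \in pintegral p
    & exists2 c : rat, c \in pintegral p & a - b = m%:R * c].

(* Main.v *)
(* Put a = 1/6 and choose n < p and t in pZ_(p) with a - t = -n, so that the sum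
   stops at n.  Writing f(x) = (a-x)_k/(1+x)_k, the identity
   f(0)^3 = 3 f(0)^2 f(t) - 3 f(0) f(t)^2 + f(t)^3 - (f(t) - f(0))^3 reduces the
   sum modulo p^4 to three terminating very-well-poised 5F4 sums, since the last
   term contributes 0 by the antisymmetry k <-> n - k.

   For p = 6n + 1 the closed form equals -p J modulo p^4, where J is the Jacobi
   sum J(chi^-1, chi^2) of the sextic character taken in Z_p: with x^p = x, the
   power (1-x)^(2 n p^2) is modulo p^3 a combination of (1-x)^(2n), (1-x)^(8n)
   and (1-x)^(14n), so that J becomes a combination of binomial coefficients.
   Substituting v = (1-x)^2/x turns J into sum_v kap(v) rho(v+4) with kap cubic
   and rho quadratic.  Hence J = A + B om + C om^2 with integers A, B, C whose
   norm is p and whose residues modulo 2 and 3 are known; these force the trace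
   3A + 1 to be u.  So J is the unit root of X^2 - u X + p, which is
   u - p/u - p^2/u^3 modulo p^3.

   For p = 6k + 5 the closed form is p^2 times a product of factorials, compared
   with the right-hand side through C(2m,m) = 4^m (1/2)_m/m! and
   1/2 = p/2 - (p-1)/2. *)
Require Import Defs.
From HB Require Import structures.
From mathcomp Require Import all_boot all_order all_algebra.
From mathcomp Require Import cyclic finfield ring lra zify.

Set Implicit Arguments.
Unset Strict Implicit.
Unset Printing Implicit Defensive.

Import Order.TTheory GRing.Theory Num.Theory.
Local Open Scope ring_scope.

(** * Rationals with denominator prime to p *)

(** The replacement of f(0)^3 works because p divides t: f(t) - f(0) is p times an explicit factor,
    so beyond p^3 its cube matters only modulo p, where the antisymmetry is exact. Every other term
    of the identity contains f(t) = (-n)_k/(1+t)_k, which makes its series terminate. The closed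
    form keeps one factor p when p = 6n + 1 and two when p = 6k + 5; the remaining products of
    factorials are needed modulo p^3 and p^2, hence second-order expansions in the first case and
    first-order ones, with harmonic numbers, in the second. No p-adic completion or complex
    character occurs: a Teichmueller representative is a rational number x^(p^2), right modulo p^3,
    and J is a rational number. The norm p alone leaves the trace open up to conjugation and the six
    Eisenstein units. This is why J is expressed through integer character sums over the three cubic
    classes: their parities and residues modulo 3 single out the unit. The second root of X^2 - u X
    + p is divisible by p, so J is told apart from it by being a unit. *)

Lemma pintegralP (p : nat) (r : rat) :
  reflect (exists2 d : nat, coprime p d & exists z : int, r = z%:~R / d%:R)
    (r \in pintegral p).
Proof.
apply: (iffP idP) => [|[d cpd [z ->]]].
  rewrite inE => cp; exists `|denq r|%N => //; exists (numq r).
  by rewrite -[in LHS](divq_num_den r) -[in LHS]absz_denq.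
rewrite inE; case: (posnP d) cpd => [->|d_gt0] cpd.
  by rewrite invr0 mulr0 (_ : denq 0 = 1) ?coprimen1.
apply: (coprime_dvdr _ cpd).
suff: (denq (z%:Q / d%:Q) %| d%:Z)%Z by [].
have := divqP z d%:Z; case => [d0|k q k_neq0]; last exact: dvdz_mull.
by rewrite /= dvdz0.
Qed.

Lemma pintegral_subring (p : nat) : subring_closed (pintegral p).
Proof.
have subA x y : x \in pintegral p -> y \in pintegral p ->
    x - y \in pintegral p /\ x * y \in pintegral p.
  move=> /pintegralP [d cd [z ->]] /pintegralP [d' cd' [z' ->]].
  (* A zero denominator is coprime to p only for p = 1; the fraction is then 0 by the convention 1/0
     = 0. *)
  have [->|d0] := eqVneq d 0%N.
    rewrite invr0 mulr0 mul0r sub0r; split; last first.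
      by apply/pintegralP; exists 1%N; [exact: coprimen1|exists 0; rewrite mul0r].
    by apply/pintegralP; exists d' => //; exists (- z'); rewrite rmorphN mulNr.
  have [->|d'0] := eqVneq d' 0%N.
    rewrite invr0 !mulr0 subr0; split; last first.
      by apply/pintegralP; exists 1%N; [exact: coprimen1|exists 0; rewrite mul0r].
    by apply/pintegralP; exists d => //; exists z.
  have cdd : coprime p (d * d') by rewrite coprimeMr cd.
  split; apply/pintegralP; exists (d * d')%N => //.
    exists (z * d'%:Z - z' * d%:Z).
    rewrite natrM rmorphB !rmorphM /=.
    rewrite -!pmulrn.
    by field; rewrite !pnatr_eq0 d0 d'0.
  exists (z * z'); rewrite natrM rmorphM /=.
  by field; rewrite !pnatr_eq0 d0 d'0.
split.
- by apply/pintegralP; exists 1%N; [exact: coprimen1|exists 1].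
- by move=> x y hx hy; case: (subA _ _ hx hy).
- by move=> x y hx hy; case: (subA _ _ hx hy).
Qed.

HB.instance Definition _ (p : nat) :=
  GRing.isSubringClosed.Build rat (pintegral p) (pintegral_subring p).

Lemma pintegral_natV (p k : nat) : coprime p k -> (k%:R : rat)^-1 \in pintegral p.
Proof.
by move=> cpk; apply/pintegralP; exists k => //; exists 1; rewrite mul1r.
Qed.

(** The conjunct [r != 0] matters: the inverse of 0 is 0 by convention, hence integral. *)
Definition punit (p : nat) : pred rat :=
  [pred r | [&& r != 0, r \in pintegral p & r^-1 \in pintegral p]].

Lemma punitE p r :
  (r \in punit p) = [&& r != 0, r \in pintegral p & r^-1 \in pintegral p].
Proof. by []. Qed.

Lemma punit_int p r : r \in punit p -> r \in pintegral p.
Proof. by rewrite punitE => /and3P []. Qed.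

Lemma punit_neq0 p r : r \in punit p -> r != 0.
Proof. by rewrite punitE => /and3P []. Qed.

Lemma punitVr p r : r \in punit p -> r^-1 \in punit p.
Proof.
by rewrite !punitE => /and3P [r0 rZ rV]; rewrite invr_neq0 // invrK rV rZ.
Qed.

Lemma punitV_int p r : r \in punit p -> r^-1 \in pintegral p.
Proof. by rewrite punitE => /and3P []. Qed.

Lemma punitM p r s : r \in punit p -> s \in punit p -> r * s \in punit p.
Proof.
rewrite !punitE => /and3P [r0 rZ rV] /and3P [s0 sZ sV].
rewrite mulf_neq0 //= invfM; apply/andP; split; exact: rpredM.
Qed.

Lemma punit1 p : 1 \in punit p.
Proof. by rewrite punitE oner_neq0 invr1 rpred1. Qed.

Lemma punitN p r : r \in punit p -> - r \in punit p.
Proof. by rewrite !punitE oppr_eq0 invrN !rpredN. Qed.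

Lemma punitX p r k : r \in punit p -> r ^+ k \in punit p.
Proof.
by move=> ru; elim: k => [|k IH]; rewrite ?expr0 ?punit1 // exprS punitM.
Qed.

Lemma punit_prod p (I : eqType) (s : seq I) (P : pred I) (F : I -> rat) :
  (forall i, i \in s -> P i -> F i \in punit p) ->
  \prod_(i <- s | P i) F i \in punit p.
Proof.
move=> h; rewrite big_seq_cond.
elim/big_rec: _ => [|i x /andP [/h hi Pi] xu]; first exact: punit1.
by apply: punitM => //; apply: hi.
Qed.

Lemma punit_nat p k : prime p -> ~~ (p %| k)%N -> k%:R \in punit p.
Proof.
move=> pp npk; rewrite punitE pnatr_eq0 rpred_nat; apply/and3P; split=> //.
  by apply: contraNneq npk => ->; rewrite dvdn0.
by apply: pintegral_natV; rewrite prime_coprime.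
Qed.

(* Unlike pcongr, a and b themselves need not be p-integral. *)
Definition cg (p e : nat) (a b : rat) : Prop :=
  exists2 c, c \in pintegral p & a = b + p%:R ^+ e * c.

Section Congruence.
Variables (p : nat).
Implicit Types (e : nat) (a b c d : rat).

Lemma cg_refl e a : cg p e a a.
Proof. by exists 0; rewrite ?rpred0 // mulr0 addr0. Qed.

Lemma cg_sym e a b : cg p e a b -> cg p e b a.
Proof.
by case=> c cZ ->; exists (- c); rewrite ?rpredN // mulrN addrK.
Qed.

Lemma cg_trans e b a c : cg p e a b -> cg p e b c -> cg p e a c.
Proof.
by case=> x xZ -> [y yZ ->]; exists (y + x); rewrite ?rpredD // mulrDr addrA.
Qed.

Lemma cg_int e a b : cg p e a b -> b \in pintegral p -> a \in pintegral p.
Proof.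
by case=> c cZ -> bZ; rewrite rpredD // rpredM // rpredX // rpred_nat.
Qed.

Lemma cgD e a b c d : cg p e a b -> cg p e c d -> cg p e (a + c) (b + d).
Proof.
by case=> x xZ -> [y yZ ->]; exists (x + y); rewrite ?rpredD //; ring.
Qed.

Lemma cgN e a b : cg p e a b -> cg p e (- a) (- b).
Proof. by case=> x xZ ->; exists (- x); rewrite ?rpredN //; ring. Qed.

Lemma cgB e a b c d : cg p e a b -> cg p e c d -> cg p e (a - c) (b - d).
Proof. by move=> h1 h2; apply: cgD => //; exact: cgN. Qed.

Lemma cgMl e c a b : c \in pintegral p -> cg p e a b -> cg p e (c * a) (c * b).
Proof. by move=> cZ [x xZ ->]; exists (c * x); rewrite ?rpredM //; ring. Qed.

Lemma cgMr e c a b : c \in pintegral p -> cg p e a b -> cg p e (a * c) (b * c).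
Proof. by rewrite ![_ * c]mulrC; exact: cgMl. Qed.

Lemma cgM e a b c d : b \in pintegral p -> c \in pintegral p ->
  cg p e a b -> cg p e c d -> cg p e (a * c) (b * d).
Proof. by move=> bZ cZ h1 h2; apply: cg_trans (cgMr cZ h1) (cgMl bZ h2). Qed.

Lemma cgX e k a b : a \in pintegral p -> b \in pintegral p ->
  cg p e a b -> cg p e (a ^+ k) (b ^+ k).
Proof.
move=> aZ bZ h; elim: k => [|k IH]; first exact: cg_refl.
by rewrite !exprS; apply: cgM => //; exact: rpredX.
Qed.

Lemma cg_sum e (I : eqType) (s : seq I) (P : pred I) (F G : I -> rat) :
  (forall i, i \in s -> P i -> cg p e (F i) (G i)) ->
  cg p e (\sum_(i <- s | P i) F i) (\sum_(i <- s | P i) G i).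
Proof.
move=> h; rewrite big_seq_cond [X in cg _ _ _ X]big_seq_cond.
elim/big_rec2: _ => [|i x y /andP [/h hi Pi] xy]; first exact: cg_refl.
by apply: cgD => //; exact: hi.
Qed.

Lemma cg_weak e' e a b : (e <= e')%N -> cg p e' a b -> cg p e a b.
Proof.
move=> le [c cZ ->]; exists (p%:R ^+ (e' - e) * c).
  by rewrite rpredM // rpredX // rpred_nat.
by rewrite mulrA -exprD subnKC.
Qed.

Lemma cg_pM k e a b : cg p e a b -> cg p (k + e) (p%:R ^+ k * a) (p%:R ^+ k * b).
Proof. by case=> c cZ ->; exists c => //; rewrite exprD; ring. Qed.

Lemma cg_pMl e a b : cg p e a b -> cg p e.+1 (p%:R * a) (p%:R * b).
Proof. exact: (@cg_pM 1). Qed.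

Lemma cg_cancel e c a b : c \in punit p -> cg p e (c * a) (c * b) -> cg p e a b.
Proof.
move=> cu h; have c0 := punit_neq0 cu.
by have := cgMl (punitV_int cu) h; rewrite !mulKf.
Qed.

Lemma cgV e a b : a \in punit p -> b \in punit p ->
  cg p e a b -> cg p e a^-1 b^-1.
Proof.
move=> au bu h; have a0 := punit_neq0 au; have b0 := punit_neq0 bu.
apply: (cg_cancel (punitM au bu)).
by rewrite mulrC mulKf // mulfK //; exact: cg_sym.
Qed.

Lemma cgP e a b : cg p e a b <-> cg p e (a - b) 0.
Proof.
split=> [[c cZ ->]|[c cZ e']]; exists c => //; first by rewrite add0r addrC addKr.
by rewrite -[a](subrK b) e' add0r addrC.
Qed.

Hypothesis pp : prime p.

Lemma p_neq0 : (p%:R : rat) != 0.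
Proof. by rewrite pnatr_eq0 -lt0n prime_gt0. Qed.

(** The ring is local: everything depends on whether p divides the numerator. *)
Lemma punit_or r : r \in pintegral p -> r \in punit p \/ cg p 1 r 0.
Proof.
case/pintegralP=> d cpd [z ->].
have du : d%:R \in punit p.
  apply: punit_nat => //; apply/negP=> /gcdn_idPl e; move: cpd.
  by rewrite /coprime e; move: (prime_gt1 pp); case: eqP => // ->.
have [/dvdzP [k ->]|npz] := boolP (p %| z)%Z.
  right; exists (k%:~R / d%:R).
    by rewrite rpredM ?rpred_int // punitV_int.
  by rewrite rmorphM /= -pmulrn; ring.
left; apply: punitM; last exact: punitVr.
have : `|z|%:R \in punit p by apply: punit_nat.
rewrite [z in z%:~R]intEsign rmorphM /= -pmulrn.
by case: (z < 0); rewrite ?expr1 ?expr0 ?rmorphN1 ?mulN1r ?mul1r // => /punitN.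
Qed.

Lemma punit_not0 r : r \in punit p -> ~ cg p 1 r 0.
Proof.
move=> ru [c cZ]; rewrite add0r => e.
have /pintegralP [d cpd [z]] : (p%:R)^-1 \in pintegral p.
  have c0 : c != 0 by apply: contraTneq (punit_neq0 ru) => c0; rewrite e c0 mulr0 eqxx.
  have -> : p%:R^-1 = c * r^-1 by rewrite e expr1 invfM mulrCA divff // mulr1.
  by rewrite rpredM // punitV_int.
have d0 : d != 0%N.
  by apply: contraTneq cpd => ->; rewrite /coprime gcdn0; move: (prime_gt1 pp);
    case: p => [|[]].
move/eqP; rewrite -[_^-1]mul1r eqr_div ?p_neq0 ?pnatr_eq0 // mul1r.
rewrite !pmulrn -rmorphM /= eqr_int => /eqP dz.
have : (p %| d)%N by have : (p %| d%:Z)%Z by rewrite dz dvdz_mull.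
move=> pd; have := cpd; rewrite prime_coprime // => /negP; exact.
Qed.

(** Being a unit depends only on the residue modulo p; products whose factors are shifted by
    multiples of p are recognised as units in this way. *)
Lemma punit_cg e a b : (0 < e)%N -> cg p e a b -> b \in punit p -> a \in punit p.
Proof.
move=> e0 h bu; have h1 := cg_weak e0 h.
have aZ : a \in pintegral p by apply: cg_int h (punit_int bu).
case: (punit_or aZ) => // a0.
by case: (punit_not0 bu); apply: cg_trans (cg_sym h1) a0.
Qed.

End Congruence.

Lemma cg_pcongr p e (a b : rat) : cg p e a b -> b \in pintegral p -> pcongr p (p ^ e) a b.
Proof.
move=> h bZ; split=> //; first exact: cg_int h bZ.
by have [c cZ ->] := h; exists c => //; rewrite natrX addrAC subrr add0r.
Qed.

Lemma pintegralD p x y : x \in pintegral p -> y \in pintegral p ->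
  x + y \in pintegral p.
Proof. exact: rpredD. Qed.

Lemma pintegralN p x : x \in pintegral p -> - x \in pintegral p.
Proof. by rewrite rpredN. Qed.

Lemma pintegralM p x y : x \in pintegral p -> y \in pintegral p ->
  x * y \in pintegral p.
Proof. exact: rpredM. Qed.

Lemma pintegralX p x k : x \in pintegral p -> x ^+ k \in pintegral p.
Proof. exact: rpredX. Qed.

Lemma pintegral_nat p k : k%:R \in pintegral p.
Proof. exact: rpred_nat. Qed.

Lemma pintegral1 p : 1 \in pintegral p.
Proof. exact: rpred1. Qed.

Lemma pintegral0 p : 0 \in pintegral p.
Proof. exact: rpred0. Qed.

Lemma pintegral_z p (k : int) : k%:~R \in pintegral p.
Proof. exact: rpred_int. Qed.

Ltac zint := repeat match goal with
  | |- is_true (@in_mem _ ?x _) => match x with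
    | (_ + _)%R => refine (pintegralD _ _)
    | (- _)%R => refine (pintegralN _)
    | (_ * _)%R => refine (pintegralM _ _)
    | (_ ^+ _)%R => refine (pintegralX _ _)
    | (_%:R)%R => exact: pintegral_nat
    | (_%:~R)%R => exact: pintegral_z
    | 1%R => exact: pintegral1
    | 0%R => exact: pintegral0
    end
  | H : is_true (@in_mem _ ?y _) |- is_true (@in_mem _ ?x _) =>
    constr_eq x y; first [exact H | exact (punit_int H)]
  | H : is_true (@in_mem _ ?x _) |- is_true (@in_mem _ ?x^-1 _) =>
    exact (punitV_int H)
  end.

(** * Dougall's well-poised summation *)

Definition rising (a : rat) (k : nat) : rat := \prod_(i < k) (a + i%:R).

Lemma rising0 a : rising a 0 = 1.
Proof. by rewrite /rising big_ord0. Qed.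

Lemma risingS a k : rising a k.+1 = rising a k * (a + k%:R).
Proof. by rewrite /rising big_ord_recr. Qed.

Lemma risingSl a k : rising a k.+1 = a * rising (a + 1) k.
Proof.
rewrite /rising big_ord_recl addr0; congr (_ * _); apply: eq_bigr => i _.
by rewrite lift0 -addn1 natrD; ring.
Qed.

Lemma rising_gt0 a k : 0 < a -> 0 < rising a k.
Proof. by move=> a0; apply: prodr_gt0 => i _; rewrite ltr_wpDr ?ler0n. Qed.

Lemma rising_fact k : rising 1 k = k`!%:R.
Proof.
elim: k => [|k IH]; first by rewrite rising0.
by rewrite risingS IH factS natrM -nat1r; ring.
Qed.

Lemma gbinomN a k : gbinom (- a) k = (-1) ^+ k * rising a k / k`!%:R.
Proof.
rewrite /gbinom; congr (_ / _); rewrite /rising.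
elim: k => [|k IH]; first by rewrite !big_ord0 expr0 mulr1.
by rewrite !big_ord_recr /= IH exprS; ring.
Qed.

(* The k-th term of a times the very-well-poised series
   5F4(a, 1+a/2, a-x, a-y, -n; a/2, 1+x, 1+y, 1+a+n; 1). *)
Definition wp_term (a x y : rat) (n k : nat) : rat :=
  (a + 2%:R * k%:R) * rising a k * rising (a - x) k * rising (a
    - y) k * rising (- n%:R) k /
  (k`!%:R * rising (1 + x) k * rising (1 + y) k * rising (1 + a + n%:R) k).

(* Wilf-Zeilberger telescoping in k; the right-hand side vanishes at k = n+1. *)
Lemma wp_telescope (a x y : rat) n k : 0 < a -> 0 <= x -> 0 <= y ->
  \sum_(j < k.+1) ((x + n.+1%:R) * (y + n.+1%:R) * wp_term a x y n.+1 j -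
     (a + n.+1%:R) * (x + y - a + n.+1%:R) * wp_term a x y n j) =
  (a + n.+1%:R) * (rising a k.+1 * rising (a - x) k.+1 * rising (a
    - y) k.+1 * rising (- n%:R) k /
  (k`!%:R * rising (1 + x) k * rising (1 + y) k * rising (1 + a + n%:R) k.+1)).
Proof.
move=> a0 x0 y0.
have n0 : (0 : rat) <= n%:R := ler0n _ n.
elim: k => [|k IH].
  rewrite big_ord1 /wp_term !risingS !rising0 fact0 /= -!natr1.
  by field; rewrite gt_eqF //; lra.
rewrite big_ord_recr /= {}IH /wp_term.
rewrite (risingS a k.+1) (risingS (a - x) k.+1) (risingS (a - y) k.+1) (risingS (1
  + x)) (risingS (1 + y)).
rewrite (risingSl (- n.+1%:R)) (_ : - n.+1%:R + 1 = - n%:R); last by rewrite -natr1; ring.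
rewrite (risingS (- n%:R)) factS natrM.
rewrite (_ : 1 + a + n.+1%:R = 1 + a + n%:R + 1); last by rewrite -natr1; ring.
have := risingSl (1 + a + n%:R) k.+1; rewrite (risingS _ k.+1) => e.
have k0 : (0 : rat) <= k%:R := ler0n _ k.
have p1 : 0 < 1 + a + n%:R by lra.
have p2 : 0 < 1 + a + n%:R + k.+1%:R by rewrite -natr1; lra.
have {e} -> : rising (1 + a + n%:R + 1) k.+1 =
    rising (1 + a + n%:R) k.+1 * (1 + a + n%:R + k.+1%:R) / (1 + a + n%:R).
  by rewrite e mulrAC mulfV ?mul1r // gt_eqF.
have f0 : (k`!%:R : rat) != 0 by rewrite pnatr_eq0 -lt0n fact_gt0.
have q1 : rising (1 + x) k != 0 by rewrite gt_eqF // rising_gt0; lra.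
have q2 : rising (1 + y) k != 0 by rewrite gt_eqF // rising_gt0; lra.
have q3 : rising (1 + a + n%:R) k.+1 != 0 by rewrite gt_eqF // rising_gt0.
have p3 : 0 < 1 + x + k%:R by lra.
have p4 : 0 < 1 + y + k%:R by lra.
move: p2; rewrite -!natr1.
move: (rising a k.+1) (rising (a - x) k.+1) (rising (a - y) k.+1) (rising (- n%:R) k).
move: (rising (1 + x) k) (rising (1 + y) k) (rising (1 + a
  + n%:R) k.+1) (k`!%:R) q1 q2 q3 f0.
move=> P Q D f q1 q2 q3 f0 A X Y M p2.
move: (n%:R) (k%:R) n0 k0 p1 p2 p3 p4 => N K n0 k0 p1 p2 p3 p4.
field.
rewrite q1 q2 q3 f0 /=; rewrite !gt_eqF //; lra.
Qed.

(** Telescoping up to k = n+1 gives a first-order recurrence in n: the boundary term carries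
    (-n)_(n+1) = 0, and the same factor removes the (n+1)-st term of the shorter series. *)
Lemma wp_sum (a x y : rat) n : 0 < a -> 0 <= x -> 0 <= y ->
  \sum_(k < n.+1) wp_term a x y n k =
  rising a n.+1 * rising (1 - a + x + y) n / (rising (1 + x) n * rising (1 + y) n).
Proof.
move=> a0 x0 y0; elim: n => [|n IH].
  by rewrite big_ord1 /wp_term !risingS !rising0 fact0 /=; field.
have := wp_telescope n n.+1 a0 x0 y0.
have -> : rising (- n%:R) n.+1 = 0 by rewrite risingS addNr mulr0.
rewrite mulr0 mul0r mulr0 sumrB -!mulr_sumr.
rewrite [X in _ - _ * X]big_ord_recr /= IH.
have -> : wp_term a x y n n.+1 = 0.
  by rewrite /wp_term (risingS (- n%:R)) addNr !mulr0 mul0r.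
have n0 : (0 : rat) <= n%:R := ler0n _ n.
rewrite (risingS _ n.+1) (risingS (1 - a + x + y)) (risingS (1 + x)) (risingS (1 + y)).
have q1 : rising (1 + x) n != 0 by rewrite gt_eqF // rising_gt0; lra.
have q2 : rising (1 + y) n != 0 by rewrite gt_eqF // rising_gt0; lra.
rewrite -!natr1 addr0 => /eqP; rewrite subr_eq0 => /eqP e.
have p3 : 0 < x + (n%:R + 1) by lra.
have p4 : 0 < y + (n%:R + 1) by lra.
apply: (mulfI (mulf_neq0 (lt0r_neq0 p3) (lt0r_neq0 p4))); rewrite {}e.
move: (rising (1 + x) n) (rising (1 + y) n) q1 q2 => P Q q1 q2.
field.
by rewrite q1 q2 /= !gt_eqF //; lra.
Qed.

(** * Expansions of rising factorials in powers of p *)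

Definition harm (k : nat) : rat := \sum_(i < k) (i.+1%:R)^-1.

Lemma punit_lt p k : prime p -> (0 < k < p)%N -> k%:R \in punit p.
Proof. by move=> pp /andP [k0 kp]; rewrite punit_nat // gtnNdvd. Qed.

Lemma punit_fact p k : prime p -> (k < p)%N -> k`!%:R \in punit p.
Proof.
move=> pp; elim: k => [|k IH] kp; first by rewrite fact0 punit1.
rewrite factS natrM; apply: punitM; last by apply: IH; apply: ltnW.
exact: punit_lt.
Qed.

Lemma harm_int p k : prime p -> (k < p)%N -> harm k \in pintegral p.
Proof.
move=> pp kp; rewrite rpred_sum // => i _; apply: punitV_int.
by apply: punit_lt => //=; apply: leq_ltn_trans kp.
Qed.

(** The coefficient e2 is the second elementary symmetric function of the inverses. Only its
    integrality and its independence of s are used, the latter to compare expansions at several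
    shifts. *)
Lemma prod_expand p (r : seq nat) (F : nat -> rat) :
  (forall i, i \in r -> F i \in punit p) ->
  exists2 e2, e2 \in pintegral p & forall s, s \in pintegral p ->
    cg p 3 (\prod_(i <- r) (F i + p%:R * s))
      (\prod_(i <- r) F i * (1 + p%:R * s * (\sum_(i <- r) (F i)^-1)
        + (p%:R * s) ^+ 2 * e2)).
Proof.
elim: r => [|j r IH] h.
  by exists 0; rewrite ?rpred0 // => s _;
    rewrite !big_nil mulr0 !addr0 mulr0 addr0 mulr1; exact: cg_refl.
have hr i : i \in r -> F i \in punit p by move=> ir; apply: h; rewrite inE ir orbT.
have [e2 e2Z he] := IH hr.
have Fj : F j \in punit p by apply: h; rewrite mem_head.
have FjV := punitV_int Fj.
have SZ : \sum_(i <- r) (F i)^-1 \in pintegral p.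
  by rewrite big_seq rpred_sum // => i ir; apply: punitV_int; exact: hr.
have PZ : \prod_(i <- r) F i \in pintegral p.
  by rewrite big_seq rpred_prod // => i ir; apply: punit_int; exact: hr.
exists (e2 + (F j)^-1 * \sum_(i <- r) (F i)^-1); first by rewrite rpredD // rpredM.
move=> s sZ; rewrite !big_cons.
apply: cg_trans (cgMl _ (he s sZ)) _.
  by apply: rpredD; [exact: punit_int | rewrite rpredM // rpred_nat].
exists ((\prod_(j0 <- r) F j0) * s ^+ 3 * e2).
  by rewrite !rpredM // rpredX.
have := punit_neq0 Fj; move: (F j) (\prod_(j0 <- r) F j0) (\sum_(j0 <- r) (F j0)^-1).
by move=> f P S f0; field.
Qed.

Lemma rising_expand p k s : prime p -> (k < p)%N -> s \in pintegral p ->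
  cg p 2 (rising (1 + p%:R * s) k) (k`!%:R * (1 + p%:R * s * harm k)).
Proof.
move=> pp kp sZ.
have hF i : i \in index_enum 'I_k -> (val i).+1%:R \in punit p.
  by move=> _; apply: punit_lt => //=; apply: leq_ltn_trans kp.
have hr i : i \in iota 0 k -> i.+1%:R \in punit p.
  by rewrite mem_iota /= => ik; apply: punit_lt => //=; apply: leq_ltn_trans kp.
have [e2 e2Z he] := prod_expand hr.
have fZ := punit_int (punit_fact pp kp).
have /= := he s sZ; rewrite -[k in iota 0 k]subn0 -/(index_iota 0 k) !big_mkord => h.
have -> : rising (1 + p%:R * s) k = \prod_(i < k) (i.+1%:R + p%:R * s).
  by apply: eq_bigr => i _; rewrite -natr1; ring.
apply: cg_trans (cg_weak _ h) _ => //.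
have -> : \prod_(i < k) i.+1%:R = k`!%:R :> rat.
  by rewrite -rising_fact; apply: eq_bigr => i _; rewrite -natr1 addrC.
exists (k`!%:R * s ^+ 2 * e2); first by rewrite !rpredM // rpredX.
by rewrite /harm; ring.
Qed.

(** * The third difference *)

Lemma signr_exp4 k : ((-1) ^+ k) ^+ 4 = 1 :> rat.
Proof. by rewrite -exprM mulnC exprM -signr_odd expr1n. Qed.

Lemma prod_falling n k : \prod_(i < k) ((n - i)%:R : rat) = (n ^_ k)%:R.
Proof.
elim: k => [|k IH]; first by rewrite big_ord0 ffactn0.
by rewrite big_ord_recr /= IH ffactnSr natrM.
Qed.

Lemma harm_falling n k : (k <= n)%N ->
  \sum_(i < k) ((n - i)%:R : rat)^-1 = harm n - harm (n - k).
Proof.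
elim: k => [|k IH] kn; first by rewrite big_ord0 subn0 subrr.
rewrite big_ord_recr /= IH ?(ltnW kn) //.
have -> : (n - k = (n - k.+1).+1)%N by lia.
by rewrite /harm [X in _ - X + _]big_ord_recr /=; ring.
Qed.

Lemma rising_negn n k : (k <= n)%N ->
  rising (- n%:R) k = (-1) ^+ k * 'C(n, k)%:R * k`!%:R.
Proof.
move=> kn; rewrite -mulrA -natrM bin_ffact.
elim: k kn => [|k IH] kn; first by rewrite rising0 ffactn0 expr0 mulr1.
rewrite risingS IH ?(ltnW kn) // ffactnSr natrM natrB ?(ltnW kn) // exprS; ring.
Qed.

Lemma rising_shift_negn n k s : (k <= n)%N ->
  rising (s - n%:R) k = (-1) ^+ k * \prod_(i < k) ((n - i)%:R - s).
Proof.
elim: k => [|k IH] kn; first by rewrite rising0 big_ord0 expr0 mulr1.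
by rewrite risingS IH ?(ltnW kn) // big_ord_recr /= natrB ?(ltnW kn) // exprS; ring.
Qed.

Lemma rising_shift_negn_expand p n k s : prime p -> (n < p)%N -> (k <= n)%N ->
  s \in pintegral p ->
  cg p 2 (rising (p%:R * s - n%:R) k)
    ((-1) ^+ k * (n ^_ k)%:R * (1 - p%:R * s * (harm n - harm (n - k)))).
Proof.
move=> pp np kn sZ.
have hr i : i \in iota 0 k -> (n - i)%:R \in punit p.
  rewrite mem_iota /= => ik; apply: punit_lt => //; apply/andP; split; first by lia.
  exact: leq_ltn_trans (leq_subr _ _) np.
have [e2 e2Z he] := prod_expand hr.
have mZ : - s \in pintegral p by zint.
have := he _ mZ; rewrite -[k in iota 0 k]subn0 -/(index_iota 0 k) !big_mkord => h.
rewrite rising_shift_negn //.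
have -> : \prod_(i < k) ((n - i)%:R - p%:R * s) = \prod_(i < k) ((n - i)%:R + p%:R * - s).
  by apply: eq_bigr => i _; rewrite mulrN.
have sgZ : (-1) ^+ k \in pintegral p by zint.
apply: cg_trans (cgMl sgZ (cg_weak _ h)) _ => //.
rewrite prod_falling harm_falling //.
exists ((-1) ^+ k * (n ^_ k)%:R * s ^+ 2 * e2); first by zint.
by ring.
Qed.

Section ThirdDifference.
Variables (p n c : nat).
Hypotheses (pp : prime p) (p_gt3 : (3 < p)%N) (np : (n < p)%N).
(** For p = 6n + 1 this is used with c = 1; for p = 6k + 5 with c = 5 and n = 5k + 4. *)
Hypothesis nc : (6 * n + 1 = c * p)%N.

Let a : rat := 6%:R^-1.
Let tau : rat := c%:R / 6%:R.
Let t : rat := p%:R * tau.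
(* f0 and f1 are the values at x = 0 and x = t of (a-x)_k/(1+x)_k, where
   a - t = -n; the sum of the theorem is 6 times the sum of A k * f0 k ^ 3. *)
Let f0 (k : nat) : rat := rising a k / k`!%:R.
Let f1 (k : nat) : rat := rising (- n%:R) k / rising (1 + t) k.
Let A (k : nat) : rat := (a + 2%:R * k%:R) * f0 k.

Lemma six_unit : 6%:R \in punit p.
Proof.
apply: punit_nat => //; apply/negP=> p6; have := dvdn_leq (isT : (0 < 6)%N) p6.
by case: p pp p_gt3 p6 => [|[|[|[|[|[|[|]]]]]]].
Qed.

Lemma ratio_int : tau \in pintegral p.
Proof. by apply: rpredM; [exact: rpred_nat | exact: punitV_int six_unit]. Qed.

Lemma a_int : a \in pintegral p.
Proof. exact: punitV_int six_unit. Qed.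

Lemma tE : t = a + n%:R.
Proof.
have : ((6 * n + 1)%:R : rat) = (c * p)%:R by rewrite nc.
rewrite natrD !natrM /t /tau /a; lra.
Qed.

(* f1 k - f0 k = p (-1)^k C(n,k) gmod k (mod p^2), and gmod k = gmod (n-k). *)
Definition gmod (k : nat) : rat := - tau * (harm k + harm (n - k) - harm n).

Lemma f0_expand k : (k <= n)%N ->
  cg p 2 (f0 k) ((-1) ^+ k * 'C(n, k)%:R * (1 - t * (harm n - harm (n - k)))).
Proof.
move=> kn; have h := rising_shift_negn_expand pp np kn ratio_int.
have fu : k`!%:R \in punit p by apply: punit_fact => //; apply: leq_ltn_trans np.
apply: (cg_cancel fu); rewrite /f0 mulrCA mulfV ?(punit_neq0 fu) // mulr1.
rewrite (_ : a = t - n%:R); last by rewrite tE; ring.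
apply: cg_trans h _; rewrite -bin_ffact natrM; exists 0; first by zint.
by rewrite /t; ring.
Qed.

Lemma f1_expand k : (k <= n)%N ->
  cg p 2 (f1 k) ((-1) ^+ k * 'C(n, k)%:R * (1 - t * harm k)).
Proof.
move=> kn; have kp : (k < p)%N by apply: leq_ltn_trans kn np.
have tauZ := ratio_int.
have h := rising_expand pp kp ratio_int.
have fu := punit_fact pp kp.
have hZ := harm_int pp kp.
have u1 : 1 + t * harm k \in punit p.
  apply: (punit_cg pp (e := 1) _ _ (punit1 p)) => //.
  by exists (tau * harm k); [zint | rewrite /t; ring].
have ru : rising (1 + t) k \in punit p.
  by apply: (punit_cg pp _ h) => //; exact: punitM.
rewrite /f1 rising_negn //.
have sZ : (-1) ^+ k * 'C(n, k)%:R * k`!%:R \in pintegral p by zint.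
apply: cg_trans (cgMl sZ (cgV ru (punitM fu u1) h)) _.
rewrite -/t; apply: (cg_cancel u1).
have -> : (1 + t * harm k) *
   ((-1) ^+ k * 'C(n, k)%:R * k`!%:R / (k`!%:R * (1 + t * harm k))) =
   (-1) ^+ k * 'C(n, k)%:R.
  by field; rewrite ?(punit_neq0 u1) ?(punit_neq0 fu).
exists ((-1) ^+ k * 'C(n, k)%:R * tau ^+ 2 * harm k ^+ 2); first by zint.
by rewrite /t; ring.
Qed.

Lemma gmod_int k : (k <= n)%N -> gmod k \in pintegral p.
Proof.
move=> kn; have tauZ := ratio_int.
have h1 := harm_int pp (leq_ltn_trans kn np); have h2 := harm_int pp np.
have h3 := harm_int pp (leq_ltn_trans (leq_subr k n) np).
by rewrite /gmod; zint.
Qed.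

(** The factor p of [f1 k - f0 k] gives p^3, so [A k] is needed only modulo p; there a = -n, and
    [A k] becomes (2k - n) (-1)^k C(n,k). The four signs multiply to 1. *)
Lemma diff_cube k : (k <= n)%N ->
  cg p 4 (A k * (f1 k - f0 k) ^+ 3)
    (p%:R ^+ 3 * ((2%:R * k%:R - n%:R) * 'C(n, k)%:R ^+ 4 * gmod k ^+ 3)).
Proof.
move=> kn; have gZ := gmod_int kn; have tauZ := ratio_int.
have [d dZ hd] : cg p 2 (f1 k - f0 k) (p%:R * ((-1) ^+ k * 'C(n, k)%:R * gmod k)).
  apply: cg_trans (cgB (f1_expand kn) (f0_expand kn)) _.
  by exists 0; rewrite ?rpred0 // /gmod /t; ring.
have hnZ := harm_int pp np.
have hnkZ := harm_int pp (leq_ltn_trans (leq_subr k n) np).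
have [d' d'Z hd'] := f0_expand kn.
set e := (-1) ^+ k in hd hd'.
have ee : e ^+ 4 = 1 := signr_exp4 k.
have eZ : e \in pintegral p by rewrite /e; zint.
set C := ('C(n, k)%:R : rat) in hd hd' *.
have CZ : C \in pintegral p by rewrite /C; zint.
have [w wZ hA] : cg p 1 (A k) ((2%:R * k%:R - n%:R) * (e * C)).
  have f0Z : f0 k \in pintegral p by rewrite hd' /t; zint.
  exists (tau * f0 k + (2%:R * k%:R - n%:R) * (p%:R * d' -
     e * C * tau * (harm n - harm (n - k)))); first by zint.
  rewrite /A; have -> : (a + 2%:R * k%:R) = t + (2%:R * k%:R - n%:R) by rewrite tE; ring.
  by rewrite [in LHS]mulrDl [in X in _ + X = _]hd' /t; ring.
have {}hd : f1 k - f0 k = p%:R * (e * C * gmod k + p%:R * d) by rewrite hd; ring.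
rewrite {}hd {}hA exprMn.
have -> : (2 * k%:R - n%:R) * C ^+ 4 * gmod k ^+ 3
   = (2 * k%:R - n%:R) * (e * C) * (e * C * gmod k) ^+ 3.
  by rewrite -[LHS]mul1r -ee; ring.
set B := 2%:R * k%:R - n%:R.
have BZ : B \in pintegral p by rewrite /B; zint.
have YZ : e * C * gmod k \in pintegral p by zint.
move: (e * C * gmod k) YZ => Y YZ.
exists (w * (Y + p%:R * d) ^+ 3 + B * (e * C) *
  (3%:R * Y ^+ 2 * d + 3%:R * Y * p%:R * d ^+ 2 + p%:R ^+ 2 * d ^+ 3)); first by zint.
ring.
Qed.

(* Modulo p^4 the terms k and n-k cancel, as A k is odd under k <-> n-k mod p. *)
Lemma sum_diff_cube :
  cg p 4 (\sum_(k < n.+1) A k * (f1 k - f0 k) ^+ 3) 0.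
Proof.
pose T k := (2%:R * k%:R - n%:R) * 'C(n, k)%:R ^+ 4 * gmod k ^+ 3.
have e0 : p%:R ^+ 3 * \sum_(k < n.+1) T k = 0.
  have : \sum_(k < n.+1) T k = - \sum_(k < n.+1) T k.
    rewrite {1}(reindex_inj rev_ord_inj) /= -sumrN; apply: eq_bigr => i _.
    have iN : (i <= n)%N by rewrite -ltnS.
    rewrite /T subSS bin_sub // /gmod subKn // natrB //; ring.
  by move/eqP; rewrite -addr_eq0 -mulr2n mulrn_eq0 /= => /eqP ->; rewrite mulr0.
rewrite -[X in cg _ _ _ X]e0 mulr_sumr; apply: cg_sum => i _ _; apply: diff_cube.
by rewrite -ltnS.
Qed.

(** For k > n the product (a)_k contains the factor a + n = t. *)
Lemma rising_tail k : (n < k < p)%N -> cg p 1 (rising a k / k`!%:R) 0.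
Proof.
case/andP => nk kp; have fu := punit_fact pp kp; have tauZ := ratio_int.
have aZ := a_int.
suff [d dZ ->] : exists2 d, d \in pintegral p & rising a k = p%:R * d.
  by exists (d / k`!%:R); [zint | rewrite add0r; ring].
elim: k nk {kp fu} => // k IH; rewrite ltnS leq_eqVlt => /orP [/eqP <-|/IH [d dZ dE]].
  exists (tau * rising a n); last by rewrite risingS -tE /t; ring.
  have rfZ : rising a n \in pintegral p by apply: rpred_prod => i _; zint.
  by zint.
by exists (d * (a + k%:R)); [zint | rewrite risingS dE; ring].
Qed.

(* f0^3 = 3 f0^2 f1 - 3 f0 f1^2 + f1^3 - (f1 - f0)^3, and the first three
   sums are terminating 5F4 sums because f1 carries the factor (-n)_k. *)
Lemma sum_closed_form :
  cg p 4 (\sum_(k < p) (12 * k + 1)%:R * gbinom (- a) k ^+ 4)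
    (6%:R * (rising a n.+1 * (3%:R * rising (1 - a) n / n`!%:R ^+ 2
       - 3%:R * rising (1 - a + t) n / (n`!%:R * rising (1 + t) n)
       + rising (1 - a + 2%:R * t) n / rising (1 + t) n ^+ 2))).
Proof.
have aZ := a_int.
have a0 : 0 < a by [].
have t0 : 0 <= t by rewrite tE addr_ge0 // ler0n.
have e1 : rising a n.+1 * (3%:R * rising (1 - a) n / n`!%:R ^+ 2
       - 3%:R * rising (1 - a + t) n / (n`!%:R * rising (1 + t) n)
       + rising (1 - a + 2%:R * t) n / rising (1 + t) n ^+ 2) =
  3%:R * \sum_(k < n.+1) wp_term a 0 0 n k
  - 3%:R * \sum_(k < n.+1) wp_term a 0 t n k
  + \sum_(k < n.+1) wp_term a t t n k.
  rewrite !wp_sum // !addr0 rising_fact.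
  have -> : 1 - a + t + t = 1 - a + 2%:R * t by ring.
  have f0' : (n`!%:R : rat) != 0 by rewrite pnatr_eq0 -lt0n fact_gt0.
  have r0 : rising (1 + t) n != 0 by rewrite gt_eqF // rising_gt0; lra.
  by field; rewrite f0' r0.
have e2 : \sum_(k < n.+1) A k * f0 k ^+ 3 =
  \sum_(k < n.+1) A k * (f1 k - f0 k) ^+ 3 * (-1) +
  (3%:R * \sum_(k < n.+1) wp_term a 0 0 n k
  - 3%:R * \sum_(k < n.+1) wp_term a 0 t n k
  + \sum_(k < n.+1) wp_term a t t n k).
  rewrite !mulr_sumr -sumrB -!big_split /=; apply: eq_bigr => k _.
  rewrite /wp_term /A /f1 /f0 !subr0 ?addr0 rising_fact.
  have -> : 1 + a + n%:R = 1 + t by rewrite tE; ring.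
  have -> : a - t = - n%:R by rewrite tE; ring.
  have f0' : (k`!%:R : rat) != 0 by rewrite pnatr_eq0 -lt0n fact_gt0.
  have r0 : rising (1 + t) k != 0 by rewrite gt_eqF // rising_gt0; lra.
  by field; rewrite f0' r0.
have sZ : 6%:R \in pintegral p by zint.
have -> : \sum_(k < p) (12 * k + 1)%:R * gbinom (- a) k ^+ 4 =
  6%:R * \sum_(k < p) A k * f0 k ^+ 3.
  rewrite mulr_sumr; apply: eq_bigr => k _; rewrite gbinomN -mulrA exprMn -/(f0 k).
  rewrite signr_exp4 mul1r natrD natrM /A /f0 /a.
  by field; rewrite pnatr_eq0 -lt0n fact_gt0.
apply: cgMl => //; rewrite e1.
apply: (@cg_trans _ _ (\sum_(k < n.+1) A k * f0 k ^+ 3)); last first.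
  rewrite e2 -[X in cg _ _ _ X]add0r; apply: cgD; last exact: cg_refl.
  by rewrite -mulr_suml -[0](mul0r (-1)); apply: cgMr; [zint | exact: sum_diff_cube].
(* Beyond n each term has four factors [f0 k], all divisible by p, so the sum up to p may be cut at
   n. *)
rewrite (big_ord_widen _ (fun k => A k * f0 k ^+ 3) np) [X in cg _ _ _ X]big_mkcond /=.
apply: cg_sum => k _ _; case: ifP => [_|]; first exact: cg_refl.
rewrite ltnS => /negbT; rewrite -ltnNge => nk.
have nkp : (n < k < p)%N by rewrite nk ltn_ord.
have [d dZ] := rising_tail nkp; rewrite add0r -/(f0 k) /A => ->; exists ((a
  + 2%:R * k%:R) * d ^+ 4); first by zint.
by ring.
Qed.
End ThirdDifference.

(** * Teichmueller representatives *)

Section Teichmuller.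
Variable p : nat.
Hypothesis pp : prime p.

(** In a^p - b^p = (a - b) sum_i a^(p-1-i) b^i the second factor is p b^(p-1) = 0 modulo p. *)
Lemma cg_expp e a b : (0 < e)%N -> a \in pintegral p -> b \in pintegral p ->
  cg p e a b -> cg p e.+1 (a ^+ p) (b ^+ p).
Proof.
move=> e0 aZ bZ h; have h1 := cg_weak e0 h.
apply/cgP; rewrite subrXX.
have [c cZ hc] := h; have -> : a - b = p%:R ^+ e * c by rewrite hc; ring.
have : cg p 1 (\sum_(i < p) a ^+ (p.-1 - i) * b ^+ i) 0.
  apply: (@cg_trans _ _ (\sum_(i < p) b ^+ p.-1)).
    apply: cg_sum => i _ _.
    have -> : b ^+ p.-1 = b ^+ (p.-1 - i) * b ^+ i.
      by rewrite -exprD subnK // -ltnS (ltn_predK (prime_gt0 pp)).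
    by apply: cgM; [zint | zint | exact: cgX | exact: cg_refl].
  rewrite sumr_const card_ord -mulr_natl; exists (b ^+ p.-1); first by zint.
  by rewrite add0r.
case=> d dZ ->; exists (c * d); first by zint.
by rewrite (exprS _ e); ring.
Qed.

Definition rep (x : 'F_p) : rat := (nat_of_ord x)%:R.

Lemma rep_int x : rep x \in pintegral p.
Proof. by rewrite /rep; zint. Qed.

Lemma rep_nat k : cg p 1 (rep k%:R) k%:R.
Proof.
rewrite /rep val_Fp_nat //; exists (- (k %/ p)%:R); first by zint.
have -> : (k%:R : rat) = (k %/ p)%:R * p%:R + (k %% p)%:R.
  by rewrite -natrM -natrD -divn_eq.
ring.
Qed.

Lemma repD x y : cg p 1 (rep (x + y)) (rep x + rep y).
Proof.
rewrite -[x + y]natr_Zp.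
have -> : (nat_of_ord (x + y))%:R = (x + y)%N%:R :> 'F_p.
  by rewrite natr_Zp natrD !natr_Zp.
by apply: cg_trans (rep_nat _) _; rewrite /rep natrD; exact: cg_refl.
Qed.

Lemma repM x y : cg p 1 (rep (x * y)) (rep x * rep y).
Proof.
rewrite -[x * y]natr_Zp.
have -> : (nat_of_ord (x * y))%:R = (x * y)%N%:R :> 'F_p.
  by rewrite natr_Zp natrM !natr_Zp.
by apply: cg_trans (rep_nat _) _; rewrite /rep natrM; exact: cg_refl.
Qed.

Lemma rep0 : rep 0 = 0. Proof. by []. Qed.

Lemma rep1 : rep 1 = 1.
Proof. by rewrite /rep (val_Fp_nat pp 1) modn_small ?prime_gt1. Qed.

Lemma repX x k : cg p 1 (rep (x ^+ k)) (rep x ^+ k).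
Proof.
elim: k => [|k IH]; first by rewrite !expr0 rep1; exact: cg_refl.
rewrite !exprS; apply: cg_trans (repM _ _) _; apply: cgMl => //; exact: rep_int.
Qed.

Lemma rep_unit x : x != 0 -> rep x \in punit p.
Proof.
move=> x0; apply: punit_lt => //;
  rewrite lt0n (_ : (nat_of_ord x != 0%N) = (x != 0)) // x0.
by rewrite -[X in (_ < X)%N](Fp_cast pp) ltn_ord.
Qed.

Lemma rep1B x : cg p 1 (rep (1 - x)) (1 - rep x).
Proof.
have := cg_sym (repD (1 - x) x); rewrite subrK rep1 => -[c cZ e].
by exists c => //; rewrite -[LHS](addrK (rep x)) e; ring.
Qed.

(* Modulo p^3, the Teichmueller representative of x. *)
Definition tau (x : 'F_p) : rat := rep x ^+ (p ^ 2).

Lemma tau_int x : tau x \in pintegral p.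
Proof. by rewrite pintegralX ?rep_int. Qed.

Lemma cg_expp2 a b : a \in pintegral p -> b \in pintegral p ->
  cg p 1 a b -> cg p 3 (a ^+ (p ^ 2)) (b ^+ (p ^ 2)).
Proof.
move=> aZ bZ h; rewrite -mulnn !exprM.
by apply: cg_expp => //; try zint; apply: cg_expp.
Qed.

(** The lift [rep] is multiplicative modulo p only; raising to the power p^2 improves this to
    p^3. *)
Lemma tauM x y : cg p 3 (tau (x * y)) (tau x * tau y).
Proof.
rewrite /tau -exprMn; apply: cg_expp2; last exact: repM.
  exact: rep_int.
by have := rep_int x; have := rep_int y => *; zint.
Qed.

Lemma tau0 : tau 0 = 0.
Proof. by rewrite /tau rep0 expr0n expn_eq0 /= -(negbK (p == 0)) -lt0n
  (prime_gt0 pp). Qed.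

Lemma tau1 : tau 1 = 1. Proof. by rewrite /tau rep1 expr1n. Qed.

Lemma tauX x k : cg p 3 (tau (x ^+ k)) (tau x ^+ k).
Proof.
elim: k => [|k IH]; first by rewrite !expr0 tau1; exact: cg_refl.
rewrite !exprS; apply: cg_trans (tauM _ _) _; apply: cgMl => //; exact: tau_int.
Qed.

Lemma Fp_card x : x ^+ p = x :> 'F_p.
Proof. by have := expf_card x; rewrite card_Fp. Qed.

Lemma Fp_fermat (x : 'F_p) : x != 0 -> x ^+ p.-1 = 1.
Proof.
move=> x0; apply: (mulfI x0); rewrite mulr1 -exprS (ltn_predK (prime_gt0 pp)).
exact: Fp_card.
Qed.

Lemma tau_rep x : cg p 1 (tau x) (rep x).
Proof.
apply: cg_trans (cg_sym (repX x (p ^ 2))) _.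
by rewrite -mulnn exprM !Fp_card; exact: cg_refl.
Qed.

Lemma Fp_prim_root : exists g : 'F_p, p.-1.-primitive_root g.
Proof.
have p1 : (0 < p.-1)%N by have := prime_gt1 pp; lia.
have /hasP [g _ hg] : has p.-1.-primitive_root (enum [pred x : 'F_p | x != 0]).
  apply: has_prim_root; rewrite ?enum_uniq //.
    by apply/allP=> x; rewrite mem_enum inE => x0; rewrite unity_rootE Fp_fermat.
  rewrite -cardE; have := cardC (pred1 (0 : 'F_p)); rewrite card1 card_Fp //.
  move=> e; rewrite (_ : #|_| = #|predC (pred1 (0 : 'F_p))|); last exact: eq_card.
  by rewrite -ltnS (ltn_predK (prime_gt0 pp)) -{1}e.
by exists g.
Qed.

Lemma Fp_gen g : p.-1.-primitive_root g ->
  forall x : 'F_p, x != 0 -> exists i : nat, x = g ^+ i.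
Proof.
move=> hg x x0; have [i ->] := prim_rootP hg (Fp_fermat x0); by exists i.
Qed.

(** If p - 1 does not divide m, replacing x by g x for a primitive root g multiplies the sum by
    tau(g)^m, and 1 - tau(g)^m is a unit because its residue 1 - g^m is nonzero. *)
Lemma sum_tau m : (0 < m)%N -> 
  cg p 3 (\sum_(x : 'F_p) tau x ^+ m) (if (p.-1 %| m)%N then p%:R - 1 else 0).
Proof.
move=> m0; case: ifP => pm.
  rewrite (bigD1 0) //= tau0 expr0n eqn0Ngt m0 add0r.
  apply: (@cg_trans _ _ (\sum_(x : 'F_p | x != 0) 1)).
    apply: cg_sum => x _ x0; have /dvdnP [k ->] := pm.
    apply: cg_trans (cg_sym (tauX _ _)) _.
    by rewrite mulnC exprM Fp_fermat // expr1n tau1; exact: cg_refl.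
  rewrite sumr_const; have := cardC (pred1 (0 : 'F_p)); rewrite card1 card_Fp // => e.
  move/(congr1 (fun k => k%:R : rat)): e; rewrite natrD => e.
  have -> : p%:R - 1 = (#|predC (pred1 (0 : 'F_p))|)%:R :> rat by rewrite -e; ring.
  exact: cg_refl.
have [g hg] := Fp_prim_root.
have g0 : g != 0.
  by rewrite (prim_root_eq0 hg); have := prime_gt1 pp; lia.
have gm : g ^+ m != 1 by rewrite -(prim_order_dvd hg) pm.
have u : 1 - tau g ^+ m \in punit p.
  apply: (punit_cg pp (e := 1) (b := rep (1 - g ^+ m))) => //; last first.
    by apply: rep_unit; rewrite subr_eq0 eq_sym.
  apply: cg_trans _ (cg_sym (rep1B _)); apply: cgB; first exact: cg_refl.
  apply: cg_trans (cg_weak _ (cg_sym (tauX _ _))) _ => //; exact: tau_rep.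
apply: (cg_cancel u); rewrite mulr0 mulrBl mul1r; apply: (cgP _ _ _ _).1.
rewrite [X in cg _ _ X _](reindex_inj (mulfI g0)) /= mulr_sumr.
apply: cg_sum => x _ _; rewrite -exprMn; apply: cgX; last exact: tauM.
  exact: tau_int.
by have := tau_int x; have := tau_int g => *; zint.
Qed.
End Teichmuller.

(** * Wolstenholme-type congruences *)

(* Replaces subterms of a polynomial expression along the congruences in the
   context, instantiating the right-hand side and leaving integrality goals. *)
Ltac cgsub := match goal with
  | H : cg _ _ ?a _ |- cg _ _ ?a _ => exact H
  | |- cg _ _ ?x _ => match x with
    | (_ + _)%R => refine (cgD _ _); [cgsub | cgsub]
    | (- _)%R => refine (cgN _); cgsub
    | (_ * _)%R => refine (cgM _ _ _ _); [ | | cgsub | cgsub]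
    | (_ ^+ _)%R => refine (cgX _ _ _ _); [ | | cgsub]
    | _ => refine (cg_refl _ _ _)
    end
  end.

Section Wolstenholme.
Variable p : nat.
Hypotheses (pp : prime p) (p_gt3 : (3 < p)%N).

(** The bound r + k <= p keeps the factors r, ..., r+k-1 prime to p. The coefficients e1, e2 serve
    all shifts s at once and are never computed: they cancel where this is applied. *)
Lemma rising_expand3 r k : (0 < r)%N -> (r + k <= p)%N ->
  exists e1 e2, [/\ e1 \in pintegral p, e2 \in pintegral p, rising r%:R k \in punit p
    & forall s, s \in pintegral p -> cg p 3 (rising (r%:R + p%:R * s) k)
       (rising r%:R k * (1 + p%:R * s * e1 + (p%:R * s) ^+ 2 * e2))].
Proof.
move=> r0 rk.
have hr i : i \in iota 0 k -> (r + i)%:R \in punit p.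
  by rewrite mem_iota /= => ik; apply: punit_lt => //; lia.
have [e2 e2Z he] := prod_expand hr.
exists (\sum_(i <- iota 0 k) ((r + i)%:R)^-1), e2.
have e1 : \prod_(i <- iota 0 k) (r + i)%:R = rising r%:R k.
  rewrite -[k in iota 0 k]subn0 -/(index_iota 0 k) big_mkord /rising.
  by apply: eq_bigr => i _; rewrite natrD.
split=> //.
- by rewrite big_seq rpred_sum // => i ir; apply: punitV_int; exact: hr.
- by rewrite -e1; apply: punit_prod => i ir _; exact: hr.
move=> s sZ; have := he s sZ; rewrite e1.
rewrite -[X in \prod_(i <- iota 0 X) _]subn0 -/(index_iota 0 k) big_mkord.
rewrite (_ : \prod_(i < k) _ = rising (r%:R + p%:R * s) k) //.
by apply: eq_bigr => i _; rewrite natrD; ring.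
Qed.

(* i^-2 = i^(p-3) (mod p), a power sum over F_p. *)
Lemma sum_inv_sq : cg p 1 (\sum_(i < p.-1) (i.+1%:R)^-2) 0.
Proof.
have h : cg p 1 (\sum_(x : 'F_p) (rep x)^-2) 0.
  have m0 : (0 < p - 3)%N by lia.
  have np : (p.-1 %| p - 3)%N = false.
    by apply/negP=> /dvdn_leq; move/(_ m0); lia.
  have := sum_tau pp m0; rewrite np => h.
  apply: cg_trans (cg_weak _ h) => //; apply: cg_sum => x _ _.
  have [->|x0] := eqVneq x 0.
    by rewrite rep0 tau0 // !expr0n (gtn_eqF m0) /= invr0; exact: cg_refl.
  have u := rep_unit pp x0.
  have -> : (rep x)^-2 = (rep x)^-2 * 1 by rewrite mulr1.
  have -> : tau x ^+ (p - 3) = (rep x)^-2 * (rep x ^+ 2 * tau x ^+ (p - 3)).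
    by rewrite mulKf // expf_neq0 // (punit_neq0 u).
  apply: cgMl; first by rewrite punitV_int // punitX.
  apply: cg_sym; apply: (@cg_trans _ _ (rep x ^+ 2 * rep x ^+ (p - 3))).
    apply: cgMl; first by zint.
    apply: cgX; [exact: tau_int | exact: rep_int | exact: tau_rep].
  rewrite -exprD; apply: cg_trans (cg_sym (repX pp _ _)) _.
  have -> : (2 + (p - 3) = p.-1)%N by lia.
  by rewrite Fp_fermat // rep1 //; exact: cg_refl.
move: h; rewrite /rep -(big_mkord xpredT (fun i => ((i%:R : rat))^-2)) Fp_cast //.
rewrite -[X in index_iota 0 X](prednK (prime_gt0 pp)) big_mkord big_ord_recl /=.
by rewrite expr0n invr0 add0r.
Qed.

(** Pairing i with p - i exhibits a factor p; the cofactor is congruent to minus the sum of the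
    inverse squares. *)
Lemma harm_wolstenholme : cg p 2 (harm p.-1) 0.
Proof.
have p1 := prime_gt1 pp.
have u2 : (2%:R : rat) \in punit p by apply: punit_lt => //; lia.
apply: (cg_cancel u2); rewrite mulr0.
have -> : 2%:R * harm p.-1 = p%:R * \sum_(i < p.-1) (i.+1%:R * (p - i.+1)%:R)^-1.
  rewrite mulr_natl mulr2n {2}/harm (reindex_inj rev_ord_inj) /= -big_split mulr_sumr.
  apply: eq_bigr => i _ /=; have ip := ltn_ord i.
  have -> : (p.-1 - i.+1).+1 = (p - i.+1)%N by lia.
  have e : (p%:R : rat) = i.+1%:R + (p - i.+1)%:R by rewrite -natrD; congr _%:R; lia.
  have n1 : (i.+1%:R : rat) != 0 by rewrite pnatr_eq0.
  have n2 : ((p - i.+1)%:R : rat) != 0 by rewrite pnatr_eq0; lia.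
  move: (i.+1%:R) ((p - i.+1)%:R) e n1 n2 => x y -> n1 n2.
  by field; rewrite n1 n2.
rewrite -[X in cg _ _ _ X](mulr0 p%:R); apply: cg_pMl.
apply: (@cg_trans _ _ (- \sum_(i < p.-1) (i.+1%:R)^-2)).
  rewrite -sumrN; apply: cg_sum => i _ _; have ip := ltn_ord i.
  have u : (i.+1%:R : rat) \in punit p by apply: punit_lt => //; lia.
  have u' : ((p - i.+1)%:R : rat) \in punit p by apply: punit_lt => //; lia.
  apply: (cg_cancel (punitM (punitX 2 u) u')).
  have e : ((p - i.+1)%:R : rat) = p%:R - i.+1%:R by rewrite natrB //; lia.
  have n1 := punit_neq0 u; have n2 := punit_neq0 u'.
  exists 1; first by zint.
  move: (i.+1%:R) ((p - i.+1)%:R) e n1 n2 => x y e n1 n2.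
  have -> : (p%:R : rat) = y + x by rewrite e subrK.
  by field; rewrite n1 n2.
by rewrite -[X in cg _ _ _ X]oppr0; apply: cgN; exact: sum_inv_sq.
Qed.

(** This is C(2p-1, p-1) = 1 modulo p^3. The expansions of the product of the i + p s at s = 1 and s
    = -1 differ by 2 p H_(p-1) times (p-1)!, which is 0 modulo p^3, and at s = -1 the product is
    (p-1)! itself. *)
Lemma rising_wolstenholme : cg p 3 (rising (1 + p%:R) p.-1) (p.-1)`!%:R.
Proof.
have p1 := prime_gt1 pp.
have hr i : i \in iota 0 p.-1 -> i.+1%:R \in punit p.
  by rewrite mem_iota /= => ik; apply: punit_lt => //; lia.
have [e2 e2Z he] := prod_expand hr.
have fu : (p.-1)`!%:R \in punit p by apply: punit_fact => //; lia.
have toI (F : nat -> rat) : \prod_(i <- iota 0 p.-1) F i = \prod_(i < p.-1) F i.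
  by rewrite -[X in iota 0 X]subn0 -/(index_iota 0 _) big_mkord.
have toS (F : nat -> rat) : \sum_(i <- iota 0 p.-1) F i = \sum_(i < p.-1) F i.
  by rewrite -[X in iota 0 X]subn0 -/(index_iota 0 _) big_mkord.
have eF : \prod_(i < p.-1) (i.+1%:R : rat) = (p.-1)`!%:R.
  by rewrite -rising_fact; apply: eq_bigr => i _; rewrite -natr1 addrC.
have m1Z : -1 \in pintegral p by zint.
have := he _ m1Z; rewrite !toI toS eF -/(harm p.-1).
have -> : \prod_(i < p.-1) (i.+1%:R + p%:R * -1) = (p.-1)`!%:R :> rat.
  rewrite -eF [RHS](reindex_inj rev_ord_inj) /=.
  (* Reversing the product gives p - 1 minus signs, an even number. *)
  have [k ek] : exists k, p.-1 = k.*2.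
    have po : odd p by case: (even_prime pp) p_gt3 => // ->.
    by exists p./2; rewrite -[in LHS](odd_double_half p) po.
  transitivity (\prod_(i < p.-1) (- 1 * (p - i.+1)%:R : rat)).
    by apply: eq_bigr => i _; have := ltn_ord i => ip; rewrite natrB; [ring | lia].
  rewrite big_split /= prodr_const card_ord [X in _ ^+ X]ek -mul2n exprM sqrrN !expr1n
    mul1r.
  by apply: eq_bigr => i _; congr _%:R; have := ltn_ord i; lia.
move=> h1; have := he 1 (pintegral1 p); rewrite !toI toS eF -/(harm p.-1).
have -> : \prod_(i < p.-1) (i.+1%:R + p%:R * 1) = rising (1 + p%:R) p.-1 :> rat.
  by apply: eq_bigr => i _; rewrite -natr1; ring.
move/cg_trans; apply.
have [d dZ hd] := harm_wolstenholme.
have {}h1 : cg p 3 (1 + p%:R * -1 * harm p.-1 + (p%:R * -1) ^+ 2 * e2) 1.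
  by apply: (cg_cancel fu); rewrite mulr1; exact: cg_sym.
rewrite -[X in cg _ _ _ X]mulr1; apply: cgMl; first by zint.
have [c cZ hc] := h1; exists (c + 2%:R * d); first by zint.
rewrite add0r in hd.
have -> : 1 + p%:R * 1 * harm p.-1 + (p%:R * 1) ^+ 2 * e2 =
  (1 + p%:R * -1 * harm p.-1 + (p%:R * -1) ^+ 2 * e2) + 2%:R * p%:R * harm p.-1 by ring.
by rewrite hc hd; ring.
Qed.
End Wolstenholme.

(** * Binomial form of the sum for p = 6n + 1 *)

Lemma punit_cg_near p e (b f z w : rat) : prime p -> (0 < e)%N ->
  f \in punit p -> z \in pintegral p -> w = 1 + p%:R * z ->
  cg p e b (f * w) -> b \in punit p.
Proof.
move=> pp e0 fu zZ we h.
have h1 : cg p 1 b f.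
  apply: cg_trans (cg_weak e0 h) _; exists (f * z); first by zint.
  by rewrite we; ring.
exact: punit_cg h1 fu.
Qed.

Lemma rising_add a j k : rising a (j + k) = rising a j * rising (a + j%:R) k.
Proof.
rewrite /rising big_split_ord; congr (_ * _); apply: eq_bigr => i _ /=.
by rewrite natrD addrA.
Qed.

Lemma rising_ffact r k : rising (r%:R + 1) k = ((r + k) ^_ k)%:R.
Proof.
rewrite -prod_falling [RHS](reindex_inj rev_ord_inj); apply: eq_bigr => i _ /=.
have ik := ltn_ord i; rewrite -addrA nat1r -natrD; congr _%:R; lia.
Qed.

Lemma rising_negn_shift n s : rising (s - n%:R) n = (-1) ^+ n * rising (1 - s) n.
Proof.
rewrite rising_shift_negn //; congr (_ * _); rewrite (reindex_inj rev_ord_inj).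
apply: eq_bigr => i _ /=; have ik := ltn_ord i.
by rewrite subKn // -natr1; ring.
Qed.

Section CaseOne.
Variables (p nu : nat).
Let n := nu.+1.
Hypotheses (pp : prime p) (p_gt3 : (3 < p)%N) (pE : p = (6 * n + 1)%N).

Let i6 : rat := 6%:R^-1.
Let t : rat := p%:R * i6.

Lemma sixth_int : i6 \in pintegral p.
Proof. exact: a_int. Qed.

Lemma nE : n%:R = (p%:R - 1) * i6.
Proof. by rewrite pE natrD natrM /i6; field. Qed.

(* Explicit quotients by powers of p, here and below, come from polynomial division. *)
Lemma third_difference_cg (L0 Lm Lp L2 f B l1 l2 h1 h2 : rat) :
  f \in pintegral p -> L0 \in pintegral p ->
  l1 \in pintegral p -> l2 \in pintegral p ->
  h1 \in pintegral p -> h2 \in pintegral p ->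
  cg p 3 Lm (L0 * (1 - t * l1 + t ^+ 2 * l2)) ->
  cg p 3 Lp (L0 * (1 + t * l1 + t ^+ 2 * l2)) ->
  cg p 3 L2 (L0 * (1 - 2%:R * t * l1 + 4%:R * t ^+ 2 * l2)) ->
  cg p 3 B (f * (1 + t * h1 + t ^+ 2 * h2)) ->
  cg p 3 (f * (3%:R * Lm * B ^+ 2 - 3%:R * L0 * f * B + Lp * f ^+ 2)) (L2 * B ^+ 3).
Proof.
move=> fZ L0Z l1Z l2Z h1Z h2Z hLm hLp hL2 hB.
have iZ := sixth_int; have tZ : t \in pintegral p by rewrite /t; zint.
have aZ (u v : rat) : u \in pintegral p -> v \in pintegral p ->
    1 + t * u + t ^+ 2 * v \in pintegral p by move=> *; zint.
have BZ : B \in pintegral p by apply: cg_int hB _; zint.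
have LmZ : Lm \in pintegral p by apply: cg_int hLm _; zint.
have LpZ : Lp \in pintegral p by apply: cg_int hLp _; zint.
have L2Z : L2 \in pintegral p by apply: cg_int hL2 _; zint.
eapply cg_trans; first by cgsub; zint.
apply: cg_sym; eapply cg_trans; first by cgsub; zint.
apply: cg_sym.
exists (i6 ^+ 3 * (L0 * f ^+ 3 * (6%:R * h1 * h2 * l1 * t
  - 18%:R * h1 * h2 * l2 * t ^+ 2
  + 6%:R * h1 * h2 ^+ 2 * l1 * t ^+ 3 - 12%:R * h1 * h2 ^+ 2 * l2 * t ^+ 4
  - 3%:R * h1 * h2 ^+ 2 * t ^+ 2 - 6%:R * h1 * l2
  + 6%:R * h1 ^+ 2 * h2 * l1 * t ^+ 2 - 12%:R * h1 ^+ 2 * h2 * l2 * t ^+ 3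
  - 3%:R * h1 ^+ 2 * h2 * t + 3%:R * h1 ^+ 2 * l1 - 9%:R * h1 ^+ 2 * l2 * t - h1 ^+ 3
  + 2%:R * h1 ^+ 3 * l1 * t - 4%:R * h1 ^+ 3 * l2 * t ^+ 2 - 6%:R * h2 * l2 * t
  + 3%:R * h2 ^+ 2 * l1 * t ^+ 2 - 9%:R * h2 ^+ 2 * l2 * t ^+ 3
  + 2%:R * h2 ^+ 3 * l1 * t ^+ 4 - 4%:R * h2 ^+ 3 * l2 * t ^+ 5 - h2 ^+ 3 * t ^+ 3))).
  by zint.
rewrite [p%:R ^+ 3 * _]mulrA -exprMn -/t; move: t {tZ aZ hLm hLp hL2 hB} => z; ring.
Qed.

Lemma fact_unit_n : n`!%:R \in punit p.
Proof. by apply: punit_fact => //; lia. Qed.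

(** Write L(s) = (n + 1 + s)_n, B = (1 + t)_n and f = n!. The three numerators are L(-t), L(0),
    L(t). Since B/f is 1 modulo p, the values L((1-j)t) f^(3-j) B^j are modulo p^3 a polynomial in j
    of degree at most 2, so their third difference over j = 0, ..., 3 vanishes. This trades the
    three terms for the single one with L(-2t). *)
Lemma bracket_cg :
  cg p 3 (rising i6 n * (3%:R * rising (1 - i6) n / n`!%:R ^+ 2
       - 3%:R * rising (1 - i6 + t) n / (n`!%:R * rising (1 + t) n)
       + rising (1 - i6 + 2%:R * t) n / rising (1 + t) n ^+ 2))
    ((-1) ^+ n * (rising (n%:R + 1 - 2%:R * t) n * rising (1
      + t) n * rising (1 - t) n / n`!%:R ^+ 3)).
Proof.
have iZ := sixth_int; have fu := fact_unit_n.
have [//||l1 [l2 [l1Z l2Z L0u hL]]] := @rising_expand3 p pp p_gt3 n.+1 n; first by lia.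
have [//||h1 [h2 [h1Z h2Z _ hB]]] := @rising_expand3 p pp p_gt3 1 n; first by lia.
have aE : i6 = t - n%:R by rewrite nE /t; ring.
have e0 : 1 - i6 + t = n.+1%:R by rewrite aE -natr1; ring.
have em : 1 - i6 = n.+1%:R + p%:R * - i6 by rewrite {1}aE /t -natr1; ring.
have ep : 1 - i6 + 2%:R * t = n.+1%:R + p%:R * i6 by rewrite {1}aE /t -natr1; ring.
have e2 : n%:R + 1 - 2%:R * t = n.+1%:R + p%:R * (- 2%:R * i6) by rewrite /t -natr1; ring.
rewrite {1}aE rising_negn_shift e0 ep em e2.
rewrite rising_fact in hB.
set L0 := rising n.+1%:R n in L0u hL *.
set Lm := rising (n.+1%:R + p%:R * - i6) n.
set Lp := rising (n.+1%:R + p%:R * i6) n.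
set L2 := rising (n.+1%:R + p%:R * (- 2%:R * i6)) n.
set B := rising (1 + t) n; set f := n`!%:R in hB fu *.
have hB' : cg p 3 B (f * (1 + t * h1 + t ^+ 2 * h2)) by exact: hB.
have Bu : B \in punit p.
  apply: (punit_cg_near (z := i6 * h1 + t * i6 * h2) pp _ fu _ _ hB').
  - by [].
  - by rewrite /t; zint.
  - by rewrite /t; ring.
have AZ : rising (1 - t) n \in pintegral p.
  by apply: rpred_prod => i _; rewrite /t; zint.
have key : cg p 3 (f * (3%:R * Lm * B ^+ 2 - 3%:R * L0 * f * B
  + Lp * f ^+ 2)) (L2 * B ^+ 3).
  have fZ := punit_int fu; have L0Z := punit_int L0u.
  apply: (third_difference_cg fZ L0Z l1Z l2Z h1Z h2Z _ _ _ hB').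
  - have sZ : - i6 \in pintegral p by zint.
    have -> : 1 - t * l1 + t ^+ 2 * l2 =
      1 + p%:R * - i6 * l1 + (p%:R * - i6) ^+ 2 * l2 by rewrite /t; ring.
    exact: hL.
  - exact: hL.
  - have sZ : - 2%:R * i6 \in pintegral p by zint.
    have -> : 1 - 2%:R * t * l1 + 4%:R * t ^+ 2 * l2 =
      1 + p%:R * (- 2%:R * i6) * l1
        + (p%:R * (- 2%:R * i6)) ^+ 2 * l2 by rewrite /t; ring.
    exact: hL.
rewrite -!mulrA; apply: cgMl; first by zint.
have [f0 B0] := (punit_neq0 fu, punit_neq0 Bu).
apply: (cg_cancel (punitM (punitX 3 fu) (punitX 2 Bu))).
rewrite [X in cg _ _ X](_ : _ = rising (1 - t) n *
  (f * (3%:R * Lm * B ^+ 2 - 3%:R * L0 * f * B + Lp * f ^+ 2))); last first.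
  by field; rewrite f0 B0.
rewrite [X in cg _ _ _ X](_ : _ = rising (1 - t) n * (L2 * B ^+ 3)); last by field.
exact: cgMl.
Qed.

(* The combination of binomials that (1 - x)^(2 n p^2) produces when it is
   expanded modulo p^3 and x^(p-1) = 1; see tau_1B_pow. *)
Definition Wbin : rat :=
  - 8%:R * n%:R * 'C(2 * n, n)%:R + 4%:R * n%:R * 'C(8 * n, n)%:R
  + n%:R * (2%:R * n%:R - 1) * (2%:R * 'C(14 * n, n)%:R + 'C(14 * n, 7 * n)%:R
      - 4%:R * 'C(8 * n, n)%:R + 'C(2 * n, n)%:R).

Lemma bin_rising m k : (k <= m)%N -> 'C(m, k)%:R = rising ((m - k)%:R
  + 1) k / k`!%:R :> rat.
Proof.
move=> km; rewrite rising_ffact subnK // -bin_ffact natrM mulfK //.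
by rewrite pnatr_eq0 -lt0n fact_gt0.
Qed.

(** The binomials C(2n,n), C(8n,n), C(14n,n) involve the rising factorials of length n from n+1, n+p
    and n-1+2p. Up to end factors and shifts by multiples of p these are one product of length n-1
    from n, namely [P]; [F] does the same for products starting at 1. *)
Let P (s : rat) := rising (n%:R + s) nu.
Let F (s : rat) := rising (1 + s) nu.

Lemma nu_n : nu%:R = n%:R - 1 :> rat.
Proof. by rewrite /n -natr1 addrK. Qed.

Lemma nfactE : n`!%:R = n%:R * nu`!%:R :> rat.
Proof. by rewrite /n factS natrM. Qed.

Lemma n_neq0 : (n%:R : rat) != 0. Proof. by rewrite pnatr_eq0. Qed.

Lemma nufact_neq0 : (nu`!%:R : rat) != 0.
Proof. by rewrite pnatr_eq0 -lt0n fact_gt0. Qed.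

Lemma bin2nE : n%:R * 'C(2 * n, n)%:R = 2%:R * (2%:R * n%:R - 1) * P 0 / nu`!%:R :> rat.
Proof.
rewrite bin_rising; last by lia.
have -> : (2 * n - n = n)%N by lia.
have h := risingSl n%:R n; rewrite (risingS _ n) /n (risingS _ nu) -/n nu_n in h.
rewrite nfactE /P addr0; have [n0 f0] := (n_neq0, nufact_neq0).
by apply: (mulfI n0); rewrite mulrCA [n%:R * (_ / _)]mulrA -h; field; rewrite n0 f0.
Qed.

Lemma bin8nE : n%:R * 'C(8 * n, n)%:R = (2%:R * n%:R - 1
  + p%:R) * P p%:R / nu`!%:R :> rat.
Proof.
rewrite bin_rising; last by lia.
have -> : (8 * n - n)%:R + 1 = n%:R + p%:R :> rat.
  by rewrite -natrD natr1; congr _%:R; lia.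
rewrite nfactE (_ : rising _ n = rising (n%:R + p%:R) nu * (n%:R + p%:R
  + (n%:R - 1))) /P; last first.
  by rewrite -nu_n; exact: risingS.
have [n0 f0] := (n_neq0, nufact_neq0).
by field; rewrite n0 f0.
Qed.

Lemma bin14nE :
  n%:R * 'C(14 * n, n)%:R = (n%:R - 1 + 2%:R * p%:R) * P (2%:R * p%:R) / nu`!%:R :> rat.
Proof.
rewrite bin_rising; last by lia.
have -> : (14 * n - n)%:R + 1 = n%:R - 1 + 2%:R * p%:R :> rat.
  have -> : (14 * n - n)%N = (2 * p + nu - 1)%N by lia.
  by rewrite natrB ?natrD ?natrM ?nu_n; [ring | lia].
rewrite nfactE (risingSl _ nu : rising _ n = _) /P; have [n0 f0] := (n_neq0, nufact_neq0).
have -> : n%:R - 1 + 2%:R * p%:R + 1 = n%:R + 2%:R * p%:R :> rat by ring.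
by field; rewrite n0 f0.
Qed.

(** As 7n = p + (n-1), the binomial splits off C(2p,p), the first two factors here, which is 2
    modulo p^3 by Wolstenholme. *)
Lemma bin14n7nE : 'C(14 * n, 7 * n)%:R =
  2%:R * (rising (1 + p%:R) p.-1 / (p.-1)`!%:R) * (F (2%:R * p%:R) * P (2%:R
    * p%:R) / F p%:R ^+ 2) :> rat.
Proof.
have p0 := p_neq0 pp.
have e7 : (7 * n = p + nu)%N by lia.
have e14 : (14 * n = (p + p) + (nu + nu))%N by lia.
have e : 'C(14 * n, 7 * n)%:R * ((7 * n)`!%:R * (7 * n)`!%:R) = (14 * n)`!%:R :> rat.
  rewrite -!natrM; congr _%:R; rewrite -(@bin_fact (14 * n) (7 * n)); last by lia.
  by congr (_ * (_ * _`!))%N; lia.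
move: e; have -> : (7 * n)`!%:R = rising 1 (p + nu) by rewrite rising_fact e7.
have -> : (14 * n)`!%:R = rising 1 ((p + p) + (nu + nu)) by rewrite rising_fact e14.
rewrite (rising_add _ (p
  + p)) (rising_add _ nu nu) (rising_add _ p p) (rising_add _ p nu).
have eP : rising (1 + (p + p)%:R + nu%:R) nu = P (2%:R * p%:R).
  by rewrite /P nu_n natrD; congr (rising _ _); ring.
have eF : rising (1 + (p + p)%:R) nu = F (2%:R * p%:R).
  by rewrite /F natrD; congr (rising _ _); ring.
rewrite eP eF -/(F p%:R).
have eq1 : rising 1 p = (p.-1)`!%:R * p%:R.
  by rewrite -{1}(prednK (prime_gt0 pp)) risingS rising_fact nat1r prednK ?prime_gt0.
have eq2 : rising (1 + p%:R) p = rising (1 + p%:R) p.-1 * (2%:R * p%:R).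
  rewrite -{2}(prednK (prime_gt0 pp)) risingS; congr (_ * _).
  by rewrite addrAC nat1r prednK ?prime_gt0 //; ring.
have F0 : F p%:R != 0 by rewrite gt_eqF // rising_gt0 // ltr_wpDr ?ler0n.
have f0 : ((p.-1)`!%:R : rat) != 0 by rewrite pnatr_eq0 -lt0n fact_gt0.
rewrite eq1 eq2 => e.
have n0 : ((p.-1)`!%:R * p%:R * F p%:R) ^+ 2 != 0 by rewrite expf_neq0 // !mulf_neq0.
apply: (mulIf n0); rewrite expr2 e; field.
by rewrite F0 f0.
Qed.

Lemma one_sub_p_unit : 1 - p%:R \in punit p.
Proof.
apply: (punit_cg pp (e := 1) (b := 1)) => //; last exact: punit1.
by exists (-1); [zint | ring].
Qed.

Lemma one_add_p_unit : 1 + p%:R \in punit p.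
Proof.
apply: (punit_cg pp (e := 1) (b := 1)) => //; last exact: punit1.
by exists 1; [zint | ring].
Qed.

(** Passing from length n to n - 1 costs end factors; they are rational functions of p because n =
    (p-1)/6 and t = p/6. *)
Lemma bracket_product : rising (n%:R + 1 - 2%:R * t) n * rising (1
  + t) n * rising (1 - t) n / n`!%:R ^+ 3
  = 16%:R * (1 - 2%:R * p%:R) / ((1 + p%:R) * (1 - p%:R) ^+ 3)
    * (P (- 2%:R * t) * (F t * F (- t)) / nu`!%:R ^+ 3).
Proof.
have [u1 u2] := (punit_neq0 one_add_p_unit, punit_neq0 one_sub_p_unit).
have h := risingSl (n%:R - 2%:R * t) n.
rewrite (risingS _ n) (risingS _ nu : rising _ n = _) nu_n in h.
have d0 : n%:R - 2%:R * t != 0.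
  have -> : n%:R - 2%:R * t = - (1 + p%:R) * i6 by rewrite nE /t; ring.
  by rewrite mulf_neq0 ?oppr_eq0.
have -> : rising (n%:R + 1 - 2%:R * t) n = P (- 2%:R * t) *
    (n%:R - 2%:R * t + (n%:R - 1)) * (n%:R - 2%:R * t + n%:R) / (n%:R - 2%:R * t).
  apply: (mulfI d0); rewrite [in RHS]mulrC divfK //.
  have -> : n%:R + 1 - 2%:R * t = n%:R - 2%:R * t + 1 by ring.
  by rewrite -h /P mulNr.
rewrite (risingS (1 + t) nu : rising (1
  + t) n = _) (risingS (1 - t) nu : rising (1 - t) n = _).
rewrite -/(F t) -/(F (- t)) nfactE nu_n.
have g0 := nufact_neq0; have n0 := n_neq0.
move: d0 n0; rewrite nE /t => d0 n0.
have {n0} m0 : p%:R - 1 != 0 :> rat by rewrite -opprB oppr_eq0.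
have d1 : p%:R - 1 - 2 * p%:R != 0 :> rat.
  by rewrite (_ : _ - _ = - (1 + p%:R)) ?oppr_eq0 //; ring.
rewrite /i6; move: (F _) (F _) (P _) => x y z.
by field; rewrite ?g0 ?u1 ?u2 ?m0 ?d1.
Qed.

(** The denominator is (1+p)(1-p)^3 = 1 - 2p + 2p^3 - p^4. *)
Lemma kappa_cg :
  cg p 3 (16%:R * (1 - 2%:R * p%:R) / ((1 + p%:R) * (1 - p%:R) ^+ 3)) 16%:R.
Proof.
have [u1 u2] := (one_add_p_unit, one_sub_p_unit).
apply: (cg_cancel (punitM u1 (punitX 3 u2))).
rewrite mulrC divfK; last
  by rewrite mulf_neq0 ?expf_neq0 ?(punit_neq0 u1) ?(punit_neq0 u2).
by exists (- 32%:R + 16%:R * p%:R); [zint | ring].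
Qed.

(** Modulo p^3 both sides are P(0)/(n-1)! times a polynomial in p, e1, e2 and d = 2 h2 - h1^2. Only
    d remains of [F], since the linear terms cancel both in F(t) F(-t) and in F(2p)/F(p)^2. *)
Lemma Wbin_cg :
  cg p 3 (rising (n%:R + 1 - 2%:R * t) n * rising (1
    + t) n * rising (1 - t) n / n`!%:R ^+ 3) Wbin.
Proof.
have iZ := sixth_int; have [u1 u2] := (one_add_p_unit, one_sub_p_unit).
have kap := kappa_cg.
have fpu : (p.-1)`!%:R \in punit p by apply: punit_fact => //; lia.
have gu : nu`!%:R \in punit p by apply: punit_fact => //; lia.
have [//||e1 [e2 [e1Z e2Z P0u hP]]] := @rising_expand3 p pp p_gt3 n nu; first by lia.
have [//||h1 [h2 [h1Z h2Z _ hF]]] := @rising_expand3 p pp p_gt3 1 nu; first by lia.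
rewrite rising_fact in hF.
pose d := 2%:R * h2 - h1 ^+ 2.
have dZ : d \in pintegral p by rewrite /d; zint.
have tZ : t \in pintegral p by rewrite /t; zint.
have FZ s : s \in pintegral p -> F s \in pintegral p.
  by move=> sZ; apply: rpred_prod => i _; zint.
have PZ s : s \in pintegral p -> P s \in pintegral p.
  by move=> sZ; apply: rpred_prod => i _; zint.
have {}hF s : s \in pintegral p -> cg p 3 (F (p%:R * s))
    (nu`!%:R * (1 + p%:R * s * h1 + (p%:R * s) ^+ 2 * h2)) by exact: hF.
have {}hP s : s \in pintegral p -> cg p 3 (P (p%:R * s))
    (P 0 * (1 + p%:R * s * e1 + (p%:R * s) ^+ 2 * e2)).
  by move=> sZ; rewrite /P addr0; exact: hP.
have {}P0u : P 0 \in punit p by rewrite /P addr0.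
have hFF : cg p 3 (F t * F (- t)) (nu`!%:R ^+ 2 * (1 + t ^+ 2 * d)).
  have mZ : - i6 \in pintegral p by zint.
  have h := hF _ mZ; rewrite mulrN -/t in h.
  have ha := hF _ iZ; rewrite -/t in ha.
  have FmZ : F (- t) \in pintegral p by apply: FZ; zint.
  eapply cg_trans; first by cgsub; zint.
  exists (nu`!%:R ^+ 2 * (i6 ^+ 4 * h2 ^+ 2 * p%:R)); first by zint.
  by rewrite /d /t; ring.
have pZ : p%:R \in pintegral p by zint.
have p2Z : p%:R * 2%:R \in pintegral p by zint.
have one : 1 \in pintegral p by zint.
have two : 2%:R \in pintegral p by zint.
have hF1 := hF _ one; rewrite mulr1 in hF1.
have hF2 := hF _ two; rewrite [p%:R * 2%:R]mulrC in hF2.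
have F1u : F p%:R \in punit p.
  apply: (punit_cg_near (z := h1 + p%:R * h2) pp _ gu _ _ hF1).
  - by [].
  - by zint.
  - by ring.
have hquot : cg p 3 (F (2%:R * p%:R) / F p%:R ^+ 2) ((1 + p%:R ^+ 2 * d) / nu`!%:R).
  apply: (cg_cancel (punitM gu (punitX 2 F1u))).
  have [F0 g0] := (punit_neq0 F1u, punit_neq0 gu).
  have -> : nu`!%:R * F p%:R ^+ 2 * (F (2%:R * p%:R) / F p%:R ^+ 2) =
    nu`!%:R * F (2%:R * p%:R) by field.
  have -> : nu`!%:R * F p%:R ^+ 2 * ((1 + p%:R ^+ 2 * d) / nu`!%:R) =
    (1 + p%:R ^+ 2 * d) * F p%:R ^+ 2 by field.
  apply: cg_trans (cgMl _ hF2) _; first by zint.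
  apply: cg_sym; eapply cg_trans; first by cgsub; zint.
  apply: cg_sym.
  exists (nu`!%:R ^+ 2 * (- 6%:R * h1 * h2 - 4%:R * h1 * h2 ^+ 2 * p%:R ^+ 2
    + h1 ^+ 2 * h2 ^+ 2 * p%:R ^+ 3 + 2%:R * h1 ^+ 3
    + 2%:R * h1 ^+ 3 * h2 * p%:R ^+ 2
    + h1 ^+ 4 * p%:R - 5%:R * h2 ^+ 2 * p%:R
    - 2%:R * h2 ^+ 3 * p%:R ^+ 3)); first by zint.
  by rewrite /d; ring.
have hw : cg p 3 (rising (1 + p%:R) p.-1 / (p.-1)`!%:R) 1.
  have [c cZ hc] := rising_wolstenholme pp p_gt3.
  exists (c / (p.-1)`!%:R); first by zint.
  by rewrite hc; field; exact: punit_neq0 fpu.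
have g1Z : (nu`!%:R)^-1 \in pintegral p by zint.
have g3Z : (nu`!%:R ^+ 3)^-1 \in pintegral p := punitV_int (punitX 3 gu).
have hPm : cg p 3 (P (- 2%:R * t)) (P 0 * (1 - 2%:R * t * e1 + 4%:R * t ^+ 2 * e2)).
  have -> : - 2%:R * t = p%:R * (- 2%:R * i6) by rewrite /t; ring.
  have -> : 1 - 2%:R * t * e1 + 4%:R * t ^+ 2 * e2 = 1 + p%:R * (- 2%:R * i6) * e1
    + (p%:R * (- 2%:R * i6)) ^+ 2 * e2 by rewrite /t; ring.
  by apply: hP; zint.
have hP1 := hP _ one; rewrite mulr1 in hP1.
have hP2 := hP _ two; rewrite [p%:R * 2%:R]mulrC in hP2.
have PmZ : P (- 2%:R * t) \in pintegral p by apply: PZ; zint.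
have FtZ : F t \in pintegral p by apply: FZ.
have FmtZ : F (- t) \in pintegral p by apply: FZ; zint.
have P1Z : P p%:R \in pintegral p by apply: PZ.
have P2Z : P (2%:R * p%:R) \in pintegral p by apply: PZ; zint.
have F2Z : F (2%:R * p%:R) \in pintegral p by apply: FZ; zint.
have WE : Wbin = - 8%:R * (n%:R * 'C(2 * n, n)%:R) + 4%:R * (n%:R * 'C(8 * n, n)%:R)
  + (2%:R * n%:R - 1) * (2%:R * (n%:R * 'C(14 * n, n)%:R) + n%:R * 'C(14 * n, 7 * n)%:R
      - 4%:R * (n%:R * 'C(8 * n, n)%:R) + n%:R * 'C(2 * n, n)%:R) by rewrite /Wbin; ring.
rewrite WE bracket_product bin2nE bin8nE bin14nE bin14n7nE.
set K := 16%:R * (1 - 2%:R * p%:R) / ((1 + p%:R) * (1 - p%:R) ^+ 3) in kap *.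
set w := rising (1 + p%:R) p.-1 / (p.-1)`!%:R in hw *.
set x2 := F (2%:R * p%:R) / F p%:R ^+ 2 in hquot *.
have -> : F (2%:R * p%:R) * P (2%:R * p%:R) / F p%:R ^+ 2 = x2 * P (2%:R * p%:R).
  by rewrite /x2; ring.
have KZ : K \in pintegral p by apply: cg_int kap _; zint.
have wZ : w \in pintegral p by apply: cg_int hw _; zint.
have x2Z : x2 \in pintegral p by apply: cg_int hquot _; zint.
have FFZ : F t * F (- t) \in pintegral p by zint.
set y := F t * F (- t) in hFF FFZ *.
have nZ : n%:R \in pintegral p by zint.
eapply cg_trans; first by cgsub; zint.
apply: cg_sym; eapply cg_trans; first by cgsub; zint.
apply: cg_sym.
have g0 := punit_neq0 gu.
rewrite nE.
exists (P 0 / nu`!%:R * (20%:R * i6 ^+ 2 * d - 224%:R * i6 ^+ 3 * d * e1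
  + 40%:R * i6 ^+ 2 * d * e1 * p%:R - 8%:R * i6 ^+ 2 * d * e1 * p%:R ^+ 2
  - 2240%:R * i6 ^+ 4 * d * e2 * p%:R
  + 80%:R * i6 ^+ 2 * d * e2 * p%:R ^+ 2 - 16%:R * i6 ^+ 2 * d * e2 * p%:R ^+ 3
  - 4%:R * i6 ^+ 2 * d * p%:R - 8%:R * i6 * e1
  + 512%:R * i6 ^+ 2 * e2 - 160%:R * i6 ^+ 2 * e2 * p%:R)); first by zint.
rewrite /t /i6; generalize (P 0) d => P0 d'.
by field.
Qed.

(** The last factor of (1/6)_(n+1) is t, and 6 t = p; this factor is what reduces the required
    precision from p^4 to p^3. *)
Lemma sum_Wbin :
  cg p 4 (\sum_(k < p) (12 * k + 1)%:R * gbinom (- i6) k ^+ 4)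
    (p%:R * ((-1) ^+ n * Wbin)).
Proof.
have np : (n < p)%N by lia.
have nc : (6 * n + 1 = 1 * p)%N by rewrite mul1n.
have := sum_closed_form pp p_gt3 np nc; rewrite mul1r -/i6 -/t.
move/cg_trans; apply.
have -> (z : rat) : 6%:R * (rising i6 n.+1 * z) = p%:R * (rising i6 n * z).
  by rewrite risingS nE /i6; field.
apply: cg_pMl; apply: cg_trans bracket_cg _.
apply: cgMl; [by zint | exact: Wbin_cg].
Qed.

(** Needed to know that the Jacobi sum is the unit root of its quadratic and not the root divisible
    by p. *)
Lemma Wbin_unit : Wbin \in punit p.
Proof.
have iZ := sixth_int; have fu := fact_unit_n.
have near r s : (0 < r)%N -> (r + n <= p)%N -> s \in pintegral p ->
    rising (r%:R + p%:R * s) n \in punit p.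
  move=> r0 rn sZ; have [e1 [e2 [e1Z e2Z ru h]]] := rising_expand3 pp p_gt3 r0 rn.
  apply: (punit_cg_near (z := s * e1 + p%:R * s ^+ 2 * e2) pp _ ru _ _ (h s sZ)).
  - by [].
  - by zint.
  - by ring.
have u1 : rising (n%:R + 1 - 2%:R * t) n \in punit p.
  have -> : n%:R + 1 - 2%:R * t = n.+1%:R + p%:R * (- 2%:R * i6).
    by rewrite /t -natr1; ring.
  by apply: near; [by [] | lia | zint].
have u2 : rising (1 + t) n \in punit p.
  by apply: (near 1%N); [by [] | lia | zint].
have u3 : rising (1 - t) n \in punit p.
  by rewrite /t -mulrN; apply: (near 1%N); [by [] | lia | zint].
apply: (punit_cg pp (e := 3) _ (cg_sym Wbin_cg)); first by [].
apply: punitM; last by apply: punitVr; exact: punitX.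
by apply: punitM => //; exact: punitM.
Qed.
End CaseOne.

(** * A Jacobi sum modulo p^3 *)

Lemma pow_expand p (x : rat) k : x \in pintegral p ->
  cg p 3 ((1 + p%:R * x) ^+ (2 * k))
    (1 + 2%:R * k%:R * p%:R * x + k%:R * (2%:R * k%:R - 1) * p%:R ^+ 2 * x ^+ 2).
Proof.
move=> xZ; elim: k => [|k [c cZ IH]].
  by exists 0; [exact: pintegral0 | rewrite muln0 expr0; ring].
rewrite mulnS exprD IH -natr1.
exists (c * (1 + p%:R * x) ^+ 2 + x ^+ 3 * (2%:R * k%:R + 2%:R * k%:R * (2%:R * k%:R - 1)
   + k%:R * (2%:R * k%:R - 1) * p%:R * x)); first by zint.
by ring.
Qed.

Section JacobiSum.
Variables (p n : nat).
Hypotheses (pp : prime p) (n_gt0 : (0 < n)%N) (pE : p = (6 * n + 1)%N).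

(* J(chi^-1, chi^2) for the sextic character chi = tau^n, as 5n = -n mod p-1. *)
Definition jacobi : rat := \sum_(x : 'F_p) tau x ^+ (5 * n) * tau (1 - x) ^+ (2 * n).

(** For U = 1 + p alpha, c0 + c1 U + c2 U^2 is (1 - p) U^(2n(p+1)) modulo p^3: c0 + c1 + c2 = -6n =
    1 - p, then c1 + 2 c2 = 2n because (1 - p)(1 + p) = 1 modulo p^2, and c2 = n(2n-1). The factor 1
    - p keeps the coefficients polynomial in n. *)
Let c0 : rat := - 8%:R * n%:R + n%:R * (2%:R * n%:R - 1).
Let c1 : rat := 2%:R * n%:R - 2%:R * (n%:R * (2%:R * n%:R - 1)).
Let c2 : rat := n%:R * (2%:R * n%:R - 1).

Lemma natp_n : p%:R = 6%:R * n%:R + 1 :> rat.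
Proof. by rewrite [in LHS]pE natrD natrM. Qed.

(* With u = w^(p-1) = 1 + p alpha, both sides are w^(2n) times polynomials in
   alpha agreeing to second order. *)
Lemma tau_1B_pow (x : 'F_p) :
  cg p 3 ((1 - p%:R) * tau (1 - x) ^+ (2 * n))
    (c0 * (1 - tau x) ^+ (2 * n) + c1 * (1 - tau x) ^+ (8 * n)
      + c2 * (1 - tau x) ^+ (14 * n)).
Proof.
(* With 6n = p - 1 this is p^2 = 1 + (p - 1)(p + 1), times 2n. *)
have ee : (p ^ 2 * (2 * n) = 2 * n + 6 * n * (2 * (n * (p + 1))))%N.
  by rewrite pE; nia.
have [->|x1] := eqVneq x 1.
  rewrite subrr tau0 // tau1 // subrr !expr0n.
  have -> : (2 * n == 0)%N = false by apply/eqP; lia.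
  have -> : (8 * n == 0)%N = false by apply/eqP; lia.
  have -> : (14 * n == 0)%N = false by apply/eqP; lia.
  by rewrite !mulr0 !addr0; exact: cg_refl.
set w := 1 - tau x.
have tZ := tau_int x.
have wZ : w \in pintegral p by rewrite /w; zint.
have hw1 : cg p 1 (rep (1 - x)) w.
  apply: cg_trans (rep1B pp x) _; apply: cgB; first exact: cg_refl.
  by apply: cg_sym; exact: tau_rep.
have x1' : 1 - x != 0 by rewrite subr_eq0 eq_sym.
have rZ := rep_int (1 - x).
have rZ' := rep_int ((1 - x) ^+ p.-1).
have h1 : cg p 3 (tau (1 - x)) (w ^+ (p ^ 2)) := cg_expp2 pp rZ wZ hw1.
have pm : p.-1 = (6 * n)%N by lia.
have [al alZ hal] : cg p 1 (w ^+ (6 * n)) 1.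
  have := repX pp (1 - x) p.-1; rewrite Fp_fermat // rep1 // => h.
  apply: cg_trans (cg_sym h); rewrite pm; apply: cg_sym.
  exact: cgX.
have tZ' := tau_int (1 - x).
have wpZ : w ^+ (p ^ 2) \in pintegral p by zint.
have mZ : 1 - p%:R \in pintegral p by zint.
apply: cg_trans (cgMl mZ (cgX (2 * n) tZ' wpZ h1)) _.
have -> : (w ^+ (p ^ 2)) ^+ (2 * n) =
    w ^+ (2 * n) * (w ^+ (6 * n)) ^+ (2 * (n * (p + 1))).
  by rewrite -!exprM -exprD ee.
have -> : w ^+ (8 * n) = w ^+ (2 * n) * w ^+ (6 * n) by rewrite -exprD -mulnDl.
have -> : w ^+ (14 * n) = w ^+ (2 * n) * w ^+ (6 * n) ^+ 2.
  by rewrite -exprM -exprD mulnAC -mulnDl.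
rewrite hal expr1.
have [c cZ ->] := pow_expand (n * (p + 1)) alZ.
set W := w ^+ (2 * n); have WZ : W \in pintegral p by rewrite /W; zint.
rewrite natrM natrD.
exists ((1 - p%:R) * W * c + W * (n%:R * p%:R * al ^+ 2 - 2%:R * n%:R * al -
   2%:R * n%:R ^+ 2 * p%:R * al ^+ 2 - 2%:R * n%:R ^+ 2 * p%:R ^+ 2 * al ^+ 2
   + 2%:R * n%:R ^+ 2 * al ^+ 2)); first by zint.
have -> : c0 = (1 - p%:R) - c1 - c2 by rewrite natp_n /c0 /c1 /c2; ring.
by rewrite /c1 /c2; ring.
Qed.

(** In the binomial expansion only the exponents 5n + j divisible by p - 1 have a nonzero power
    sum. *)
Lemma sum_tau_prog M :
  cg p 3 (\sum_(x : 'F_p) tau x ^+ (5 * n) * (1 - tau x) ^+ M)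
   ((p%:R - 1) * \sum_(j < M.+1 | (6 * n %| 5 * n + j)%N) (-1) ^+ j * 'C(M, j)%:R).
Proof.
have pm : p.-1 = (6 * n)%N by lia.
have -> : \sum_(x : 'F_p) tau x ^+ (5 * n) * (1 - tau x) ^+ M =
    \sum_(j < M.+1) (-1) ^+ j * 'C(M, j)%:R * \sum_(x : 'F_p) tau x ^+ (5 * n + j).
  transitivity (\sum_(x : 'F_p) \sum_(j < M.+1)
      (-1) ^+ j * 'C(M, j)%:R * tau x ^+ (5 * n + j)).
    apply: eq_bigr => x _; rewrite exprBn mulr_sumr; apply: eq_bigr => j _.
    by rewrite expr1n mulr1 exprD -mulr_natr; ring.
  by rewrite exchange_big; apply: eq_bigr => j _; rewrite mulr_sumr.
rewrite [X in cg _ _ _ (_ * X)]big_mkcond mulr_sumr; apply: cg_sum => j _ _.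
have j0 : (0 < 5 * n + j)%N by lia.
have := sum_tau pp j0; rewrite pm; case: ifP => _ h.
  rewrite [X in cg _ _ _ X]mulrC; apply: cgMl => //; zint.
rewrite mulr0 -[X in cg _ _ _ X](mulr0 ((-1) ^+ j * 'C(M, j)%:R)).
by apply: cgMl => //; zint.
Qed.

Lemma dvdn_prog j : (6 * n %| 5 * n + j)%N -> exists k, j = (n + 6 * n * k)%N.
Proof.
case/dvdnP => [[|k]] h; first by lia.
by exists k; nia.
Qed.

Lemma signN6 k : (-1) ^+ (n + 6 * n * k) = (-1) ^+ n :> rat.
Proof.
by rewrite exprD (_ : (6 * n * k = 2 * (3 * n
  * k))%N) 1?exprM ?sqrrN ?expr1n ?mulr1 //; lia.
Qed.

Lemma sum_prog M q : (n + 6 * n * q <= M < n + 6 * n * q.+1)%N ->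
  \sum_(j < M.+1 | (6 * n %| 5 * n + j)%N) (-1) ^+ j * 'C(M, j)%:R =
  (-1) ^+ n * \sum_(k < q.+1) 'C(M, n + 6 * n * k)%:R :> rat.
Proof.
case/andP=> qM Mq; rewrite mulr_sumr.
have hM (k : 'I_q.+1) : (n + 6 * n * k < M.+1)%N.
  by have := ltn_ord k; rewrite ltnS => kq; nia.
pose h (k : 'I_q.+1) : 'I_M.+1 := Ordinal (hM k).
rewrite (reindex_onto h (fun j : 'I_M.+1 => inord ((j - n) %/ (6 * n)))) /=.
  apply: eq_big => k.
    have -> : (5 * n + (n + 6 * n * k) = k.+1 * (6 * n))%N by lia.
    rewrite dvdn_mull // /= -val_eqE /= addKn mulKn ?muln_gt0 //.
    by rewrite inordK ?ltn_ord // eqxx.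
  by move=> _; rewrite signN6.
move=> j /dvdn_prog [k jk]; apply: val_inj => /=.
rewrite jk addKn mulKn ?muln_gt0 // inordK //.
have := ltn_ord j; rewrite ltnS jk => kM; rewrite ltnS leqNgt; apply/negP=> qk; nia.
Qed.

(** The factor 1 - p introduced by c0, c1, c2 cancels, up to sign, the p - 1 of the power sums. The
    surviving j are n, 7n and 13n, as far as they do not exceed 2n, 8n or 14n; symmetry of binomials
    leaves those of [Wbin]. *)
Lemma jacobi_Wbin : cg p 3 jacobi (- ((-1) ^+ n * Wbin n.-1)).
Proof.
have u : 1 - p%:R \in punit p := one_sub_p_unit pp.
have pZ : p%:R - 1 \in pintegral p by zint.
have c0Z : c0 \in pintegral p by rewrite /c0; zint.
have c1Z : c1 \in pintegral p by rewrite /c1; zint.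
have c2Z : c2 \in pintegral p by rewrite /c2; zint.
apply: (cg_cancel u); rewrite /jacobi mulr_sumr.
apply: (@cg_trans _ _ (c0 * (\sum_(x : 'F_p) tau x ^+ (5 * n) * (1 - tau x) ^+ (2 * n))
   + c1 * (\sum_(x : 'F_p) tau x ^+ (5 * n) * (1 - tau x) ^+ (8 * n))
   + c2 * (\sum_(x : 'F_p) tau x ^+ (5 * n) * (1 - tau x) ^+ (14 * n)))).
  rewrite !mulr_sumr -!big_split /=; apply: cg_sum => x _ _.
  rewrite mulrCA; have tZ := tau_int x.
  have tkZ : tau x ^+ (5 * n) \in pintegral p by zint.
  apply: cg_trans (cgMl tkZ (tau_1B_pow x)) _.
  by exists 0; [zint | ring].
have s2 := sum_tau_prog (2 * n); have s8 := sum_tau_prog (8 * n).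
have s14 := sum_tau_prog (14 * n).
rewrite (@sum_prog _ 0) in s2; last by lia.
rewrite (@sum_prog _ 1) in s8; last by lia.
rewrite (@sum_prog _ 2) in s14; last by lia.
apply: cg_trans (cgD (cgD (cgMl c0Z s2) (cgMl c1Z s8)) (cgMl c2Z s14)) _.
rewrite !big_ord_recl !big_ord0 /= !muln0 !addn0 !muln1.
have -> : 'C(8 * n, n + 6 * n) = 'C(8 * n, n).
  by rewrite -bin_sub; [congr 'C(_, _); lia | lia].
have -> : 'C(14 * n, n + 6 * n * 2) = 'C(14 * n, n).
  by rewrite -bin_sub; [congr 'C(_, _); lia | lia].
have -> : (n + 6 * n = 7 * n)%N by lia.
rewrite /Wbin prednK //.
by exists 0; [zint | rewrite /c0 /c1 /c2; ring].
Qed.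
End JacobiSum.

(** * Quadratic and cubic character sums *)

Section CubicSums.
Variables (p n : nat).
Hypotheses (pp : prime p) (n_gt0 : (0 < n)%N) (pE : p = (6 * n + 1)%N).
Implicit Types (v x y s c : 'F_p).

Lemma pm1 : p.-1 = (6 * n)%N. Proof. by rewrite pE addn1. Qed.

Lemma Fp_exp6n v : v != 0 -> v ^+ (6 * n) = 1.
Proof. by move=> v0; rewrite -pm1 Fp_fermat. Qed.

Lemma Fp_nat_neq0 k : (0 < k < p)%N -> k%:R != 0 :> 'F_p.
Proof.
case/andP=> k0 kp; rewrite -(dvdn_pcharf (pchar_Fp pp)).
by rewrite gtnNdvd.
Qed.

Lemma Fp2_neq0 : 2%:R != 0 :> 'F_p.
Proof. by apply: Fp_nat_neq0; lia. Qed.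

Lemma Fp4_neq0 : 4%:R != 0 :> 'F_p.
Proof. by apply: Fp_nat_neq0; lia. Qed.

Lemma Fp_half v : v != 0 -> (v ^+ (3 * n) == 1) || (v ^+ (3 * n) == -1).
Proof.
move=> v0; rewrite -eqf_sqr expr1n -exprM; apply/eqP.
by rewrite (_ : (3 * n * 2 = 6 * n)%N) ?Fp_exp6n //; lia.
Qed.

Lemma Fp_1_neqN1 : (1 : 'F_p) != -1.
Proof. by rewrite -subr_eq0 opprK (_ : 1 + 1 = 2%:R) ?Fp2_neq0. Qed.

(** The Legendre symbol through Euler's criterion. Integer values allow its sums to be studied
    modulo 2 and 3, which values in F_p would not. *)
Definition rho v : int := if v == 0 then 0 else if v ^+ (3 * n) == 1 then 1 else -1.

Lemma rho0 : rho 0 = 0. Proof. by rewrite /rho eqxx. Qed.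

Lemma rhoM x y : rho (x * y) = rho x * rho y.
Proof.
rewrite /rho mulf_eq0; have [//|x0] := eqVneq x 0; first by rewrite mul0r.
have [//|y0] := eqVneq y 0; first by rewrite mulr0.
rewrite /= exprMn.
have n1 : (-1 == 1 :> 'F_p) = false by rewrite eq_sym; exact: negbTE Fp_1_neqN1.
case/orP: (Fp_half x0) => /eqP ->; case/orP: (Fp_half y0) => /eqP ->;
  by rewrite ?mulr1 ?mul1r ?mulrNN ?mulr1 ?eqxx ?n1.
Qed.

Lemma rho_sqr x : x != 0 -> rho (x ^+ 2) = 1.
Proof.
move=> x0; rewrite /rho expf_eq0 (negbTE x0) /= -exprM.
by rewrite (_ : (2 * (3 * n) = 6 * n)%N) ?Fp_exp6n ?eqxx //; lia.
Qed.

Lemma rho1 : rho 1 = 1.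
Proof. by rewrite -(expr1n _ 2) rho_sqr ?oner_neq0. Qed.

Lemma rho4 : rho 4%:R = 1.
Proof. by rewrite (_ : 4%:R = 2%:R ^+ 2) ?rho_sqr ?Fp2_neq0 //; ring. Qed.

Lemma rho_cg v : cg p 3 (rho v)%:~R (tau v ^+ (3 * n)).
Proof.
have e0 : (3 * n == 0)%N = false by apply/eqP; lia.
have [->|v0] := eqVneq v 0.
  by rewrite rho0 tau0 // expr0n e0; exact: cg_refl.
apply: cg_sym; apply: cg_trans (cg_sym (tauX pp _ _)) _.
rewrite /rho (negbTE v0); case: eqP => [->|/eqP n1]; first by rewrite tau1 //;
  exact: cg_refl.
have := Fp_half v0; rewrite (negbTE n1) /= => /eqP ->.
have -> : (-1)%:~R = (-1 : rat) ^+ (p ^ 2).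
  have po : odd (p ^ 2) by rewrite oddX /= pE addn1 /= oddM.
  by rewrite -signr_odd po expr1.
apply: cg_expp2 => //; [exact: rep_int | zint |].
have := repD pp (-1) 1; rewrite addNr rep0 rep1 // => -[z zZ h].
by exists (- z); [zint | apply: (addIr 1); rewrite -[LHS](addrK (p%:R ^+ 1
  * z)) -h; ring].
Qed.

Lemma card_sqr v : (#|[pred s | s ^+ 2 == v]|%:Z = 1 + rho v)%R.
Proof.
have [g hg] := Fp_prim_root pp.
have [->|v0] := eqVneq v 0.
  rewrite rho0 addr0; congr Posz.
  apply: (@etrans _ _ #|pred1 (0 : 'F_p)|); last exact: card1.
  by apply: eq_card => s; rewrite !inE sqrf_eq0.
rewrite /rho (negbTE v0); case: eqP => [v1|nv1].
  have [i vi] := Fp_gen pp hg v0.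
  have : (6 * n %| i * (3 * n))%N.
    by rewrite -pm1 (prim_order_dvd hg) exprM -vi v1.
  case/dvdnP=> k ik; have {}ik : i = (k * 2)%N by nia.
  pose s0 := g ^+ k; have vs : v = s0 ^+ 2 by rewrite vi ik exprM.
  have s00 : s0 != 0 by apply: contraNneq v0 => s00; rewrite vs s00 expr0n.
  have : s0 != - s0 by rewrite -subr_eq0 opprK -mulr2n -mulr_natl mulf_neq0 ?Fp2_neq0.
  move=> ss; congr Posz; apply: (@etrans _ _ #|pred2 s0 (- s0)|);
    last by rewrite card2 ss.
  by apply: eq_card => s; rewrite !inE vs eqf_sqr.
rewrite subrr; congr Posz; apply: eq_card0 => s; rewrite !inE; apply/negP=> /eqP sv.
apply: nv1; rewrite -sv -exprM (_ : (2 * (3 * n) = 6 * n)%N) ?Fp_exp6n //; last by lia.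
by apply: contraNneq v0 => s0; rewrite -sv s0 expr0n.
Qed.

Lemma sum_rho_mul (P : pred 'F_p) s : s != 0 -> rho s = -1 ->
  (forall v, P (s * v) = P v) -> \sum_(v | P v) rho v = 0.
Proof.
move=> s0 rs Ps; set S := \sum_(v | P v) _.
have : S = - S.
  rewrite {1}/S (reindex_inj (mulfI s0)) /= -sumrN.
  by apply: eq_big => [v|v _]; [exact: Ps | rewrite rhoM rs mulN1r].
by lia.
Qed.

Lemma prim_root_rho g : p.-1.-primitive_root g -> forall k, odd k -> rho (g ^+ k) = -1.
Proof.
move=> hg k ko; have g0 : g != 0 by rewrite (prim_root_eq0 hg) pm1; lia.
rewrite /rho expf_eq0 (negbTE g0) andbF -exprM -(prim_order_dvd hg) pm1.
case: ifP => // /dvdnP [q kq]; have {}kq : k = (q * 2)%N by nia.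
by move: ko; rewrite kq muln2 odd_double.
Qed.

Lemma sum_rho : \sum_(v : 'F_p) rho v = 0.
Proof.
have [g hg] := Fp_prim_root pp.
have g0 : g != 0 by rewrite (prim_root_eq0 hg) pm1; lia.
by apply: (sum_rho_mul g0) => //; rewrite -(expr1 g); exact: (prim_root_rho hg).
Qed.

Lemma sum_rho_shift c : \sum_(v : 'F_p) rho (v + c) = 0.
Proof.
rewrite -[RHS]sum_rho [RHS](reindex_inj (addIr c)) /=; exact: eq_bigr.
Qed.

(* The Moebius map v |-> (s v + 4)/(v + 4) is a bijection from the line minus
   {-4} onto the line minus {s}, and rho(a b) = rho(a/b). *)
Lemma sum_rho_quad s : s != 0 -> s != 1 ->
  \sum_(v : 'F_p) rho ((s * v + 4%:R) * (v + 4%:R)) = - rho s.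
Proof.
move=> s0 s1.
pose f v := (s * v + 4%:R) / (v + 4%:R); pose h v := 4%:R * (v - 1) / (s - v).
have n4 := Fp4_neq0.
have s1' : s - 1 != 0 by rewrite subr_eq0.
rewrite (bigD1 (- 4%:R)) //= addNr mulr0 rho0 add0r.
apply: (@etrans _ _ (\sum_(v | v != s) rho v)); last first.
  by have := sum_rho; rewrite (bigD1 s) //= addrC => /eqP; rewrite addr_eq0 => /eqP.
rewrite [RHS](reindex_onto f h) /=; last first.
  move=> v vs; have d0 : s - v != 0 by rewrite subr_eq0 eq_sym.
  have d1 : 4%:R * (v - 1) / (s - v) + 4%:R != 0.
    rewrite (_ : _ + _ = 4%:R * (s - 1) / (s - v)); last by field.
    by rewrite !mulf_neq0 // invr_eq0.
  rewrite /f /h; move: d1; rewrite (_ : _ / _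
    + _ = 4%:R * (s - 1) / (s - v)); last by field.
  by move=> _; field; rewrite d0 s1' n4.
have key v : v + 4%:R != 0 -> f v != s /\ h (f v) = v.
  move=> d0.
  have e : s - f v = 4%:R * (s - 1) / (v + 4%:R) by rewrite /f; field.
  have d1 : s - f v != 0 by rewrite e !mulf_neq0 // invr_eq0.
  split; first by rewrite eq_sym -subr_eq0.
  by rewrite /h e /f; field; rewrite d0 s1' n4.
apply: eq_big => v.
  have [->|v4] := eqVneq v (- 4%:R).
    rewrite /f addNr invr0 mulr0 /h /=; apply/esym/negbTE; rewrite negb_and negbK.
    apply/orP; right; apply/eqP => h1.
    have : 4%:R * (0 - 1) / (s - 0) + 4%:R = 0 :> 'F_p by rewrite h1 addNr.
    rewrite (_ : _ + _ = 4%:R * (s - 1) / s); last by field.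
    by move/eqP; rewrite !mulf_eq0 invr_eq0 (negbTE n4) (negbTE s1') (negbTE s0).
  have d0 : v + 4%:R != 0 by rewrite addr_eq0.
  by have [-> ->] := key v d0; rewrite eqxx.
move=> v4; have d0 : v + 4%:R != 0 by rewrite addr_eq0.
have -> : (s * v + 4%:R) * (v + 4%:R) = f v * (v + 4%:R) ^+ 2 by rewrite /f; field.
by rewrite rhoM rho_sqr // mulr1.
Qed.

Lemma sum_rho_sqr : \sum_(v : 'F_p) rho ((v + 4%:R) * (v + 4%:R)) = p%:Z - 1.
Proof.
rewrite (bigD1 (- 4%:R)) //= addNr mulr0 rho0 add0r.
rewrite (eq_bigr (fun=> 1)) => [|v v4]; last by rewrite -expr2 rho_sqr // addr_eq0.
rewrite sumr_const; have := cardC (pred1 (- 4%:R : 'F_p)); rewrite card1 card_Fp // => e.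
rewrite natz; move/(congr1 Posz): e; rewrite PoszD => <-.
by rewrite addrAC subrr add0r.
Qed.
End CubicSums.

(** * Cubic residue classes *)

Section CubicClasses.
Variables (p n : nat).
Hypotheses (pp : prime p) (n_gt0 : (0 < n)%N) (pE : p = (6 * n + 1)%N).
Variable om : 'F_p.
Hypotheses (om1 : om != 1) (om3 : om ^+ 3 = 1).
Hypothesis om_gen : exists2 g : 'F_p, p.-1.-primitive_root g & om = g ^+ (2 * n).
Implicit Types (v x y s c : 'F_p).

Lemma om_sum : 1 + om + om ^+ 2 = 0.
Proof.
have om1' : om - 1 != 0 by rewrite subr_eq0.
apply: (mulfI om1'); rewrite mulr0.
by rewrite (_ : (om - 1) * _ = om ^+ 3 - 1); [by rewrite om3 subrr | ring].
Qed.

Lemma om_neq0 : om != 0.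
Proof. by apply: contraTneq isT => o0; have
  := om3; rewrite o0 expr0n => /eqP; rewrite eq_sym oner_eq0. Qed.

Lemma om2_neq1 : om ^+ 2 != 1.
Proof.
apply: contraNneq om1 => o2; have := om3; rewrite exprS o2 mulr1 => ->.
by [].
Qed.

Lemma om2_neq : om ^+ 2 != om.
Proof.
apply: contraNneq om1 => o2; apply/eqP; apply: (mulfI om_neq0).
by rewrite mulr1 -expr2.
Qed.

(** The cubic residue symbol, with values in the cube roots of unity of F_p. *)
Definition kap v := v ^+ (2 * n).

Lemma kapM x y : kap (x * y) = kap x * kap y.
Proof. exact: exprMn. Qed.

Lemma kap_exp k v : kap v ^+ k = v ^+ (2 * n * k).
Proof. by rewrite exprM. Qed.

Lemma kapX x k : kap (x ^+ k) = kap x ^+ k.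
Proof. by rewrite /kap -!exprM mulnC. Qed.

Lemma kap0 : kap 0 = 0.
Proof. by rewrite /kap expr0n muln_eq0 /= eqn0Ngt n_gt0. Qed.

Lemma kap_eq0 v : (kap v == 0) = (v == 0).
Proof. by rewrite expf_eq0 muln_gt0 n_gt0. Qed.

Lemma kap1 : kap 1 = 1. Proof. exact: expr1n. Qed.

Lemma kap3 v : v != 0 -> kap v ^+ 3 = 1.
Proof.
by move=> v0; rewrite -exprM mulnAC (Fp_exp6n pp pE).
Qed.

Lemma kap_cube v : v != 0 -> kap (v ^+ 3) = 1.
Proof. by move=> v0; rewrite -(kap3 v0) /kap -!exprM mulnC. Qed.

Lemma kap_cases v : v != 0 -> [|| kap v == 1, kap v == om | kap v == om ^+ 2].
Proof.
move=> v0; set k := kap v; have k3 : k ^+ 3 = 1 := kap3 v0.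
have : (k - 1) * ((k - om) * (k - om ^+ 2)) = 0.
  apply: (@etrans _ _ (k ^+ 3 - 1 - k ^+ 2 * (1 + om + om ^+ 2)
     + k * (om * (1 + om + om ^+ 2)) - (om ^+ 3 - 1))); first by ring.
  by rewrite om_sum k3 om3 !mulr0 !subrr subr0 addr0.
by move/eqP; rewrite !mulf_eq0 !subr_eq0.
Qed.

Lemma sum_classes (V : zmodType) (F : 'F_p -> V) :
  \sum_(v | v != 0) F v = \sum_(v | kap v == 1) F v + \sum_(v | kap v == om) F v
    + \sum_(v | kap v == om ^+ 2) F v.
Proof.
have z1 : 1 != 0 :> 'F_p := oner_neq0 _.
have o0 := om_neq0; have o20 : om ^+ 2 != 0 by rewrite expf_neq0.
rewrite (bigID (fun v => kap v == 1)) /= -addrA; congr (_ + _).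
  apply: eq_bigl => v; rewrite andbC; case: eqP => //= k1.
  by rewrite -kap_eq0 k1 z1.
rewrite (bigID (fun v => kap v == om)) /=; congr (_ + _); apply: eq_bigl => v.
  rewrite andbC; case: eqP => //= k1.
  by rewrite -kap_eq0 k1 o0 (negbTE om1).
have [->|v0] /= := eqVneq v 0; first by rewrite kap0 eq_sym (negbTE o20).
have := kap_cases v0; case: eqP => [->|_] /=.
  by rewrite eq_sym (negbTE om2_neq1).
by case: eqP => [->|_] //= ; rewrite ?(negbTE om2_neq) // eq_sym (negbTE om2_neq).
Qed.

Definition cls c : {set 'F_p} := [set v | kap v == c].

Lemma card_cls_mul s c : s != 0 -> #|cls (kap s * c)| = #|cls c|.
Proof.
move=> s0; rewrite -(card_imset (mem (cls c)) (mulfI s0)); apply: eq_card => v.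
have ks0 : kap s != 0 by rewrite kap_eq0.
apply/idP/imsetP; rewrite inE.
  move=> /eqP kv; exists (v / s); last by rewrite mulrC divfK.
  rewrite inE; apply/eqP; apply: (mulfI ks0); rewrite -kapM -kv; congr kap.
  by rewrite mulrC divfK.
by case=> x; rewrite inE => /eqP <- ->; rewrite kapM.
Qed.

(** Multiplication by the primitive root g carries each class onto the next, because kap(g) = om. *)
Lemma card_classes :
  [/\ #|cls 1| = (2 * n)%N, #|cls om| = (2 * n)%N & #|cls (om ^+ 2)| = (2 * n)%N].
Proof.
have [g hg og] := om_gen.
have g0 : g != 0 by rewrite (prim_root_eq0 hg) (pm1 pE); lia.
have kg : kap g = om by rewrite og.
have h1 := card_cls_mul 1 g0; rewrite kg mulr1 in h1.
have h2 := card_cls_mul om g0; rewrite kg -expr2 in h2.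
have := sum_classes (fun=> 1 : int).
rewrite !sumr_const !natz.
have e c : #|(fun v => kap v == c)| = #|cls c| by apply: eq_card => v; rewrite !inE.
rewrite !e h2 h1; have := cardC (pred1 (0 : 'F_p)); rewrite card1 card_Fp //.
have -> : #|predC (pred1 (0 : 'F_p))| = #|(fun v : 'F_p => v != 0)| by apply: eq_card.
by split; lia.
Qed.
End CubicClasses.

(** All orbits of f on A have exactly three elements. *)
Lemma three_dvd_card (T : finType) (f : T -> T) (A : {set T}) : injective f ->
  (forall x, x \in A -> f x \in A) -> (forall x, x \in A -> f (f (f x)) = x) ->
  (forall x, x \in A -> f x != x) -> (3 %| #|A|)%N.
Proof.
move=> fI fA f3 fx; rewrite -(@fcard_order_set T f fI 3 A).
- exact: dvdn_mull.
- apply/subsetP=> x xA; rewrite inE; apply/eqP.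
  rewrite (@order_cycle _ f [:: x; f x; f (f x)]) ?mem_head //=.
    by rewrite !eqxx f3 ?eqxx.
  have x1 := fx _ xA; have x2 := fx _ (fA _ xA).
  rewrite !inE !negb_or [x == f x]eq_sym x1 [f x == _]eq_sym x2 /= andbT.
  apply: contraNneq x1 => e; rewrite {1}e; apply/eqP; exact: f3.
- move=> x y /eqP <-; apply/idP/idP => [|h]; first exact: fA.
  by rewrite -(fI _ _ (f3 _ h)); exact: fA _ (fA _ h).
Qed.

(** * Quadratic character sums over the cubic classes *)

Section CubicIntegers.
Variables (p n : nat).
Hypotheses (pp : prime p) (n_gt0 : (0 < n)%N) (pE : p = (6 * n + 1)%N).
Variable om : 'F_p.
Hypotheses (om1 : om != 1) (om3 : om ^+ 3 = 1).
Hypothesis om_gen : exists2 g : 'F_p, p.-1.-primitive_root g & om = g ^+ (2 * n).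
Implicit Types (v x y s c : 'F_p).
Notation kap := (kap n).
Notation rho := (rho n).

(** The shift 4 comes from the discriminant v (v + 4) of (1 - x)^2 = v x. *)
Definition csum c : int := \sum_(v : 'F_p | kap v == c) rho (v + 4%:R).

Lemma csum_total : csum 1 + csum om + csum (om ^+ 2) = -1.
Proof.
rewrite /csum -(sum_classes pp n_gt0 pE om1 om3 (fun v => rho (v + 4%:R))).
have := sum_rho_shift pp n_gt0 pE 4%:R;
  rewrite (bigD1 0) //= add0r (rho4 pp n_gt0 pE) => h.
by apply: (addrI 1); rewrite h subrr.
Qed.

Lemma card_cls c : c \in [:: 1; om; om ^+ 2] -> #|cls n c| = (2 * n)%N.
Proof.
have [h1 h2 h3] := card_classes pp n_gt0 pE om1 om3 om_gen.
by rewrite !inE => /or3P [] /eqP ->.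
Qed.

Lemma sum_cls_const c (z : int) : c \in [:: 1; om; om ^+ 2] ->
  \sum_(v | kap v == c) z = z *+ (2 * n).
Proof.
move=> hc; rewrite sumr_const -(card_cls hc); congr (_ *+ _).
by apply: eq_card => v; rewrite !inE.
Qed.

(** Modulo 2 the symbol is 1 except at 0, and a class has the even size 2n, so the sum is odd
    exactly for the class of -4. *)
Lemma csum_parity c : c \in [:: 1; om; om ^+ 2] ->
  exists z : int, csum c = (kap (- 4%:R) == c)%:Z + 2%:Z * z.
Proof.
move=> hc.
have e v : exists z, rho v == (v != 0)%:Z + 2%:Z * z.
  rewrite /rho; case: eqP => _ /=; first by exists 0.
  by case: eqP => _; [exists 0 | exists (-1)].
pose w v := xchoose (e v).
have we v : rho v = (v != 0)%:Z + 2%:Z * w v by apply/eqP; exact: (xchooseP (e v)).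
rewrite /csum (eq_bigr _ (fun v _ => we (v + 4%:R))) big_split /= -mulr_sumr.
have -> : \sum_(v | kap v == c) (v + 4%:R != 0)%:Z =
    (2 * n)%:Z - (kap (- 4%:R) == c)%:Z.
  apply: (@etrans _ _ (\sum_(v | kap v == c) (1 - (v == - 4%:R)%:Z))).
    apply: eq_bigr => v _; rewrite addr_eq0; by case: eqP.
  rewrite sumrB (sum_cls_const _ hc) natz; congr (_ - _).
  rewrite big_mkcond (bigD1 (- 4%:R)) //= eqxx big1 ?addr0; first by case: eqP.
  by move=> v /negbTE ->; case: eqP.
exists (n%:Z - (kap (- 4%:R) == c)%:Z + \sum_(v | kap v == c) w (v + 4%:R)).
by rewrite PoszM; ring.
Qed.

(* 16 t (t-1) = v means (4t-2)^2 = v + 4. *)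
Lemma csum_count c : c \in [:: 1; om; om ^+ 2] ->
  csum c = #|[set t : 'F_p | kap (16%:R * (t * (t - 1))) == c]|%:Z - (2 * n)%:Z.
Proof.
move=> hc; have n4 := Fp4_neq0 pp n_gt0 pE.
have e v : rho (v + 4%:R) = #|[set t : 'F_p | 16%:R * (t * (t - 1)) == v]|%:Z - 1.
  rewrite -(addKr 1 (rho _)) -(card_sqr pp n_gt0 pE) addrC; congr (Posz _ - _).
  have inj : injective (fun t : 'F_p => 4%:R * t - 2%:R).
    by move=> x y /addIr /(mulfI n4).
  rewrite -(card_imset _ inj); apply: eq_card => s; rewrite inE.
  apply/eqP/imsetP.
    move=> hs; exists ((s + 2%:R) / 4%:R); last by field.
    by rewrite inE; apply/eqP; rewrite -[RHS](addrK 4%:R) -hs; field.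
  case=> t; rewrite inE => /eqP <- ->; ring.
rewrite /csum (eq_bigr _ (fun v _ => e v)) sumrB (sum_cls_const _ hc) natz; congr (_ - _).
rewrite -sum1_card -[RHS]natz natr_sum.
rewrite [RHS](partition_big (fun t : 'F_p => 16%:R * (t * (t
  - 1))) (fun v => kap v == c)) /=.
  apply: eq_bigr => v /eqP kv; rewrite -sum1_card -natz natr_sum; apply: eq_bigl => t.
  by rewrite !inE; case: eqP => [->|_]; rewrite ?kv ?eqxx ?andbF.
by move=> t; rewrite inE.
Qed.

Lemma kap16 : kap (16%:R : 'F_p) = kap (2%:R : 'F_p).
Proof.
have n2 := Fp2_neq0 pp n_gt0 pE.
rewrite (_ : 16%:R = 2%:R * 2%:R ^+ 3 :> 'F_p); last by ring.
by rewrite kapM (kap_cube pp pE n2) mulr1.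
Qed.

Lemma kap_m4 : kap (- 4%:R : 'F_p) = kap (2%:R : 'F_p) ^+ 2.
Proof.
rewrite (_ : - 4%:R = (-1) ^+ 3 * 2%:R ^+ 2 :> 'F_p); last by ring.
have m1 : -1 != 0 :> 'F_p by rewrite oppr_eq0 oner_neq0.
by rewrite kapM (kap_cube pp pE m1) mul1r kapX.
Qed.

(* The classes are permuted by t |-> 1 - 1/t, of order three. *)
Lemma csum_mod3 c : c \in [:: 1; om; om ^+ 2] -> c != kap (2%:R : 'F_p) ->
  (3 %| csum c + (2 * n)%:Z)%Z.
Proof.
move=> hc ck; rewrite (csum_count hc) subrK.
have n2 := Fp2_neq0 pp n_gt0 pE.
have c0 : c != 0.
  have o0 := om_neq0 om3.
  by move: hc; rewrite !inE => /or3P [] /eqP ->; rewrite ?oner_neq0 ?expf_neq0.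
have t01 t : t \in [set t : 'F_p | kap (16%:R * (t * (t
  - 1))) == c] -> (t != 0) && (t - 1 != 0).
  rewrite inE => /eqP h; have : kap (16%:R * (t * (t - 1))) != 0 by rewrite h.
  by rewrite (kap_eq0 n_gt0) !mulf_eq0 !negb_or => /and3P [_ -> ->].
have m1 : -1 != 0 :> 'F_p by rewrite oppr_eq0 oner_neq0.
apply: (@three_dvd_card _ (fun t : 'F_p => 1 - t^-1)).
- by move=> x y /addrI /oppr_inj /invr_inj.
- move=> t ht; have /andP [t0 t1] := t01 t ht; move: ht; rewrite !inE => /eqP <-.
  rewrite (_ : 16%:R * ((1 - t^-1) * (1 - t^-1 - 1)) = 16%:R * (t * (t
    - 1)) * (- t^-1) ^+ 3).
    by rewrite [X in X == _]kapM (kap_cube pp pE) ?mulr1 // oppr_eq0 invr_eq0.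
  by field.
- move=> t ht; have /andP [t0 t1] := t01 t ht.
  have e : 1 - t^-1 = (t - 1) / t by field.
  rewrite e (_ : 1 - ((t - 1) / t)^-1 = - (t - 1)^-1); last by field; rewrite t0 t1.
  by rewrite invrN invrK opprK addrC subrK.
(* A fixed point has t (t - 1) = -1, so 16 t (t - 1) = -16 lies in the class of 2, which is
   excluded. *)
move=> t ht; have /andP [t0 t1] := t01 t ht; apply: contraNneq ck => e.
have : t * (t - 1) = -1.
  have : t * (1 - t^-1) = t * t by rewrite e.
  rewrite mulrBr mulfV // mulr1 => e'.
  by rewrite mulrBr mulr1 -e'; ring.
move=> tt; move: ht; rewrite inE tt kapM kap16 => /eqP <-.
by rewrite (_ : -1 = (-1) ^+ 3) ?(kap_cube pp pE m1) ?mulr1 //; ring.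
Qed.

(** In the square over one class the second variable is s v with kap(s) = 1, so that summing over
    the classes frees v. The inner sum over v is p - 2 for s = 1 and -rho(s) - 1 otherwise. The sum
    of rho over the cubes is 0, as g^3 is a cube and a non-square. *)
Lemma csum_sqr : csum 1 ^+ 2 + csum om ^+ 2 + csum (om ^+ 2) ^+ 2 = p%:Z - (2 * n)%:Z.
Proof.
have n4 := Fp4_neq0 pp n_gt0 pE.
have h1 : 1 \in [:: 1; om; om ^+ 2] by rewrite mem_head.
have sq c : c != 0 -> csum c ^+ 2 = \sum_(v | kap v == c) \sum_(s | kap s == 1)
    rho (s * v + 4%:R) * rho (v + 4%:R).
  move=> c0; rewrite expr2 {1}/csum mulr_suml; apply: eq_bigr => v /eqP kv.
  have v0 : v != 0 by rewrite -(kap_eq0 n_gt0) kv.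
  rewrite /csum (reindex_inj (mulIf v0)) mulr_sumr; apply: eq_big => s.
    by rewrite kapM kv -{2}[c]mul1r (inj_eq (mulIf c0)).
  by move=> _; rewrite mulrC.
have o0 := om_neq0 om3.
rewrite !sq ?oner_neq0 ?expf_neq0 //.
rewrite -(sum_classes pp n_gt0 pE om1 om3 (fun v => \sum_(s | kap s == 1)
    rho (s * v + 4%:R) * rho (v + 4%:R))) exchange_big /=.
have e s : \sum_(v : 'F_p | v != 0) rho (s * v + 4%:R) * rho (v + 4%:R) =
    \sum_(v : 'F_p) rho ((s * v + 4%:R) * (v + 4%:R)) - 1.
  rewrite [X in _ = X - 1](bigD1 0) //= mulr0 !add0r -expr2 (rho_sqr pp n_gt0 pE n4).
  rewrite [RHS]addrC addKr; apply: eq_bigr => v _.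
  by rewrite (rhoM pp n_gt0 pE).
rewrite (eq_bigr _ (fun s _ => e s)) (bigD1 1) ?kap1 //=.
rewrite (eq_bigr (fun v => rho ((v + 4%:R) * (v
  + 4%:R)))); last by move=> v _; rewrite mul1r.
rewrite (sum_rho_sqr pp n_gt0 pE).
rewrite (eq_bigr (fun s => - rho s - 1)); last first.
  move=> s /andP [/eqP ks s1]; rewrite (sum_rho_quad pp n_gt0 pE) //.
  by rewrite -(kap_eq0 n_gt0) ks oner_neq0.
have hr : \sum_(s : 'F_p | kap s == 1) (- rho s - 1) = - (2 * n)%:Z.
  rewrite sumrB sumrN (sum_cls_const _ h1) natz.
  have [g hg _] := om_gen.
  have g0 : g != 0 by rewrite (prim_root_eq0 hg) (pm1 pE); lia.
  rewrite (@sum_rho_mul p n pp n_gt0 pE (fun s => kap s == 1) (g ^+ 3)) ?oppr0 ?add0r //.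
  - by rewrite expf_neq0.
  - exact: (prim_root_rho pp n_gt0 pE hg).
  - by move=> v; rewrite kapM (kap_cube pp pE g0) mul1r.
move: hr; rewrite (bigD1 1) ?kap1 //=.
have -> : rho (1 : 'F_p) = 1 := rho1 pp n_gt0 pE.
  by move=> <-; ring.
all: exact/eqP/kap1.
Qed.
End CubicIntegers.

(** * The Jacobi sum as a root of a quadratic *)

Section JacobiQuadratic.
Variables (p n : nat).
Hypotheses (pp : prime p) (n_gt0 : (0 < n)%N) (pE : p = (6 * n + 1)%N).
Implicit Types (v x y s c : 'F_p).
Notation rho := (rho n).
Notation kap := (kap n).

(* The quadratic (1-x)^2 = v x has discriminant v (v+4). *)
Lemma card_fiber v :
  #|[pred x : 'F_p | (x != 0) && ((1 - x) ^+ 2 / x == v)]|%:Z = 1 + rho v * rho (v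
    + 4%:R).
Proof.
have n2 := Fp2_neq0 pp n_gt0 pE; have n4 := Fp4_neq0 pp n_gt0 pE.
rewrite -(rhoM pp n_gt0 pE) -(card_sqr pp n_gt0 pE); congr Posz.
have inj : injective (fun x : 'F_p => 2%:R * x - (2%:R + v)).
  by move=> x y /addIr /(mulfI n2).
rewrite -(card_imset _ inj); apply: eq_card => s; rewrite inE.
have key x : ((2%:R * x - (2%:R + v)) ^+ 2 == v * (v + 4%:R)) =
    (x != 0) && ((1 - x) ^+ 2 / x == v).
  have -> : (2%:R * x - (2%:R + v)) ^+ 2 =
      v * (v + 4%:R) + 4%:R * ((1 - x) ^+ 2 - v * x) by ring.
  rewrite -subr_eq0 addrC addKr mulf_eq0 (negbTE n4) /=.
  have [->|x0] /= := eqVneq x 0.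
    by rewrite subr0 expr1n mulr0 subr0 (oner_eq0 _).
  by rewrite subr_eq0 -[RHS](inj_eq (mulIf x0)) divfK.
apply/imsetP/idP; first by case=> x; rewrite inE -key => h ->.
move=> hs; exists ((s + (2%:R + v)) / 2%:R); last by field.
rewrite inE -key; apply: etrans hs; congr (_ ^+ 2 == _); by field.
Qed.

(** As x^(6n) = 1, the power x^(5n) is the inverse of x^n. *)
Lemma jacobi_term x : x != 0 ->
  cg p 3 (tau x ^+ (5 * n) * tau (1 - x) ^+ (2 * n)) (tau ((1 - x) ^+ 2 / x) ^+ n).
Proof.
move=> x0; have h k (z : 'F_p) : cg p 3 (tau z ^+ k) (tau (z ^+ k)).
  exact: cg_sym (tauX pp _ _).
have tZ (z : 'F_p) : tau z \in pintegral p := tau_int z.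
apply: (@cg_trans _ _ (tau (x ^+ (5 * n)) * tau ((1 - x) ^+ (2 * n)))).
  apply: cgM => //; by zint.
apply: cg_trans (cg_sym (tauM pp _ _)) _.
apply: cg_sym; apply: cg_trans (h _ _) _.
have -> : ((1 - x) ^+ 2 / x) ^+ n = x ^+ (5 * n) * (1 - x) ^+ (2 * n).
  have e : x ^+ (5 * n) * x ^+ n = 1.
    by rewrite -exprD -mulSnr (Fp_exp6n pp pE).
  have xn0 : x ^+ n != 0 by rewrite expf_neq0.
  apply: (mulIf xn0); rewrite [RHS]mulrAC e mul1r -exprMn divfK //.
  by rewrite -exprM.
exact: cg_refl.
Qed.

(** The fibre of (1-x)^2/x over v has 1 + rho(v) rho(v+4) points. The 1 contributes the sum of
    tau(v)^n, which is 0; in the rest rho(v) = tau(v)^(3n) turns the sextic character into the cubic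
    one, tau(v)^(4n). *)
Lemma jacobi_rho : cg p 3 (jacobi p n) (\sum_(v : 'F_p) tau v ^+ (4 * n) * (rho (v
  + 4%:R))%:~R).
Proof.
have tZ v : tau v \in pintegral p := tau_int v.
have rZ v : (rho v)%:~R \in pintegral p by zint.
apply: (@cg_trans _ _ (\sum_(x : 'F_p | x != 0) tau ((1 - x) ^+ 2 / x) ^+ n)).
  rewrite /jacobi (bigD1 0) //= tau0 // expr0n (_ : (5
    * n == 0)%N = false); last by apply/eqP; lia.
  by rewrite mul0r add0r; apply: cg_sum => x _; exact: jacobi_term.
rewrite (partition_big (fun x : 'F_p => (1 - x) ^+ 2 / x) predT) //=.
apply: (@cg_trans _ _ (\sum_(v : 'F_p) (tau v ^+ n + tau v ^+ (4 * n) * (rho (v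
  + 4%:R))%:~R))).
  apply: cg_sum => v _ _.
  rewrite (eq_bigr (fun=> tau v ^+ n)); last by move=> x /andP [_ /eqP ->].
  rewrite sumr_const.
  rewrite (_ : #|_| = #|[pred x : 'F_p | (x != 0) && ((1
    - x) ^+ 2 / x == v)]|); last first.
    exact: eq_card.
  have e := congr1 (fun z : int => z%:~R : rat) (card_fiber v).
  rewrite /= -pmulrn in e; rewrite -[X in cg _ _ X _]mulr_natl e.
  rewrite rmorphD rmorphM /= mulrDl mul1r; apply: cgD; first exact: cg_refl.
  rewrite mulrAC; apply: cgMr => //.
  have -> : tau v ^+ (4 * n) = tau v ^+ (3 * n)
    * tau v ^+ n by rewrite -exprD; congr (_ ^+ _); lia.
  by apply: cgMr; [zint; exact: tZ | exact: rho_cg].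
rewrite big_split /= -[X in cg _ _ _ X]add0r; apply: cgD; last exact: cg_refl.
have := sum_tau pp n_gt0; rewrite (_ : (p.-1 %| n)%N = false) //.
by apply/negP=> /dvdn_leq; rewrite (pm1 pE); lia.
Qed.

Section WithRoot.
Variable om : 'F_p.
Hypotheses (om1 : om != 1) (om3 : om ^+ 3 = 1).
Hypothesis om_gen : exists2 g : 'F_p, p.-1.-primitive_root g & om = g ^+ (2 * n).

(** Since v^(4n) = kap(v)^2, the class of om gets the weight tau(om^2), and that of om^2 its
    square. *)
Let Om : rat := tau (om ^+ 2).

Lemma jacobi_csum :
  cg p 3 (jacobi p n) ((csum n (1 : 'F_p))%:~R + Om * (csum n om)%:~R
    + Om ^+ 2 * (csum n (om ^+ 2))%:~R).
Proof.
have tZ v : tau v \in pintegral p := tau_int v.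
apply: cg_trans jacobi_rho _.
rewrite (bigD1 0) //= tau0 // expr0n (_ : (4 * n == 0)%N = false); last by apply/eqP; lia.
rewrite mul0r add0r (sum_classes pp n_gt0 pE om1 om3).
have cls c : cg p 3 (\sum_(v | kap v == c) tau v ^+ (4 * n) * (rho (v + 4%:R))%:~R)
    (tau (c ^+ 2) * (csum n c)%:~R).
  rewrite /csum rmorph_sum mulr_sumr; apply: cg_sum => v _ /eqP <-.
  apply: cgMr; first by zint.
  apply: cg_trans (cg_sym (tauX pp _ _)) _.
  rewrite kap_exp (_ : (2 * n * 2 = 4 * n)%N); [exact: cg_refl | lia].
apply: cgD; first apply: cgD.
- by have := cls 1; rewrite expr1n tau1 // mul1r.
- exact: cls.
apply: cg_trans (cls _) _; apply: cgMr; first by zint.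
exact: tauX.
Qed.

Lemma Om_sum : cg p 3 (1 + Om + Om ^+ 2) 0.
Proof.
have OZ : Om \in pintegral p := tau_int _.
have u : Om - 1 \in punit p.
  have h0 : om ^+ 2 - 1 != 0 by rewrite subr_eq0 (om2_neq1 om1 om3).
  apply: (punit_cg pp (e := 1) (b := rep (om ^+ 2 - 1))) => //; last exact: rep_unit.
  have := repD pp (om ^+ 2 - 1) 1; rewrite subrK rep1 // => h.
  have h2 := cg_trans (tau_rep pp (om ^+ 2)) h.
  have := cgB h2 (cg_refl p 1 1); rewrite addrK; exact.
apply: (cg_cancel u); rewrite mulr0.
have -> : (Om - 1) * (1 + Om + Om ^+ 2) = Om ^+ 3 - 1 by ring.
apply: (cgP _ _ _ _).1; rewrite /Om; apply: cg_trans (cg_sym (tauX pp _ _)) _.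
by rewrite -exprM mulnC exprM om3 expr1n tau1 //; exact: cg_refl.
Qed.

(** Using 1 + Om + Om^2 = 0, J = r + q Om with r = A - C and q = B - C. Its trace is 2r - q = 3A + 1
    because A + B + C = -1. Its norm r^2 - r q + q^2 is half of 3(A^2 + B^2 + C^2) - (A + B + C)^2,
    which is 2p. *)
Lemma jacobi_quadratic : cg p 3 (jacobi p n ^+ 2 - (3%:Z * csum n (1 : 'F_p)
  + 1)%:~R * jacobi p n + p%:R) 0.
Proof.
have h1 := csum_total pp n_gt0 pE om1 om3.
have h2 := csum_sqr pp n_gt0 pE om1 om3 om_gen.
have hJ := jacobi_csum; have [d dZ hd] := Om_sum.
have OZ : Om \in pintegral p := tau_int _.
set A := csum n (1 : 'F_p) in h1 h2 hJ *.
set B := csum n om in h1 h2 hJ; set C := csum n (om ^+ 2) in h1 h2 hJ.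
have AE : A = - 1 - B - C by rewrite -h1; ring.
have pE' : p%:Z = (A - C) ^+ 2 - (A - C) * (B - C) + (B - C) ^+ 2.
  have p6 : p%:Z = 6%:Z * n%:Z + 1 by rewrite pE PoszD PoszM.
  have e2 : A ^+ 2 + B ^+ 2 + C ^+ 2 = 4%:Z * n%:Z + 1 by rewrite h2 p6 PoszM; ring.
  have e1 : (A + B + C) ^+ 2 = 1 by rewrite h1.
  have e3 : 2%:Z * ((A - C) ^+ 2 - (A - C) * (B - C) + (B - C) ^+ 2) =
    3%:Z * (A ^+ 2 + B ^+ 2 + C ^+ 2) - (A + B + C) ^+ 2 by ring.
  rewrite e2 e1 in e3; move: (_ - _ + _) e3 => N e3; lia.
have JZ : jacobi p n \in pintegral p.
  by apply: cg_int hJ _; zint.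
have [c cZ ->] : cg p 3 (jacobi p n) ((A - C)%:~R + (B - C)%:~R * Om).
  apply: cg_trans hJ _.
  have -> : A%:~R + Om * B%:~R + Om ^+ 2 * C%:~R =
    (A - C)%:~R + (B - C)%:~R * Om + C%:~R * (1 + Om + Om ^+ 2).
    by rewrite !rmorphB /=; ring.
  by rewrite hd; exists (C%:~R * d); [zint | ring].
have pN : (p%:R : rat) = ((A - C)%:~R) ^+ 2 - (A - C)%:~R * (B - C)%:~R
  + ((B - C)%:~R) ^+ 2.
  rewrite [LHS]pmulrn pE'; move: (A - C) (B - C) => a b.
  by rewrite !expr2 rmorphD rmorphB !rmorphM /=.
rewrite [X in _ + X]pN.
have -> : 3%:Z * A + 1 = 2%:Z * (A - C) - (B - C) by rewrite AE; ring.
set r := (A - C)%:~R; set q := (B - C)%:~R.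
have -> : (2%:Z * (A - C) - (B - C))%:~R = 2%:R * r - q :> rat by rewrite rmorphB rmorphM.
have rZ : r \in pintegral p by rewrite /r; zint.
have qZ : q \in pintegral p by rewrite /q; zint.
exists (q ^+ 2 * d + c * (2%:R * (r + q * Om) - (2%:R * r - q))
  + p%:R ^+ 3 * c ^+ 2); first by zint.
transitivity (q ^+ 2 * (1 + Om + Om ^+ 2) +
  p%:R ^+ 3 * (c * (2%:R * (r + q * Om) - (2%:R * r - q))
    + p%:R ^+ 3 * c ^+ 2)); first by ring.
by rewrite hd; ring.
Qed.
End WithRoot.
End JacobiQuadratic.

(** * The norm equation in the Eisenstein integers *)

Lemma prime_dvdzM (p : nat) (a b : int) : prime p ->
  (p %| a * b)%Z -> (p %| a)%Z \/ (p %| b)%Z.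
Proof. by move=> pp; rewrite !dvdzE abszM Euclid_dvdM // => /orP. Qed.

(* Comparing the two factorizations of 4p^2 in the Eisenstein integers: w and m
   come from x + y sqrt(-3) through one of the six units (r + k sqrt(-3))/2. *)
Lemma eisenstein_unit (p : nat) (x y w m : int) : prime p ->
  p%:Z = x ^+ 2 + 3%:Z * y ^+ 2 -> 4%:Z * p%:Z = w ^+ 2 + 3%:Z * m ^+ 2 ->
  exists r k e : int, [/\ r ^+ 2 + 3%:Z * k ^+ 2 = 4%:Z, e ^+ 2 = 1,
    w = r * x + 3%:Z * k * y & e * m = r * y - k * x].
Proof.
move=> pp px pw.
have p0 : p%:Z != 0 by have := prime_gt0 pp; lia.
have [e e1 /dvdzP [k hk]] : exists2 e : int, e ^+ 2 = 1 & (p %| w * y - e * m * x)%Z.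
  have : (p %| (w * y - m * x) * (w * y + m * x))%Z.
    apply/dvdzP; exists (4%:Z * y ^+ 2 - m ^+ 2).
    transitivity ((w ^+ 2 + 3%:Z * m ^+ 2) * y ^+ 2 - m ^+ 2 * (x ^+ 2 + 3%:Z * y ^+ 2));
      first by ring.
    by rewrite -pw -px; ring.
  case/(prime_dvdzM pp) => h; [exists 1 | exists (-1)] => //; first by rewrite mul1r.
  by rewrite mulN1r mulNr opprK.
have e4 : (w * x + 3%:Z * e * m * y) ^+ 2 + 3%:Z * (k * p%:Z) ^+ 2 = 4%:Z * p%:Z * p%:Z.
  rewrite pw [in RHS]px -hk.
  transitivity (w ^+ 2 * x ^+ 2 + 9%:Z * e ^+ 2 * m ^+ 2 * y ^+ 2
    + 3%:Z * w ^+ 2 * y ^+ 2 + 3%:Z * e ^+ 2 * m ^+ 2 * x ^+ 2); first by ring.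
  by rewrite e1; ring.
have /dvdzP [r hr] : (p %| w * x + 3%:Z * e * m * y)%Z.
  have : (p %| (w * x + 3%:Z * e * m * y) * (w * x + 3%:Z * e * m * y))%Z.
    apply/dvdzP; exists (4%:Z * p%:Z - 3%:Z * k ^+ 2 * p%:Z).
    by apply: (addIr (3%:Z * (k * p%:Z) ^+ 2)); rewrite -expr2 e4; ring.
  by case/(prime_dvdzM pp).
exists r, k, e; split => //.
- have p20 : p%:Z ^+ 2 != 0 by rewrite expf_neq0.
  by apply: (mulIf p20); move: e4; rewrite hr => h;
    rewrite mulrDl -exprMn -[RHS]mulrA -expr2 in h *; rewrite -h; ring.
- apply: (mulIf p0).
  transitivity ((w * x + 3%:Z * e * m * y) * x + 3%:Z * (w * y - e * m * x) * y).
    by rewrite px; ring.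
  by rewrite hr hk; ring.
apply: (mulIf p0).
transitivity ((w * x + 3%:Z * e * m * y) * y - (w * y - e * m * x) * x
  + e * m * (p%:Z - x ^+ 2 - 3%:Z * y ^+ 2)).
  by ring.
by rewrite hr hk [in p%:Z - _]px; ring.
Qed.

Lemma eisenstein_units_enum (r k : int) : r ^+ 2 + 3%:Z * k ^+ 2 = 4%:Z ->
  [\/ k = 0 /\ (r = 2%:Z \/ r = -2%:Z), k = 1 /\ (r = 1 \/ r = -1) | k = -1 /\ (r
    = 1 \/ r = -1)].
Proof.
move=> h; have k2 : (-1 <= k <= 1) by nia.
have r2 : (-2%:Z <= r <= 2%:Z) by nia.
have [kk|[kk|kk]] : k = -1 \/ k = 0 \/ k = 1 by lia.
- by rewrite kk in h; constructor 3; split=> //; nia.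
- by rewrite kk in h; constructor 1; split=> //; nia.
- by rewrite kk in h; constructor 2; split=> //; nia.
Qed.

(** The candidates for w = 3A + 1 come from the six units. Its residue modulo 3 leaves -2x and x +
    3y, x - 3y; the first is even and the others are odd, since x + y is odd. The conditions on A, B
    and C decide among them and match the case distinction on y. *)
Lemma trace_normalized (p : nat) (x y A B C : int) : prime p -> (3 < p)%N ->
  p%:Z = x ^+ 2 + 3%:Z * y ^+ 2 ->
  (x = 1 %[mod 3])%Z -> (y = 0 %[mod 3])%Z \/ (y = 1 %[mod 3])%Z ->
  4%:Z * p%:Z = (3%:Z * A + 1) ^+ 2 + 3%:Z * (B - C) ^+ 2 ->
  A + B + C = -1 ->
  [\/ [/\ (2 %| B)%Z, (2 %| C)%Z & (3 %| B - C)%Z],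
      [/\ (2 %| A)%Z, (2 %| B)%Z & (3 %| A - C)%Z] |
      [/\ (2 %| A)%Z, (2 %| C)%Z & (3 %| A - B)%Z]] ->
  3%:Z * A + 1 = if (3 %| y)%Z then - (2%:Z * x) else x - 3%:Z * y.
Proof.
move=> pp p3 px x1 y01 pw sABC cls.
(* x + y is odd, as otherwise x^2 + 3y^2 would be even. *)
have [z xyz] : exists z, x + y = 2%:Z * z + 1.
  have [/dvdzP [q hq]|h] := boolP (2 %| x + y)%Z; last first.
    by exists ((x + y) %/ 2)%Z; lia.
  have xE : x = q * 2 - y by rewrite -hq addrK.
  have : (2 %| p%:Z)%Z.
    by apply/dvdzP; exists (2%:Z * q ^+ 2 - 2%:Z * q * y
      + 2%:Z * y ^+ 2); rewrite px xE; ring.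
  rewrite dvdzE /= (dvdn_prime2 _ pp) // => /eqP p2; by move: p3; rewrite -p2.
have [r [k [e [hrk e1 hw hm]]]] := eisenstein_unit pp px pw.
have ee : e = 1 \/ e = -1.
  by move/eqP: e1; rewrite sqrf_eq1 => /orP [] /eqP; [left | right].
have {hrk} rk := eisenstein_units_enum hrk.
(* Modulo 3, w = r x + 3 k y is r, so r must be 1 modulo 3. *)
have r1 : [\/ r = -2%:Z /\ k = 0, r = 1 /\ k = 1 | r = 1 /\ k = -1].
  case: rk => [[kE [rE|rE]]|[kE [rE|rE]]|[kE [rE|rE]]]; move: hw; rewrite kE rE => hw.
  - by exfalso; lia.
  - by constructor 1.
  - by constructor 2.
  - by exfalso; lia.
  - by constructor 3.
  - by exfalso; lia.
clear rk pw px e1.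
have y3 : (3 %| y)%Z <-> (y = 0 %[mod 3])%Z by split; lia.
case: r1 => [[rE kE]|[rE kE]|[rE kE]]; case: ee => eE; move: hw hm;
  rewrite rE kE eE => hw hm;
  clear rE kE eE; case: cls => [[c1 c2 c3]|[c1 c2 c3]|[c1 c2 c3]]; case: y01 => hy;
  case: ifP => h3; lia.
Qed.

(** Two iterations of J = u - p/J, starting from u, give an approximate root l modulo p^3. The
    difference of the two quadratic relations is (J - l)(J + l - u), whose second factor is J modulo
    p, a unit. *)
Lemma unit_root_cg p (J u : rat) : prime p -> J \in punit p -> u \in pintegral p ->
  cg p 3 (J ^+ 2 - u * J + p%:R) 0 ->
  u \in punit p /\ cg p 3 J (u - p%:R / u - p%:R ^+ 2 / u ^+ 3).
Proof.
move=> pp Ju uZ hJ; have JZ := punit_int Ju.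
have [c cZ hc] := hJ; rewrite add0r in hc.
have uJ : cg p 1 u J.
  apply: (cg_cancel Ju); exists (1 - p%:R ^+ 2 * c); first by zint.
  have -> : J * J = (J ^+ 2 - u * J + p%:R) + u * J - p%:R by ring.
  by rewrite hc; ring.
have uu : u \in punit p by apply: punit_cg uJ Ju.
split=> //; have u0 := punit_neq0 uu; have iZ := punitV_int uu.
set i := u^-1 in iZ.
have ui : u * i = 1 by rewrite mulfV.
have -> : p%:R / u = p%:R * i by [].
have -> : p%:R ^+ 2 / u ^+ 3 = p%:R ^+ 2 * i ^+ 3 by rewrite /i exprVn.
set l := u - _ - _.
have Du : J + l - u \in punit p.
  apply: (punit_cg pp (e := 1) (b := J)) => //.
  by exists (- i - p%:R * i ^+ 3); [zint | rewrite /l; ring].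
apply: (cg_cancel Du).
exists (c - (2%:R * i ^+ 4 + p%:R * i ^+ 6)); first by zint.
apply: (@etrans _ _ ((J ^+ 2 - u * J + p%:R) - (l ^+ 2 - u * l + p%:R) + (J
  + l - u) * l)).
  by ring.
have -> : l ^+ 2 - u * l + p%:R = p%:R ^+ 3 * (2%:R * i ^+ 4 + p%:R * i ^+ 6).
  rewrite /l; apply: (@etrans _ _ (p%:R * (1 - u * i) - p%:R ^+ 2 * i ^+ 2 * (u * i - 1)
    + p%:R ^+ 3 * (2%:R * i ^+ 4 + p%:R * i ^+ 6))); first by ring.
  by rewrite ui; ring.
by rewrite hc; ring.
Qed.

Lemma dvdz_sub_shift (d m a b : int) :
  (d %| a + m)%Z -> (d %| b + m)%Z -> (d %| a - b)%Z.
Proof.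
by move=> ha hb; rewrite (_ : a - b = (a + m) - (b + m)) ?rpredB //; ring.
Qed.

Lemma dvdz_even (a : int) : (exists z, a = false%:Z + 2%:Z * z) -> (2 %| a)%Z.
Proof. by case=> z ->; rewrite add0r dvdz_mulr. Qed.

Lemma case_one (p : nat) (x y : int) : prime p -> (3 < p)%N -> (p = 1 %[mod 3])%N ->
  p%:Z = x ^+ 2 + 3%:Z * y ^+ 2 -> (x = 1 %[mod 3])%Z ->
  (y = 0 %[mod 3])%Z \/ (y = 1 %[mod 3])%Z ->
  let u : rat :=
    if (3 %| y)%Z then (- (2%:Z * x))%:~R else (x - 3%:Z * y)%:~R in
  pcongr p (p ^ 4) (\sum_(k < p) (12 * k + 1)%:R * gbinom (- (1 / 6%:R)) k ^+ 4)
    (- (p%:R * u) + p%:R ^+ 2 / u + p%:R ^+ 3 / u ^+ 3).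
Proof.
move=> pp p3 p1 px x1 y01 u.
have podd : odd p by case: (even_prime pp) p3 => // ->.
have [nu pE] : exists nu, p = (6 * nu.+1 + 1)%N by exists (p %/ 6).-1; lia.
pose n := nu.+1; have n0 : (0 < n)%N by [].
have [g hg] := Fp_prim_root pp.
pose om : 'F_p := g ^+ (2 * n).
have om1 : om != 1.
  by rewrite /om -(prim_order_dvd hg) (pm1 pE); apply/negP=> /dvdn_leq; lia.
have om3 : om ^+ 3 = 1.
  by rewrite /om -exprM; apply/eqP; rewrite -(prim_order_dvd hg) (pm1 pE) mulnAC.
have om_gen : exists2 g : 'F_p, p.-1.-primitive_root g & om = g ^+ (2 * n) by exists g.
pose A := csum n (1 : 'F_p); pose B := csum n om; pose C := csum n (om ^+ 2).
have sABC : A + B + C = -1 := csum_total pp n0 pE om1 om3.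
have sq : A ^+ 2 + B ^+ 2
  + C ^+ 2 = p%:Z - (2 * n)%:Z := csum_sqr pp n0 pE om1 om3 om_gen.
have pw : 4%:Z * p%:Z = (3%:Z * A + 1) ^+ 2 + 3%:Z * (B - C) ^+ 2.
  have p6 : p%:Z = 6%:Z * n%:Z + 1 by rewrite {1}pE PoszD PoszM.
  have AE : A = - 1 - B - C by rewrite -sABC; ring.
  apply: (@etrans _ _ (6%:Z * (A ^+ 2 + B ^+ 2 + C ^+ 2) - 2%:Z)).
    by rewrite sq PoszM p6; ring.
  rewrite AE; ring.
have c1 : 1 \in [:: 1; om; om ^+ 2] by rewrite !inE eqxx.
have c2 : om \in [:: 1; om; om ^+ 2] by rewrite !inE eqxx orbT.
have c3 : om ^+ 2 \in [:: 1; om; om ^+ 2] by rewrite !inE eqxx !orbT.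
have par1 := csum_parity pp n0 pE om1 om3 om_gen c1.
have par2 := csum_parity pp n0 pE om1 om3 om_gen c2.
have par3 := csum_parity pp n0 pE om1 om3 om_gen c3.
have m1 := csum_mod3 pp n0 pE om1 om3 om_gen c1.
have m2 := csum_mod3 pp n0 pE om1 om3 om_gen c2.
have m3 := csum_mod3 pp n0 pE om1 om3 om_gen c3.
have [o1 o2] : om ^+ 2 != 1 /\ om ^+ 2 != om.
  by split; [exact: (om2_neq1 om1 om3) | exact: (om2_neq om1 om3)].
rewrite (kap_m4 pp pE) -/A -/B -/C in par1 par2 par3 m1 m2 m3.
have cls : [\/ [/\ (2 %| B)%Z, (2 %| C)%Z & (3 %| B - C)%Z],
      [/\ (2 %| A)%Z, (2 %| B)%Z & (3 %| A - C)%Z] |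
      [/\ (2 %| A)%Z, (2 %| C)%Z & (3 %| A - B)%Z]].
  have n2 := Fp2_neq0 pp n0 pE.
  (* The class of 2 governs both conditions: the odd sum belongs to kap(2)^2, the class of -4, and
     the condition modulo 3 is available for every class but kap(2). *)
  case/or3P: (kap_cases pp pE om1 om3 n2) => /eqP k2;
    rewrite k2 in par1 par2 par3 m1 m2 m3.
  - rewrite expr1n eq_sym (negbTE om1) in par2.
    rewrite expr1n eq_sym (negbTE o1) in par3.
    by constructor 1; split; [exact: dvdz_even | exact: dvdz_even |
      exact: dvdz_sub_shift (m2 om1) (m3 o1)].
  - rewrite (negbTE o1) in par1; rewrite (negbTE o2) in par2.
    have h4 : (3 %| A + (2 * n)%:Z)%Z by apply: m1; rewrite eq_sym.
    by constructor 2; split; [exact: dvdz_even | exact: dvdz_even |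
      exact: dvdz_sub_shift h4 (m3 o2)].
  have e4 : (om ^+ 2) ^+ 2 = om by rewrite -exprM (exprD om 3 1) om3 mul1r.
  rewrite e4 (negbTE om1) in par1; rewrite e4 eq_sym (negbTE o2) in par3.
  have h4 : (3 %| A + (2 * n)%:Z)%Z by apply: m1; rewrite eq_sym.
  have h5 : (3 %| B + (2 * n)%:Z)%Z by apply: m2; rewrite eq_sym.
  by constructor 3; split; [exact: dvdz_even | exact: dvdz_even |
    exact: dvdz_sub_shift h4 h5].
have wE := trace_normalized pp p3 px x1 y01 pw sABC cls.
have uE : u = (3%:Z * A + 1)%:~R by rewrite /u wE; case: ifP.
have Wu := Wbin_unit pp p3 pE.
have hJ : cg p 3 (jacobi p n) (- ((-1) ^+ n * Wbin nu)) := jacobi_Wbin pp n0 pE.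
have Ju : jacobi p n \in punit p.
  apply: (punit_cg pp _ hJ) => //; apply: punitN; apply: punitM => //.
  by apply: punitX; apply: punitN; exact: punit1.
have hq : cg p 3 (jacobi p n ^+ 2 - u * jacobi p n + p%:R) 0.
  by rewrite uE; exact: (jacobi_quadratic pp n0 pE om1 om3 om_gen).
have uZ : u \in pintegral p by rewrite uE; zint.
have [uu hJu] := unit_root_cg pp Ju uZ hq.
have u3 := punitX 3 uu.
apply: cg_pcongr; last by zint.
have := sum_Wbin pp p3 pE; rewrite div1r => h; apply: cg_trans h _.
have -> : - (p%:R * u) + p%:R ^+ 2 / u + p%:R ^+ 3 / u ^+ 3 =
  p%:R * (- (u - p%:R / u - p%:R ^+ 2 / u ^+ 3)).
  by field; exact: punit_neq0 uu.
apply: cg_pMl; rewrite -[X in cg _ _ X]opprK; apply: cgN.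
exact: cg_trans (cg_sym hJ) hJu.
Qed.

(** * The sum for p = 6k + 5 *)

Lemma bin_double_rising m : 'C(2 * m, m)%:R = 4%:R ^+ m
  * rising (2%:R^-1) m / m`!%:R :> rat.
Proof.
elim: m => [|m IH]; first by rewrite muln0 bin0 rising0 fact0 expr0; field.
have f0 : (m`!%:R : rat) != 0 by rewrite pnatr_eq0 -lt0n fact_gt0.
have m0 : (m%:R + 1 : rat) != 0 by rewrite natr1 pnatr_eq0.
have e : (m.+1 * m.+1 * 'C(2 * m.+1, m.+1) = 2 * m.+1 * (2 * m).+1 * 'C(2 * m, m))%N.
  have -> : (2 * m.+1 = (2 * m).+2)%N by lia.
  have h1 := mul_bin_diag (2 * m).+2 m.
  have h2 := mul_bin_down (2 * m).+1 m.
  have e3 : ((2 * m).+1 - m = m.+1)%N by lia.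
  rewrite e3 /= in h2; rewrite /= in h1.
  by rewrite -mulnA -h1 mulnCA -h2 mulnA.
have : (m.+1%:R * m.+1%:R * 'C(2 * m.+1, m.+1)%:R : rat) =
    2%:R * m.+1%:R * (2 * m).+1%:R * 'C(2 * m, m)%:R by rewrite -!natrM e.
rewrite IH risingS exprS factS natrM -!natr1 natrM => {}e.
apply: (mulfI (mulf_neq0 m0 m0)); rewrite e.
by field; rewrite f0 m0.
Qed.

Section CaseTwo.
Variables (p k : nat).
Hypotheses (pp : prime p) (pE : p = (6 * k + 5)%N).
Let n := (5 * k + 4)%N.
Let q := (3 * k + 2)%N.

Lemma p_gt3_two : (3 < p)%N. Proof. by lia. Qed.

Lemma natpE : p%:R = 6%:R * k%:R + 5%:R :> rat.
Proof. by rewrite [in LHS]pE natrD natrM. Qed.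

Lemma natqE : q%:R = 3%:R * k%:R + 2%:R :> rat.
Proof. by rewrite natrD natrM. Qed.

Lemma sixth_int_two : 6%:R^-1 \in pintegral p.
Proof. exact: a_int pp p_gt3_two. Qed.

Lemma i2_int : 2%:R^-1 \in pintegral p.
Proof.
by rewrite (_ : 2%:R^-1 = 3%:R * 6%:R^-1) //; have h := sixth_int_two; zint.
Qed.

(** H_(p-1) is 0 modulo p, and its last m terms are congruent to those of -H_m. *)
Lemma harm_reflect m : (m < p)%N -> cg p 1 (harm (p.-1 - m)) (harm m).
Proof.
move=> mp; have p1 := prime_gt1 pp.
have mp' : (m <= p.-1)%N by lia.
have hw := cg_weak (isT : (1 <= 2)%N) (harm_wolstenholme pp p_gt3_two).
have hs : cg p 1 (\sum_(i < m) ((p.-1 - i)%:R : rat)^-1) (- harm m).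
  rewrite /harm -sumrN; apply: cg_sum => i _ _; have im := ltn_ord i.
  have u : (i.+1%:R : rat) \in punit p by apply: punit_lt => //; lia.
  have u' : ((p.-1 - i)%:R : rat) \in punit p by apply: punit_lt => //; lia.
  apply: (cg_cancel (punitM u u')).
  have n1 := punit_neq0 u; have n2 := punit_neq0 u'.
  have e : (p%:R : rat) = i.+1%:R + (p.-1 - i)%:R by rewrite -natrD; congr _%:R; lia.
  exists 1; first by zint.
  move: (i.+1%:R) ((p.-1 - i)%:R) e n1 n2 => x y -> n1 n2.
  by field; rewrite n1 n2.
rewrite harm_falling // in hs.
have := cgB hw hs; rewrite sub0r opprK; apply: cg_trans.
by exists 0; [zint | ring].
Qed.

(** The even denominators in H_(2k+1) give H_k/2. With q = (p-1)/2, an odd one is 2i + 1 = p - 2(q -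
    i), so these give -(H_q - H_(2k+1))/2 modulo p. *)
Lemma harm_half : cg p 1 (harm (2 * k + 1) - harm k) (- harm q).
Proof.
have i2Z := i2_int.
have odd_even m : harm (2 * m + 1) = 2%:R^-1 * harm m + \sum_(i < m.+1) ((2 * i
  + 1)%:R : rat)^-1.
  elim: m => [|m IH].
    by rewrite muln0 add0n /harm big_ord0 !big_ord1; ring.
  have harmS j : harm j.+1 = harm j + (j.+1%:R)^-1 by rewrite /harm big_ord_recr.
  have e3 : (2 * m.+1 + 1 = (2 * m + 1).+2)%N by lia.
  have e2 : ((2 * m + 1).+1%:R : rat) = 2%:R * m.+1%:R by rewrite -natrM; congr _%:R; lia.
  rewrite e3 !harmS IH [\sum_(i < m.+2) _]big_ord_recr /= e3 e2 invfM; ring.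
have hs : cg p 1 (\sum_(i < k.+1) ((2 * i + 1)%:R : rat)^-1)
    (- (2%:R^-1 * \sum_(i < k.+1) ((q - i)%:R : rat)^-1)).
  rewrite mulr_sumr -sumrN; apply: cg_sum => i _ _; have ik := ltn_ord i.
  have u : ((2 * i + 1)%:R : rat) \in punit p by apply: punit_lt => //; rewrite pE; lia.
  have u' : ((q - i)%:R : rat) \in punit p.
    by apply: punit_lt => //; rewrite /q pE; lia.
  apply: (cg_cancel (punitM u u')).
  have n1 := punit_neq0 u; have n2 := punit_neq0 u'.
  have e : (p%:R : rat) = (2 * i + 1)%:R + 2%:R * (q - i)%:R.
    by rewrite -natrM -natrD; congr _%:R; rewrite /q pE; lia.
  exists (2%:R^-1); first by zint.
  move: ((2 * i + 1)%:R) ((q - i)%:R) e n1 n2 => x y -> n1 n2.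
  by field; rewrite n1 n2.
have kq : (k.+1 <= q)%N by rewrite /q; lia.
rewrite (harm_falling kq) in hs.
have e1 : (q - k.+1 = 2 * k + 1)%N by rewrite /q; lia.
rewrite e1 in hs.
have [c cZ hc] := hs.
have ho := odd_even k; rewrite hc in ho.
exists (2%:R * c); first by zint.
move: (harm (2 * k + 1)) (harm k) (harm q) ho => H h h3 ho.
have ho2 : 2%:R * H = h - h3 + H + 2%:R * p%:R ^+ 1 * c by rewrite {1}ho; field.
by apply: (@etrans _ _ (2%:R * H - H - h)); [ring | rewrite ho2; ring].
Qed.

Lemma bin_unit m j : (m < p)%N -> (j <= m)%N -> 'C(m, j)%:R \in punit p.
Proof.
move=> mp jm; have fu : (m`!%:R : rat) \in punit p by apply: punit_fact.
have f1 : (j`!%:R : rat) \in punit p by apply: punit_fact => //; lia.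
have f2 : ((m - j)`!%:R : rat) \in punit p by apply: punit_fact => //; lia.
have e : ('C(m, j)%:R : rat) = m`!%:R / (j`!%:R * (m - j)`!%:R).
  by rewrite -(bin_fact jm) !natrM mulfK // mulf_neq0 ?(punit_neq0 f1) ?(punit_neq0 f2).
by rewrite e; apply: punitM => //; apply: punitVr; exact: punitM.
Qed.

Lemma rising_half m : (m <= q)%N -> cg p 2 (rising (2%:R^-1) m)
  ((-1) ^+ m * (q ^_ m)%:R * (1 - p%:R / 2%:R * (harm q - harm (q - m)))).
Proof.
move=> mq; have qp : (q < p)%N by rewrite /q pE; lia.
have := rising_shift_negn_expand pp qp mq i2_int.
rewrite (_ : p%:R * 2%:R^-1 - q%:R = 2%:R^-1) //.
by rewrite natpE natqE; field.
Qed.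

(* The power of 2 comes from C(2q,q) = 4^q (1/2)_q / q! with 2q = p - 1. *)
Lemma two_pow_cg : cg p 2 (2%:R ^+ (p - 1)) (1 - p%:R / 2%:R * harm q).
Proof.
have qp : (q < p)%N by rewrite /q pE; lia.
have i2Z := i2_int; have hZ := harm_int pp qp.
have fu : (q`!%:R : rat) \in punit p by apply: punit_fact.
have h := rising_half (leqnn q);
  rewrite subnn ffactnn /harm big_ord0 subr0 -/(harm q) in h.
have m1Z : -1 \in pintegral p by zint.
have h1 := rising_expand pp qp m1Z.
(* As 2q = p - 1, (1 - p)_q is a second expression for C(2q,q) q!, up to sign. Comparing both gives
   4^q (1 - p H_q/2) = 1 - p H_q modulo p^2. *)
have e1 : rising (1 + p%:R * -1) q = (-1) ^+ q * ('C(2 * q, q)%:R * q`!%:R).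
  rewrite (_ : 1 + p%:R * -1 =
    - (2 * q)%:R); first by rewrite rising_negn -?mulrA //; lia.
  by rewrite natrM natpE natqE; ring.
have e2 : (-1) ^+ q * ('C(2 * q, q)%:R * q`!%:R) = (-1) ^+ q * (4%:R ^+ q
  * rising (2%:R^-1) q).
  by rewrite bin_double_rising divfK // (punit_neq0 fu).
rewrite e1 e2 in h1.
have sgn : (-1) ^+ q * (-1) ^+ q = 1 :> rat by rewrite -exprMn mulrNN mulr1 expr1n.
have h2 : cg p 2 (q`!%:R * (4%:R ^+ q * (1 - p%:R / 2%:R * harm q)))
     (q`!%:R * (1 + p%:R * -1 * harm q)).
  apply: cg_trans _ h1.
  have -> : q`!%:R * (4%:R ^+ q * (1 - p%:R / 2%:R * harm q)) =
    (-1) ^+ q * (4%:R ^+ q * ((-1) ^+ q * q`!%:R * (1 - p%:R / 2%:R * harm q))).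
    move: ((-1) ^+ q) ((4%:R : rat) ^+ q) (1 - _) sgn => sg W v sgn.
    by apply: (@etrans _ _ (sg * sg * (q`!%:R * (W * v)))); [rewrite sgn mul1r | ring].
  have s1Z : (-1) ^+ q \in pintegral p by zint.
  have s2Z : (4%:R : rat) ^+ q \in pintegral p by zint.
  by apply: cgMl s1Z (cgMl s2Z (cg_sym h)).
have -> : (2%:R : rat) ^+ (p - 1) = 4%:R ^+ q.
  rewrite (_ : p - 1 = 2 * q)%N; last by rewrite /q pE; lia.
  by rewrite exprM; congr (_ ^+ _); rewrite expr2 -natrM.
have u : 1 - p%:R / 2%:R * harm q \in punit p.
  apply: (punit_cg pp (e := 1) (b := 1)) => //; last exact: punit1.
  by exists (- (2%:R^-1 * harm q)); [zint | ring].
have [c cZ hc] := cg_cancel fu h2.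
apply: (cg_cancel u); rewrite mulrC hc.
exists (c - 2%:R^-1 ^+ 2 * harm q ^+ 2); first by zint.
by field.
Qed.

Let CL : rat := 'C(4 * k + 4, 2 * k + 2)%:R.
Let CS : rat := 'C(2 * k + 2, k + 1)%:R.
Let E : rat := harm (2 * k + 1) - harm k.

(** Because (2k+2) + k = (k+1) + (2k+1) = q, the falling factorials of q are q!/k! and q!/(2k+1)!.
    In the quotient [CL] / [CS] all factorials then cancel, leaving a power of 2 and a harmonic
    correction. *)
Lemma central_bins_cg :
  cg p 2 (2%:R * (-1) ^+ k * CL * (1 + p%:R * E / 2%:R)) (- 4%:R ^+ (k + 1) * CS).
Proof.
have l1 : (2 * k + 2 <= q)%N by rewrite /q; lia.
have l2 : (k + 1 <= q)%N by rewrite /q; lia.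
have e1 : (q - (2 * k + 2) = k)%N by rewrite /q; lia.
have e2 : (q - (k + 1) = 2 * k + 1)%N by rewrite /q; lia.
have e3 : (2 * k + 2 = (2 * k + 1).+1)%N by lia.
have e4 : ((2 * k + 1).+1 = 2 * (k + 1))%N by lia.
have e5 : (4 * k + 4 = 2 * (2 * k + 2))%N by lia.
have e6 : (2 * k + 2 = 2 * (k + 1))%N by lia.
have e7 : (2 * k + 2 = (k + 1) * 2)%N by lia.
have u2 : (2%:R : rat) \in punit p by apply: punit_lt => //; rewrite pE; lia.
have k1 : ((k + 1)%:R : rat) \in punit p by apply: punit_lt => //; rewrite pE; lia.
have fk : (k`!%:R : rat) \in punit p by apply: punit_fact => //; rewrite pE; lia.
have fm : ((2 * k + 1)`!%:R : rat) \in punit p by apply: punit_fact => //; rewrite pE;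
  lia.
have i2Z := i2_int.
have qp : (q < p)%N by rewrite /q pE; lia.
have hqZ := harm_int pp qp.
have h1Z : harm k \in pintegral p by apply: harm_int => //; rewrite pE; lia.
have h2Z : harm (2 * k + 1) \in pintegral p by apply: harm_int => //; rewrite pE; lia.
have hL := rising_half l1; have hS := rising_half l2.
rewrite e1 in hL; rewrite e2 in hS.
have fq : (q`!%:R : rat) \in punit p by apply: punit_fact.
have f1 : (q ^_ (2 * k + 2))%:R = q`!%:R / k`!%:R :> rat.
  by rewrite -(ffact_fact l1) e1 natrM mulfK // (punit_neq0 fk).
have f2 : (q ^_ (k + 1))%:R = q`!%:R / (2 * k + 1)`!%:R :> rat.
  by rewrite -(ffact_fact l2) e2 natrM mulfK // (punit_neq0 fm).
have g1 : (2 * k + 2)`!%:R = 2%:R * (k + 1)%:R * (2 * k + 1)`!%:R :> rat.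
  by rewrite e3 factS natrM e4 natrM.
have g2 : (k + 1)`!%:R = (k + 1)%:R * k`!%:R :> rat by rewrite addn1 factS natrM.
have eL : CL = 4%:R ^+ (2 * k + 2) * rising (2%:R^-1) (2 * k + 2) / (2 * k + 2)`!%:R.
  by rewrite -bin_double_rising /CL e5.
have eS : CS = 4%:R ^+ (k + 1) * rising (2%:R^-1) (k + 1) / (k + 1)`!%:R.
  by rewrite -bin_double_rising /CS e6.
have e16 : (4%:R : rat) ^+ (2 * k + 2) = 4%:R ^+ (k + 1) ^+ 2.
  by rewrite -exprM e7.
rewrite f1 in hL; rewrite f2 in hS.
have sL : (-1) ^+ (2 * k + 2) = 1 :> rat.
  by rewrite e6 exprM sqrrN !expr1n.
have sS : (-1) ^+ (k + 1) = - (-1) ^+ k :> rat by rewrite addn1 exprS mulN1r.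
rewrite sL mul1r in hL; rewrite sS in hS.
have [c cZ hc] := hL; have [d dZ hd] := hS.
rewrite eL eS e16 hc hd g1 g2 /E.
have [n1 [n2 [n3 n4]]]
  := (punit_neq0 fk, (punit_neq0 fm, (punit_neq0 k1, punit_neq0 u2))).
set F := (4%:R : rat) ^+ (k + 1); have FZ : F \in pintegral p by rewrite /F; zint.
set sg := (-1) ^+ k; have sZ : sg \in pintegral p by rewrite /sg; zint.
have sE : 1 + p%:R * (harm (2 * k + 1) - harm k) / 2%:R \in pintegral p by zint.
exists (sg * F ^+ 2 / ((k + 1)%:R * (2 * k + 1)`!%:R) * c * (1 + p%:R * (harm (2 * k
  + 1) - harm k) / 2%:R)
   + F ^+ 2 / ((k + 1)%:R * k`!%:R) * d
   - sg * F ^+ 2 * q`!%:R / (k`!%:R * (2 * k + 1)`!%:R * (k + 1)%:R) * 2%:R^-1 ^+ 2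
     * (harm q - harm k) * (harm (2 * k + 1) - harm k)).
  have v1 := punitVr (punitM k1 fm); have v2 := punitVr (punitM k1 fk).
  have v3 := punitVr (punitM (punitM fk fm) k1).
  by zint; first [exact: punit_int v1 | exact: punit_int v2 | exact: punit_int v3].
have n5 : k%:R + 1 != 0 :> rat by rewrite natr1 -addn1.
by field; rewrite n1 n2 n5.
Qed.

Let i6 : rat := 6%:R^-1.
Let t : rat := p%:R * (5%:R / 6%:R).
Let Psi (s : rat) : rat := rising (1 - p%:R * s) k * rising (1 + p%:R * s) (4 * k + 3).

(* The factor p of the middle product comes from its (k+1)-st term. *)
Lemma rising_mid s : rising (1 - i6 + (p%:R * s - p%:R + t)) n =
  (-1) ^+ k * (p%:R * s) * Psi s.
Proof.
have ne : n = (k + (4 * k + 3).+1)%N by rewrite /n; lia.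
have i6p : i6 = (p%:R * 5%:R) * i6 - n%:R.
  by rewrite /i6 natpE /n natrD natrM; field.
have -> : 1 - i6 + (p%:R * s - p%:R + t) = p%:R * s - k%:R.
  have hn : n%:R = 5%:R * k%:R + 4%:R :> rat by rewrite /n natrD natrM.
  have hp := natpE; have ht : t = p%:R * 5%:R * i6 by rewrite /t /i6; ring.
  have : i6 = t - n%:R by rewrite ht -i6p.
  by rewrite hn => ->; rewrite hp; ring.
rewrite ne rising_add rising_negn_shift subrK risingSl /Psi.
by rewrite [p%:R * s + 1]addrC; ring.
Qed.

(** Since t = 5p/6, the three numerators are the middle products at s = 1/6, 1 and 11/6. Each
    contributes a factor p s, and the last factor t of (1/6)_(n+1) the other p. *)
Lemma bracket_two :
  6%:R * (rising i6 n.+1 * (3%:R * rising (1 - i6) n / n`!%:R ^+ 2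
       - 3%:R * rising (1 - i6 + t) n / (n`!%:R * rising (1 + t) n)
       + rising (1 - i6 + 2%:R * t) n / rising (1 + t) n ^+ 2)) =
  p%:R ^+ 2 * (5%:R * (rising (1 - t) n * (2%:R^-1 * Psi i6 / n`!%:R ^+ 2
       - 3%:R * Psi 1 / (n`!%:R * rising (1 + t) n)
       + 11%:R / 6%:R * Psi (11%:R / 6%:R) / rising (1 + t) n ^+ 2))).
Proof.
have i6p : i6 = t - n%:R.
  by rewrite /i6 /t natpE /n natrD natrM; field.
have h1 := rising_mid i6; have h2 := rising_mid 1; have h3 := rising_mid (11%:R / 6%:R).
rewrite (_ : 1 - i6 + (p%:R * i6 - p%:R
  + t) = 1 - i6) in h1; last by rewrite /i6 /t; field.
rewrite (_ : 1 - i6 + (p%:R * 1 - p%:R + t) = 1 - i6 + t) in h2; last by ring.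
rewrite (_ : 1 - i6 + (p%:R * (11%:R / 6%:R) - p%:R + t) = 1 - i6 + 2%:R * t) in h3;
  last by rewrite /t; field.
rewrite h1 h2 h3 risingS.
have -> : i6 + n%:R = t by rewrite i6p subrK.
have -> : rising i6 n = (-1) ^+ k * rising (1 - t) n.
  rewrite {1}i6p rising_negn_shift; congr (_ * _).
  rewrite /n (_ : 5 * k + 4 = k + 2 * (2 * k + 2))%N; last by lia.
  by rewrite exprD exprM sqrrN !expr1n mulr1.
have f0 : (n`!%:R : rat) != 0 by rewrite pnatr_eq0 -lt0n fact_gt0.
have r0 : rising (1 + t) n != 0.
  have t0 : 0 <= t by apply: mulr_ge0; [exact: ler0n | apply: divr_ge0; exact: ler0n].
  by rewrite gt_eqF //; apply: rising_gt0; lra.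
have sg : (-1) ^+ k * (-1) ^+ k = 1 :> rat by rewrite -exprMn mulrNN mulr1 expr1n.
move: (rising (1 + t) n) r0 (rising (1
  - t) n) (Psi i6) (Psi 1) (Psi (11%:R / 6%:R)) => B r0 A P1 P2 P3.
move: ((-1) ^+ k) sg => sg sg1.
apply: (@etrans _ _ ((sg * sg) * (p%:R ^+ 2 * (5%:R * (A * (2%:R^-1 * P1 / n`!%:R ^+ 2
       - 3%:R * P2 / (n`!%:R * B)
         + 11%:R / 6%:R * P3 / B ^+ 2)))))); last by rewrite sg1 mul1r.
by rewrite /i6 /t; field; rewrite f0 r0.
Qed.

Let L : rat := k`!%:R.
Let M : rat := (2 * k + 1)`!%:R.

(** (-1)^j C(p-1,j) is the product of 1 - p/i over 1 <= i <= j. *)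
Lemma fact_reflect j : (j < p)%N ->
  cg p 2 ((-1) ^+ j * (p.-1)`!%:R) ((p.-1 - j)`!%:R * (j`!%:R * (1 - p%:R * harm j))).
Proof.
move=> jp; have jp' : (j <= p.-1)%N by lia.
have m1Z : -1 \in pintegral p by zint.
have h := rising_expand pp jp m1Z.
have fZ : (p.-1 - j)`!%:R \in pintegral p by zint.
have e : rising (1 + p%:R * -1) j = (-1) ^+ j * 'C(p.-1, j)%:R * j`!%:R.
  rewrite -rising_negn //; congr (rising _ _).
  have p1 : (p%:R : rat) = p.-1%:R + 1 by rewrite natr1 prednK // prime_gt0.
  by rewrite p1; ring.
rewrite e in h; have := cgMl fZ h.
have -> : (p.-1 - j)`!%:R * ((-1) ^+ j * 'C(p.-1, j)%:R * j`!%:R) =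
    (-1) ^+ j * (p.-1)`!%:R :> rat.
  by rewrite -(bin_fact jp') !natrM; ring.
by rewrite mulrN1 mulNr.
Qed.

Lemma bracket_two_cg :
  cg p 2 (rising (1 - t) n * (2%:R^-1 * Psi i6 / n`!%:R ^+ 2
       - 3%:R * Psi 1 / (n`!%:R * rising (1 + t) n)
       + 11%:R / 6%:R * Psi (11%:R / 6%:R) / rising (1 + t) n ^+ 2))
   ((-1) ^+ k * (2%:R / 3%:R * (L ^+ 2 / M) * (1 + p%:R * E / 3%:R))).
Proof.
have np : (n < p)%N by rewrite /n pE; lia.
have kp : (k < p)%N by rewrite pE; lia.
have k2p : (2 * k + 1 < p)%N by rewrite pE; lia.
have k4p : (4 * k + 3 < p)%N by rewrite pE; lia.
have r1 : (p.-1 - k = n)%N by rewrite /n pE; lia.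
have r2 : (p.-1 - (2 * k + 1) = 4 * k + 3)%N by rewrite pE; lia.
have sk2 : (-1) ^+ (2 * k + 1) = -1 :> rat.
  by rewrite exprD exprM sqrrN !expr1n mul1r expr1.
have iZ : i6 \in pintegral p := sixth_int_two.
have i2Z := i2_int.
have fu : n`!%:R \in punit p := punit_fact pp np.
have Lu : L \in punit p := punit_fact pp kp.
have Mu : M \in punit p := punit_fact pp k2p.
have Nu : (4 * k + 3)`!%:R \in punit p := punit_fact pp k4p.
have fr1 := fact_reflect kp; rewrite r1 -/L in fr1.
have fr2 := fact_reflect k2p; rewrite r2 sk2 mulN1r -/M in fr2.
have hh := harm_reflect k2p; rewrite r2 in hh.
have a1Z := harm_int pp kp; have a2Z := harm_int pp k2p.
have a4Z := harm_int pp k4p; have etaZ := harm_int pp np.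
pose tau' : rat := 5%:R * i6.
have tE' : t = p%:R * tau' by rewrite /t /tau' /i6; field.
have tauZ : tau' \in pintegral p by rewrite /tau'; zint.
have mtauZ : - tau' \in pintegral p by zint.
have hA := rising_expand pp np mtauZ; rewrite mulrN -tE' in hA.
have hB := rising_expand pp np tauZ; rewrite -tE' in hB.
set A := rising (1 - t) n in hA *; set B := rising (1 + t) n in hB *.
set f := n`!%:R in fu hA hB fr1 *; set eta := harm n in etaZ hA hB.
set N := (4 * k + 3)`!%:R in Nu fr2.
set a1 := harm k in a1Z fr1; set a2 := harm (2 * k + 1) in a2Z fr2 hh.
set a4 := harm (4 * k + 3) in a4Z hh.
have tZ : t \in pintegral p by rewrite tE'; zint.
have Bu : B \in punit p.
  apply: (punit_cg_near (z := tau' * eta) pp _ fu _ _ hB).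
  - by [].
  - by zint.
  - by rewrite tE'; ring.
pose E' := a4 - a1.
have E'Z : E' \in pintegral p by rewrite /E'; zint.
have hPsi s : s \in pintegral p ->
    cg p 2 (Psi s) (L * N * (1 + p%:R * s * E')).
  move=> sZ; have msZ : - s \in pintegral p by zint.
  have h1 := rising_expand pp kp msZ; rewrite mulrN -/L -/a1 in h1.
  have h2 := rising_expand pp k4p sZ; rewrite -/N -/a4 in h2.
  have Z1 : L * (1 + - (p%:R * s) * a1) \in pintegral p by zint.
  have Z2 : rising (1 + p%:R * s) (4 * k + 3) \in pintegral p.
    by apply: cg_int h2 _; zint.
  apply: cg_trans (cgM Z1 Z2 h1 h2) _.
  exists (- L * N * s ^+ 2 * a1 * a4); first by zint.
  by rewrite /E'; ring.
have hP1 := hPsi _ iZ; have hP2 := hPsi _ (pintegral1 p).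
have siZ : 11%:R / 6%:R \in pintegral p by rewrite -/i6; zint.
have hP3 := hPsi _ siZ.
set P1 := Psi i6 in hP1 *; set P2 := Psi 1 in hP2 *.
set P3 := Psi (11%:R / 6%:R) in hP3 *.
have P1Z : P1 \in pintegral p by apply: cg_int hP1 _; zint.
have P2Z : P2 \in pintegral p by apply: cg_int hP2 _; zint.
have P3Z : P3 \in pintegral p by apply: cg_int hP3 _; zint.
have AZ : A \in pintegral p by apply: cg_int hA _; zint.
have fi : f^-1 \in pintegral p := punitV_int fu.
have Mi : M^-1 \in pintegral p := punitV_int Mu.
have [f0 [B0 M0]] := (punit_neq0 fu, (punit_neq0 Bu, punit_neq0 Mu)).
have hBi : cg p 2 B^-1 (f^-1 * (1 - t * eta)).
  apply: (cg_cancel Bu); rewrite mulfV //.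
  have mZ : f^-1 * (1 - t * eta) \in pintegral p by zint.
  apply: cg_sym; apply: cg_trans (cgMr mZ hB) _.
  exists (- tau' ^+ 2 * eta ^+ 2); first by zint.
  by rewrite tE'; field.
have BiZ : B^-1 \in pintegral p := punitV_int Bu.
have -> : A * (2%:R^-1 * P1 / f ^+ 2 - 3%:R * P2 / (f * B) + 11%:R / 6%:R * P3 / B ^+ 2) =
  A * (2%:R^-1 * P1 * f^-1 ^+ 2 - 3%:R * P2 * f^-1 * B^-1
    + 11%:R / 6%:R * P3 * B^-1 ^+ 2).
  by field; rewrite f0 B0.
eapply cg_trans; first by cgsub; zint.
(* The constant is 1/2 - 3 + 11/6 = -2/3. To first order the terms in [eta] = H_n cancel: the first
   factor gives 2/3 t H_n, the inverse powers of [B] give -2/3 t H_n. *)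
apply: (@cg_trans _ _ (- (2%:R / 3%:R) * (L * N / f) * (1 + p%:R * E' - 2%:R * t * E'))).
  exists (L * N / f * (- 125%:R * i6 ^+ 2 * E' * eta
    + 6375%:R * i6 ^+ 4 * E' * eta ^+ 2 * p%:R
    - 15125%:R * i6 ^+ 5 * E' * eta ^+ 3 * p%:R ^+ 2
    + 375%:R * i6 ^+ 3 * eta ^+ 2 - 1375%:R * i6 ^+ 4 * eta ^+ 3 * p%:R)); first by zint.
  by rewrite tE' /tau' /i6; field.
have sZ : (-1) ^+ k \in pintegral p by zint.
have sg1 : (-1) ^+ k * (-1) ^+ k = 1 :> rat by rewrite -exprMn mulrNN mulr1 expr1n.
have [c cZ hc] := fr1; have [d dZ hd] := fr2; have [c' c'Z hc'] := hh.
set sg := (-1) ^+ k in sZ sg1 hc *.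
have hNM : N * M * (1 - p%:R * a2) =
    - sg * f * L * (1 - p%:R * a1) - p%:R ^+ 2 * (sg * c + d).
  have h1 : N * (M * (1 - p%:R * a2)) = - (p.-1)`!%:R - p%:R ^+ 2 * d by rewrite hd; ring.
  have h2 : f * (L * (1 - p%:R * a1)) = sg * (p.-1)`!%:R
    - p%:R ^+ 2 * c by rewrite hc; ring.
  apply: (@etrans _ _ (- sg * (f * (L * (1 - p%:R * a1))) - p%:R ^+ 2 * (sg * c
    + d))); last by ring.
  rewrite -mulrA h1 h2.
  apply: (@etrans _ _ (- (sg * sg) * (p.-1)`!%:R - p%:R ^+ 2 * d)); last by ring.
  by rewrite sg1; ring.
(* Reflection at k, with p - 1 - k = n, and at 2k + 1, with p - 1 - (2k+1) = 4k + 3, eliminates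
   (p-1)! and replaces n! and (4k+3)! by the smaller factorials. *)
have hLN : cg p 2 (L * N / f) (- sg * (L ^+ 2 / M) * (1 + p%:R * (a2 - a1))).
  apply: (cg_cancel (punitM fu Mu)).
  have -> : f * M * (L * N / f) = L * (N * M) by field.
  have -> : f * M * (- sg * (L ^+ 2 / M) * (1 + p%:R * (a2 - a1))) =
    - sg * f * L ^+ 2 * (1 + p%:R * (a2 - a1)) by field.
  exists (L * (N * M * a2 ^+ 2 + sg * f * L * a1 * a2 - (sg * c + d) * (1 + p%:R * a2))).
    by zint.
  apply: (@etrans _ _ (L * (N * M * (1 - p%:R * a2) * (1 + p%:R * a2)
    + N * M * p%:R ^+ 2 * a2 ^+ 2))).
    by ring.
  by rewrite hNM; ring.
have i3Z : 2%:R / 3%:R \in pintegral p.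
  by rewrite (_ : 2%:R / 3%:R = 4%:R * i6); [zint | rewrite /i6; field].
have [e eZ he] := hLN; rewrite he.
have i3Z' : 3%:R^-1 \in pintegral p.
  by rewrite (_ : 3%:R^-1 = 2%:R * i6); [zint | rewrite /i6; field].
have EE : E' = a2 - a1 + p%:R ^+ 1 * c' by rewrite /E' hc'; ring.
exists (- (2%:R / 3%:R) * e * (1 + p%:R * E' - 2%:R * t * E')
   - sg * (2%:R / 3%:R) * (L ^+ 2 / M) * (2%:R / 3%:R)
     * ((a2 - a1) ^+ 2 + c' + p%:R * (a2 - a1) * c')).
  by zint.
rewrite EE tE' /tau' /i6 /E -/a1 -/a2.
by field.
Qed.

Lemma sum_two :
  cg p 4 (\sum_(j < p) (12 * j + 1)%:R * gbinom (- i6) j ^+ 4)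
    (p%:R ^+ 2 * (5%:R * ((-1) ^+ k * (2%:R / 3%:R * (L ^+ 2 / M) * (1
      + p%:R * E / 3%:R))))).
Proof.
have np : (n < p)%N by rewrite /n pE; lia.
have nc : (6 * n + 1 = 5 * p)%N by rewrite /n pE; lia.
have := sum_closed_form pp p_gt3_two np nc; rewrite -/i6 -/t bracket_two.
move/cg_trans; apply; apply: (@cg_pM _ 2 2).
by apply: cgMl; [zint | exact: bracket_two_cg].
Qed.

(** On the right 2^(p-1) + 3p - 4 is -3(1 - p - pE/6) modulo p^2, as 2^(p-1) = 1 + pE/2. Multiplied
    by 1 + pE/2 from the two central binomials and by the 1 + p below, it becomes -3(1 + pE/3). *)
Lemma target_two :
  cg p 2 (5%:R * ((-1) ^+ k * (2%:R / 3%:R * (L ^+ 2 / M) * (1 + p%:R * E / 3%:R))))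
    (20%:R * 2%:R ^+ (2 * k + 2) * (2%:R ^+ (p - 1) + 3%:R * p%:R - 4%:R) / (3%:R * CL)).
Proof.
have qp : (q < p)%N by rewrite /q pE; lia.
have i2Z := i2_int; have iZ : i6 \in pintegral p := sixth_int_two.
have kp : (k < p)%N by rewrite pE; lia.
have k2p : (2 * k + 1 < p)%N by rewrite pE; lia.
have k22p : (2 * k + 2 < p)%N by rewrite pE; lia.
have k44p : (4 * k + 4 < p)%N by rewrite pE; lia.
have l1 : (k + 1 <= 2 * k + 2)%N by lia.
have l2 : (2 * k + 2 <= 4 * k + 4)%N by lia.
have d1 : (2 * k + 2 - (k + 1) = k.+1)%N by lia.
have e2k : (2 * k + 2 = (2 * k + 1).+1)%N by lia.
have e22 : (2 * k + 2 = 2 * (k + 1))%N by lia.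
have u3 : (3%:R : rat) \in punit p by apply: punit_lt => //; rewrite pE; lia.
have Lu : L \in punit p := punit_fact pp kp.
have Mu : M \in punit p := punit_fact pp k2p.
have CSu : CS \in punit p := bin_unit k22p l1.
have CLu : CL \in punit p := bin_unit k44p l2.
have a1Z := harm_int pp kp; have a2Z := harm_int pp k2p.
have EZ : E \in pintegral p by rewrite /E; zint.
have hqZ := harm_int pp qp.
have hE := harm_half; have h2p := two_pow_cg; have hc := central_bins_cg.
have [L0 [M0 [CS0 CL0]]]
  := (punit_neq0 Lu, (punit_neq0 Mu, (punit_neq0 CSu, punit_neq0 CLu))).
have k10 : (k%:R + 1 : rat) != 0 by rewrite natr1 pnatr_eq0.
have pu : 1 + p%:R \in punit p.
  by apply: (punit_cg pp (e := 1) (b := 1)); [| exists 1; [zint | ring] | exact: punit1].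
have p10 := punit_neq0 pu.
(* Here 1 + p = 6(k+1) brings in the factor that the term 3p of the target compensates. *)
have LM : L ^+ 2 / M = 12%:R / ((1 + p%:R) * CS).
  have : CS * ((k + 1)`!%:R * (k.+1)`!%:R) = (2 * k + 2)`!%:R.
    by rewrite -!natrM -(bin_fact l1) d1.
  rewrite addn1 factS e2k factS -e2k !natrM -/L -/M => h.
  have hp : (p%:R : rat) = 6%:R * (k%:R + 1) - 1 by rewrite natpE; ring.
  have e1 : ((2 * k + 2)%:R : rat) = 2%:R * (k%:R + 1) by rewrite e22 natrM natrD.
  have e3 : (k.+1%:R : rat) = k%:R + 1 by rewrite natr1.
  rewrite e1 e3 in h.
  have h' : CS * (k%:R + 1) * L ^+ 2 = 2%:R * M.
    apply: (mulIf k10); apply: (@etrans _ _ (2%:R * (k%:R + 1) * M)); last by ring.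
    by rewrite -h; ring.
  have -> : 1 + p%:R = 6%:R * (k%:R + 1) :> rat by rewrite hp; ring.
  have -> : L ^+ 2 = 2%:R * M / (CS * (k%:R + 1)).
    by rewrite -h' mulrAC divff ?mul1r ?mulf_neq0.
  by field; rewrite M0 CS0 k10.
rewrite LM.
have [x xZ hx] : cg p 2 (2%:R ^+ (p - 1)) (1 + p%:R * E / 2%:R).
  have [y yZ hy] := hE; apply: cg_trans h2p _.
  exists (- (2%:R^-1 * y)); first by zint.
  by rewrite -/E in hy; rewrite hy; field.
have e4 : (2%:R : rat) ^+ (2 * k + 2) = 4%:R ^+ (k + 1).
  by rewrite e22 exprM; congr (_ ^+ _); rewrite expr2 -natrM.
have [z zZ hz] := hc.
rewrite e4 hx.
apply: (cg_cancel (punitM (punitM (punitM u3 pu) CSu) CLu)).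
set F := (4%:R : rat) ^+ (k + 1) in hz *; have FZ : F \in pintegral p by rewrite /F; zint.
set sg := (-1) ^+ k in hz *; have sZ : sg \in pintegral p by rewrite /sg; zint.
have hFC : F * CS = - 2%:R * sg * CL * (1 + p%:R * E / 2%:R) + p%:R ^+ 2 * z.
  apply: (@etrans _ _ (- (- F * CS + p%:R ^+ 2 * z) + p%:R ^+ 2 * z)); first by ring.
  by rewrite -hz; ring.
have CLZ := punit_int CLu; have CSZ := punit_int CSu.
have -> : 3%:R * (1 + p%:R) * CS * CL * (5%:R * (sg * (2%:R / 3%:R * (12%:R / ((1
  + p%:R) * CS)) * (1 + p%:R * E / 3%:R)))) = 120%:R * sg * CL * (1 + p%:R * E / 3%:R).
  by field; rewrite p10 CS0.
have -> : 3%:R * (1 + p%:R) * CS * CL *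
   (20%:R * F * (1 + p%:R * E / 2%:R + p%:R ^+ 2 * x
     + 3%:R * p%:R - 4%:R) / (3%:R * CL)) =
   20%:R * (1 + p%:R) * (F * CS) * (1 + p%:R * E / 2%:R + p%:R ^+ 2 * x
     + 3%:R * p%:R - 4%:R).
  by field.
rewrite hFC.
exists (60%:R * CL * E * p%:R * sg + 20%:R * CL * E * p%:R * sg * x
  + 20%:R * CL * E * p%:R ^+ 2 * sg * x + 20%:R * CL * E * sg
  + 10%:R * CL * E ^+ 2 * p%:R * sg + 10%:R * CL * E ^+ 2 * sg
  + 40%:R * CL * p%:R * sg * x + 120%:R * CL * sg
  + 40%:R * CL * sg * x - 10%:R * E * p%:R * z - 10%:R * E * p%:R ^+ 2 * z
  - 20%:R * p%:R ^+ 2 * x * z - 60%:R * p%:R ^+ 2 * z - 20%:R * p%:R ^+ 3 * x * z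
  + 60%:R * z); first by zint.
by field.
Qed.

Lemma case_two_aux :
  pcongr p (p ^ 4) (\sum_(j < p) (12 * j + 1)%:R * gbinom (- (1 / 6%:R)) j ^+ 4)
     ((20%:R * 2%:R ^+ ((p + 1) %/ 3)
         * (2%:R ^+ (p - 1) + 3%:R * p%:R - 4%:R) * p%:R ^+ 2)
      / (3%:R * 'C(2 * (p + 1) %/ 3, (p + 1) %/ 3)%:R)).
Proof.
have e1 : ((p + 1) %/ 3 = 2 * k + 2)%N by lia.
have e2 : (2 * (p + 1) %/ 3 = 4 * k + 4)%N by lia.
rewrite e1 e2 div1r -/i6 -/CL.
have l2 : (2 * k + 2 <= 4 * k + 4)%N by lia.
have k44p : (4 * k + 4 < p)%N by rewrite pE; lia.
have u3 : (3%:R : rat) \in punit p by apply: punit_lt => //; rewrite pE; lia.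
have CLu : CL \in punit p := bin_unit k44p l2.
have Vu := punitV_int (punitM u3 CLu).
apply: cg_pcongr; last by zint.
apply: cg_trans sum_two _.
rewrite [X in cg _ _ _ X]mulrAC [X in cg _ _ _ X]mulrC.
apply: (@cg_pM _ 2 2); exact: target_two.
Qed.
End CaseTwo.

Lemma case_two (p : nat) : prime p -> (3 < p)%N -> (p = 2 %[mod 3])%N ->
  pcongr p (p ^ 4) (\sum_(k < p) (12 * k + 1)%:R * gbinom (- (1 / 6%:R)) k ^+ 4)
     ((20%:R * 2%:R ^+ ((p + 1) %/ 3)
         * (2%:R ^+ (p - 1) + 3%:R * p%:R - 4%:R) * p%:R ^+ 2)
      / (3%:R * 'C(2 * (p + 1) %/ 3, (p + 1) %/ 3)%:R)).
Proof.
move=> pp p3 p2; have podd : odd p by case: (even_prime pp) p3 => // ->.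
have pE : p = (6 * (p %/ 6) + 5)%N by lia.
exact: case_two_aux pp pE.
Qed.

Theorem theorem5p6 (p : nat) (p_prime : prime p) (p_gt3 : (3 < p)%N) :
  let S : rat := \sum_(k < p) (12 * k + 1)%:R * gbinom (- (1 / 6%:R)) k ^+ 4 in
  ((p = 1 %[mod 3])%N ->
   forall x y : int,
     p%:Z = x ^+ 2 + 3%:Z * y ^+ 2 ->
     (x = 1 %[mod 3])%Z ->
     (y = 0 %[mod 3])%Z \/ (y = 1 %[mod 3])%Z ->
     let u : rat :=
       if (3 %| y)%Z then (- (2%:Z * x))%:~R else (x - 3%:Z * y)%:~R in
     pcongr p (p ^ 4) S
       (- (p%:R * u) + p%:R ^+ 2 / u + p%:R ^+ 3 / u ^+ 3))
  /\
  ((p = 2 %[mod 3])%N ->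
   pcongr p (p ^ 4) S
     ((20%:R * 2%:R ^+ ((p + 1) %/ 3)
         * (2%:R ^+ (p - 1) + 3%:R * p%:R - 4%:R) * p%:R ^+ 2)
      / (3%:R * 'C(2 * (p + 1) %/ 3, (p + 1) %/ 3)%:R))).
Proof.
move=> S; split; last exact: case_two.
move=> p1 x y px x1 y01 u; exact: case_one.
Qed.
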